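(* Let $\pi\propto e^{-V}$ be a probability measure on $\mathbb{R}^d$ satisfying a weak Poincaré inequality with some weight function $\beta_{\mathsf{WPI}}$ and with $\Phi(\cdot)=\operatorname{Osc}(\cdot)^2$. Let $(X_t)_{t\ge 0}$ be the Langevin diffusion $\mathrm{d}X_t=-\nabla V(X_t)\,\mathrm{d}t+\sqrt2\,\mathrm{d}B_t$, and let $\rho_t$ be the law of $X_t$. Let $2\le q<q'\le\infty$ be such that $R_{q'}(\rho_0\,\|\,\pi)<\infty$, and define $\delta_0:=\exp\big(q\,R_{q'}(\rho_0\,\|\,\pi)\big)$. Then for any $r>0$ (and $t\ge 0$), $$R_q(\rho_t\,\|\,\pi)\le\begin{cases}R_q(\rho_0\,\|\,\pi)-\dfrac{2-4r\delta_0}{\beta(r)\,q}\,t & \text{if } R_q(\rho_0\,\|\,\pi),\,R_q(\rho_t\,\|\,\pi)\ge 1,\\[2mm] e^{-\frac{2t}{\beta(r)q}}\big(R_q(\rho_0\,\|\,\pi)-2r\delta_0\big)+2r\delta_0 & \text{if } R_q(\rho_0\,\|\,\pi)<1,\end{cases}$$ where $$\beta(r):=\begin{cases}\beta_{\mathsf{WPI}}(r) & \text{if } q'=\infty,\\ \beta_{\mathsf{WPI}}\Big((r/5)^{\frac{q'}{q'-q}}\Big)\,\ln\Big((5/r)^{\frac{q'}{q'-q}}\vee 1\Big) & \text{if } q'<\infty.\end{cases}$$ Therefore, for $\varepsilon>0$, we have $R_q(\rho_T\,\|\,\pi)\le\varepsilon$ whenever $$T\ge q\,\beta\Big(\frac{1}{4\delta_0}\Big)R_q(\rho_0\,\|\,\pi)+\frac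 q2\,\beta\Big(\frac{\varepsilon}{4\delta_0}\Big)\ln\Big(\frac1\varepsilon\Big).$$
   Context: Weak Poincaré inequality (WPI): a probability measure $\pi$ on $\mathbb{R}^d$ satisfies a WPI with weight $\beta_{\mathsf{WPI}}$ and functional $\Phi$ if $\beta_{\mathsf{WPI}}:(0,\infty)\to\mathbb{R}_+$ is non-increasing, $\Phi:L^2(\pi)\to[0,\infty]$ satisfies $\Phi(cf+a)=c^2\Phi(f)$ for all $a,c\in\mathbb{R}$, $f\in L^2(\pi)$, and for every $f\in\mathcal{C}^\infty(\mathbb{R}^d)$, $\operatorname{Var}_\pi(f)\le\beta_{\mathsf{WPI}}(r)\,\mathbb{E}_\pi[\|\nabla f\|^2]+r\,\Phi(f)$ for all $r>0$. Here $\operatorname{Osc}(f)=\sup f-\inf f$. Rényi divergence: for $1<q<\infty$, $R_q(\rho\,\|\,\pi)=\frac1{q-1}\ln\big\|\frac{\mathrm{d}\rho}{\mathrm{d}\pi}\big\|_{L^q(\pi)}^q$ if $\rho\ll\pi$ and $+\infty$ otherwise; $R_\infty(\rho\,\|\,\pi)=\ln\|\mathrm{d}\rho/\mathrm{d}\pi\|_{L^\infty(\pi)}$. $(B_t)$ is a standard $d$-dimensional Brownian motion. All probability measures are assumed to have densities with respect to Lebesgue measure. Standing assumption: $\mathcal{C}^\infty(\mathbb{R}^d)$ forms a core for the domain of the generator of the Langevin diffusion (for example, this is given when $V$ is infinitely differentiable). $a\vee b=\max(a,b)$. *)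

(* Defs.v *)
From HB Require Import structures.
From mathcomp Require Import all_boot all_order all_algebra.
From mathcomp Require Import all_classical all_reals all_analysis.

Set Implicit Arguments.
Unset Strict Implicit.
Unset Printing Implicit Defensive.

Import Order.TTheory GRing.Theory Num.Theory.
Import numFieldNormedType.Exports.

Local Open Scope classical_set_scope.
Local Open Scope ring_scope.

(* The sigma-algebra on R^n generated by the coordinates, as the library does
   for n.-tuple; since n is finite this is the Borel sigma-algebra. *)
Definition rV_display (d : measure_display) : measure_display.
Proof. exact: d. Qed.

Section measurable_rV.
Context {R : realType} (n : nat).

Let coord (i : 'I_n) (x : 'rV[R]_n) : R := x ord0 i.

Let rV_set0 : g_sigma_preimage coord set0.
Proof. exact: sigma_algebra0. Qed.

Let rV_setC A : g_sigma_preimage coord A -> g_sigma_preimage coord (~` A).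
Proof. exact: sigma_algebraC. Qed.

Let rV_bigcup (F : (set 'rV[R]_n)^nat) :
  (forall i, g_sigma_preimage coord (F i)) ->
  g_sigma_preimage coord (\bigcup_i (F i)).
Proof. exact: sigma_algebra_bigcup. Qed.

HB.instance Definition _ := @isMeasurable.Build
  (rV_display default_measure_display) 'rV[R]_n
  (g_sigma_preimage coord) rV_set0 rV_setC rV_bigcup.

Lemma measurable_rV_coord (i : 'I_n) :
  measurable_fun [set: 'rV[R]_n] (fun x => x ord0 i : R).
Proof.
move=> _ Y mY; rewrite setTI; apply: sub_sigma_algebra => /=.
rewrite -bigcup_seq/=; exists i => /=; first by rewrite mem_index_enum.
by exists Y => //; rewrite setTI.
Qed.

Lemma measurable_fun_rVP d (T : measurableType d) (f : T -> 'rV[R]_n) :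
  (forall i, measurable_fun [set: T] (fun x => f x ord0 i : R)) ->
  measurable_fun [set: T] f.
Proof.
move=> mf _ A mA.
suff : g_sigma_preimage coord `<=` image_set_system [set: T] f measurable.
  exact.
  apply: smallest_sub => [|B].
    exact/sigma_algebra_image/sigma_algebra_measurable.
  rewrite -bigcup_seq => -[i _] [C mC <-].
  by have := mf i measurableT C mC; rewrite /image_set_system/= !setTI.
Qed.

End measurable_rV.

Section lebesgue_rV.
Context {R : realType}.

Definition rV_cons n (p : measurableTypeR R * 'rV[R]_n) : 'rV[R]_n.+1 :=
  \row_(i < n.+1) oapp (p.2 ord0) p.1 (unlift ord0 i).

Definition rV_uncons n (x : 'rV[R]_n.+1) : measurableTypeR R * 'rV[R]_n :=
  (x ord0 ord0, \row_(j < n) x ord0 (lift ord0 j)).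

Lemma rV_unconsK n : cancel (@rV_uncons n) (@rV_cons n).
Proof.
move=> x; apply/rowP => i; rewrite mxE.
by case: unliftP => [j ->|->] //=; rewrite mxE.
Qed.

Lemma rV_consK n : cancel (@rV_cons n) (@rV_uncons n).
Proof.
case=> a v; congr pair; rewrite /= ?mxE ?unlift_none//.
by apply/rowP => j; rewrite !mxE liftK.
Qed.

Lemma measurable_rV_cons n :
  measurable_fun [set: measurableTypeR R * 'rV[R]_n] (@rV_cons n).
Proof.
apply: measurable_fun_rVP => i.
case: (unliftP ord0 i) => [j ->|->].
  rewrite (_ : (fun _ => _) = (fun v : 'rV[R]_n => v ord0 j : R) \o snd).
    exact: measurableT_comp (measurable_rV_coord _) measurable_snd.
  by apply/funext => x /=; rewrite mxE liftK.
rewrite (_ : (fun _ => _) = fst); first exact: measurable_fst.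
by apply/funext => x /=; rewrite mxE unlift_none.
Qed.

Lemma measurable_rV_uncons n : measurable_fun [set: 'rV[R]_n.+1] (@rV_uncons n).
Proof.
apply: measurable_fun_pair; first exact: measurable_rV_coord.
apply: measurable_fun_rVP => i.
rewrite (_ : (fun _ => _) = (fun x : 'rV[R]_n.+1 => x ord0 (lift ord0 i) : R)).
  exact: measurable_rV_coord.
by apply/funext => x; rewrite mxE.
Qed.

Section step.
Variables (n : nat) (mu : {sigma_finite_measure set 'rV[R]_n -> \bar R}).

Definition lebesgue_rV_succ : set 'rV[R]_n.+1 -> \bar R :=
  pushforward (lebesgue_measure \x mu)%E (@rV_cons n).

Let preimage_rV_cons A : measurable A -> measurable (@rV_cons n @^-1` A).
Proof.
by move=> mA; rewrite -[X in measurable X]setTI; exact: measurable_rV_cons.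
Qed.

Let lebesgue_rV_succ0 : lebesgue_rV_succ set0 = 0%E.
Proof. by rewrite /lebesgue_rV_succ /pushforward preimage_set0 measure0. Qed.

Let lebesgue_rV_succ_ge0 A : (0 <= lebesgue_rV_succ A)%E.
Proof. by rewrite /lebesgue_rV_succ /pushforward; exact: measure_ge0. Qed.

Let lebesgue_rV_succ_sigma_additive : semi_sigma_additive lebesgue_rV_succ.
Proof.
move=> F mF tF mUF; rewrite /lebesgue_rV_succ /pushforward preimage_bigcup.
apply: measure_semi_sigma_additive.
- by move=> i; exact: preimage_rV_cons.
- apply/trivIsetP => /= i j _ _ ij; rewrite -preimage_setI.
  by move/trivIsetP : tF => /(_ _ _ _ _ ij) ->//; rewrite preimage_set0.
- by rewrite -preimage_bigcup; exact: preimage_rV_cons.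
Qed.

HB.instance Definition _ := isMeasure.Build _ _ _ lebesgue_rV_succ
  lebesgue_rV_succ0 lebesgue_rV_succ_ge0 lebesgue_rV_succ_sigma_additive.

Let lebesgue_rV_succ_sigma_finite : sigma_finite setT lebesgue_rV_succ.
Proof.
have /sigma_finiteP[F [FT ndF Foo]] := sigma_finiteT (@lebesgue_measure R).
have /sigma_finiteP[G [GT ndG Goo]] := sigma_finiteT mu.
exists (fun k => @rV_uncons n @^-1` (F k `*` G k)).
  rewrite -preimage_bigcup (_ : \bigcup_k _ = setT) ?preimage_setT//.
  rewrite -subTset => -[x y] _.
  have [k _ Fkx] : (\bigcup_k F k) x by rewrite -FT.
  have [l _ Gly] : (\bigcup_l G l) y by rewrite -GT.
  exists (maxn k l) => //; split => /=.
  - by move: x Fkx; exact/subsetPset/ndF/leq_maxl.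
  - by move: y Gly; exact/subsetPset/ndG/leq_maxr.
move=> k; have [mF Fkoo] := Foo k; have [mG Gkoo] := Goo k; split.
  rewrite -[X in measurable X]setTI; apply: measurable_rV_uncons => //.
  exact: measurableX.
rewrite /lebesgue_rV_succ /pushforward -comp_preimage.
rewrite (_ : _ \o _ = id); last by apply/funext => p /=; rewrite rV_consK.
by rewrite /= product_measure1E// lte_mul_pinfty// ge0_fin_numE.
Qed.

HB.instance Definition _ := Measure_isSigmaFinite.Build _ _ _ lebesgue_rV_succ
  lebesgue_rV_succ_sigma_finite.

End step.

(* Lebesgue measure on R^n as the n-fold product measure. *)
Fixpoint lebesgue_rV n : {sigma_finite_measure set 'rV[R]_n -> \bar R} :=
  match n with
  | 0 => \d_(0 : 'rV[R]_0)
  | m.+1 => lebesgue_rV_succ (lebesgue_rV m)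
  end.

Lemma lebesgue_rV_box n (A : 'I_n -> set R) : (forall i, measurable (A i)) ->
  lebesgue_rV n [set x | forall i, A i (x ord0 i)] =
  (\prod_(i < n) lebesgue_measure (A i))%E.
Proof.
elim: n A => [|n IHn] A mA.
  by rewrite big_ord0 /= diracE mem_set//= => -[].
have mbox : measurable
    [set x : 'rV[R]_n | forall i, A (lift ord0 i) (x ord0 i)].
  rewrite (_ : [set x | _] = \big[setI/setT]_(i < n)
      ((fun x : 'rV[R]_n => x ord0 i : R) @^-1` A (lift ord0 i))).
    apply: bigsetI_measurable => i _; rewrite -[X in measurable X]setTI.
    exact: measurable_rV_coord.
  rewrite -bigcap_seq; apply/seteqP; split => x /= h i.
    by move=> _; exact: h.
  by apply: (h i) => /=; rewrite mem_index_enum.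
rewrite big_ord_recl -IHn// /= /lebesgue_rV_succ /pushforward.
transitivity ((lebesgue_measure \x lebesgue_rV n)%E
    (A ord0 `*` [set x : 'rV[R]_n | forall i, A (lift ord0 i) (x ord0 i)]));
  last first.
  by rewrite product_measure1E//; exact: (mA ord0).
congr ((lebesgue_measure \x lebesgue_rV n)%E _).
apply/seteqP; split => -[a v] /=.
  move=> h; split => [|i]; first by have := h ord0; rewrite mxE unlift_none.
  by have := h (lift ord0 i); rewrite mxE liftK.
move=> [h0 h] i; rewrite mxE.
by case: unliftP => [j ->|->] //=.
Qed.

End lebesgue_rV.

Section calculus.
Context {R : realType} {d : nat}.
Implicit Types (f V : 'rV[R]_d -> R) (x u v : 'rV[R]_d).

Definition partial (i : 'I_d) f x : R := 'D_(delta_mx ord0 i) f x.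

Definition grad f x : 'rV[R]_d := \row_i partial i f x.

Definition laplacian f x : R := \sum_i partial i (partial i f) x.

(* Euclidean inner product; the library norm on 'rV is the sup norm. *)
Definition dotp u v : R := \sum_i u ord0 i * v ord0 i.

Definition smooth f :=
  forall (s : seq 'I_d) x, differentiable (foldr partial f s) x.

Definition C1 f := (forall x, differentiable f x) /\ continuous (grad f).

Definition langevin_op V f x : R := laplacian f x - dotp (grad V x) (grad f x).

End calculus.

Section weak_poincare.
Context {R : realType} {d : nat}.
Local Open Scope ereal_scope.
Implicit Types (pi : probability 'rV[R]_d R) (f V : 'rV[R]_d -> R).

Definition gibbs V pi :=
  exists2 Z : R, (0 < Z)%R & forall A, measurable A ->
    pi A = \int[lebesgue_rV d]_(x in A) (expR (- V x) / Z)%:E.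

(* Oscillation of the pointwise-defined f. For the continuous f tested in the
   inequality below this is also the pi-essential oscillation, since pi has a
   positive density; it may be +oo. *)
Definition osc f : \bar R :=
  ereal_sup (range (EFin \o f)) - ereal_inf (range (EFin \o f)).

Record weak_poincare pi (beta : R -> R) (Phi : ('rV[R]_d -> R) -> \bar R)
    : Prop := {
  wpi_weight_ge0 : forall r, (0 < r -> 0 <= beta r)%R;
  wpi_weight_noninc : forall r s, (0 < r -> r <= s -> beta s <= beta r)%R;
  wpi_Phi_ge0 : forall f, f \in Lfun pi 2%:E -> 0 <= Phi f;
  wpi_Phi_affine : forall (a c : R) f, f \in Lfun pi 2%:E ->
    Phi (fun x => c * f x + a)%R = (c ^+ 2)%:E * Phi f;
  wpi_inequality : forall f r, smooth f -> f \in Lfun pi 2%:E -> (0 < r)%R ->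
    'V_pi[f] <= (beta r)%:E * \int[pi]_x (dotp (grad f x) (grad f x))%:E
                + r%:E * Phi f }.

End weak_poincare.

Section renyi.
Context {R : realType} d {T : measurableType d}.
Local Open Scope ereal_scope.
Local Open Scope charge_scope.

(* Only orders q > 1 are meaningful (the value at -oo is a dummy). *)
Definition renyi (q : \bar R) (rho pi : probability T R) : \bar R :=
  if `[< rho `<< pi >] then
    let h := 'd (charge_of_finite_measure rho) '/d pi in
    match q with
    | q%:E => ((q - 1)^-1)%:E * lne ('N[pi]_q%:E[h] `^ q)
    | +oo => lne 'N[pi]_+oo[h]
    | -oo => 0
    end
  else +oo.

End renyi.

Section langevin_sde.
Context {R : realType} {d : nat} {dW : measure_display} {W : measurableType dW}.
Variable P : probability W R.
Implicit Types (F : R -> set (set W)) (B X : R -> {RV P >-> 'rV[R]_d}).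

(* Processes are indexed by R; only the times t >= 0 matter. *)
Record filtration F : Prop := {
  filtration_sigma : forall t, 0 <= t -> sigma_algebra [set: W] (F t);
  filtration_sub : forall t, 0 <= t -> F t `<=` measurable;
  filtration_mono : forall s t, 0 <= s -> s <= t -> F s `<=` F t }.

Definition adapted F X :=
  forall t A, 0 <= t -> measurable A -> F t (X t @^-1` A).

Definition continuous_paths X :=
  {ae P, forall w, {within `[0, +oo[, continuous (fun t => X t w)}}.

(* Standard d-dimensional Brownian motion for the filtration F. Taking C = setT
   in brownian_increment, the coordinates of B t - B s are independent
   N(0, t - s) variables (normal_prob takes a standard deviation); for general
   C in F s the increment is independent of F s. *)
Record brownian F B : Prop := {
  brownian_adapted : adapted F B;
  brownian_0 : {ae P, forall w, B 0 w = 0};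
  brownian_increment : forall s t (C : set W) (A : 'I_d -> set R),
    0 <= s -> s < t -> F s C -> (forall i, measurable (A i)) ->
    P (C `&` [set w | forall i, A i ((B t w - B s w) ord0 i)]) =
    (P C * \prod_(i < d) normal_prob 0 (Num.sqrt (t - s)) (A i))%E;
  brownian_continuous : continuous_paths B }.

(* dX = - grad V (X) dt + sqrt 2 dB; as the noise is additive, this is a
   pathwise integral equation. *)
Record langevin_sde (V : 'rV[R]_d -> R) F B X : Prop := {
  sde_filtration : filtration F;
  sde_brownian : brownian F B;
  sde_adapted : adapted F X;
  sde_continuous : continuous_paths X;
  sde_eq : {ae P, forall w, forall t, 0 <= t ->
    X t w = X 0 w
      - \row_i \int[lebesgue_measure]_(s in `[0, t]) (grad V (X s w) ord0 i)
      + Num.sqrt 2 *: B t w } }.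

Definition markov_process (k : R -> R.-pker 'rV[R]_d ~> 'rV[R]_d) F X :=
  forall s t (C : set W) A, 0 <= s -> s <= t -> F s C -> measurable A ->
    P (C `&` X t @^-1` A) = (\int[P]_(w in C) k (t - s)%R (X s w) A)%E.

Definition langevin_diffusion V k F B X :=
  langevin_sde V F B X /\ markov_process k F X.

End langevin_sde.

Section langevin_semigroup.
Context {R : realType} {d : nat}.
Variables (V : 'rV[R]_d -> R) (k : R -> R.-pker 'rV[R]_d ~> 'rV[R]_d).
Variable pi : probability 'rV[R]_d R.

(* k t x is the law at time t of the Langevin diffusion started at x. *)
Definition langevin_transition := forall x,
  exists (dW : measure_display) (W : measurableType dW) (P : probability W R)
    (F : R -> set (set W)) (B X : R -> {RV P >-> 'rV[R]_d}),
    langevin_diffusion V k F B X /\ forall w, X 0 w = x.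

Definition semigroup t (f : 'rV[R]_d -> R) x : R := \int[k t x]_y f y.

Definition L2norm (f : 'rV[R]_d -> R) : \bar R := 'N[pi]_2%:E[EFin \o f].

Record L2_contraction_semigroup : Prop := {
  semigroup_L2 : forall t f, 0 <= t ->
    f \in Lfun pi 2%:E -> semigroup t f \in Lfun pi 2%:E;
  semigroup_contraction : forall t f, 0 <= t ->
    f \in Lfun pi 2%:E -> (L2norm (semigroup t f) <= L2norm f)%E;
  semigroup_strongly_continuous : forall f, f \in Lfun pi 2%:E ->
    L2norm (semigroup t f \- f) @[t --> 0^'+] --> 0%E }.

(* f is in the domain of the L^2(pi) generator, which maps it to g. *)
Definition L2_generator (f g : 'rV[R]_d -> R) := [/\ f \in Lfun pi 2%:E,
  g \in Lfun pi 2%:E &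
  L2norm (fun x => (semigroup t f x - f x) / t - g x) @[t --> 0^'+] --> 0%E].

(* The smooth functions in the domain, on which the generator acts as
   langevin_op V, are dense in the domain for the graph norm. *)
Definition smooth_core := forall f g, L2_generator f g -> forall e : R, 0 < e ->
  exists h, [/\ smooth h, L2_generator h (langevin_op V h),
    (L2norm (f \- h)%R < e%:E)%E & (L2norm (g \- langevin_op V h)%R < e%:E)%E].

End langevin_semigroup.

(* The value at q' = -oo is a dummy. The rate can vanish: the logarithm is 0 for
   r >= 5, and beta itself may be 0 for r >= 1/4; quotients by it then follow
   the convention x / 0 = 0. *)
Definition renyi_rate {R : realType} (beta : R -> R) (q : R) (q' : \bar R)
    (r : R) : R :=
  match q' with
  | +oo%E => beta r
  | q'%:E => let a := q' / (q' - q) in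
      beta ((r / 5) `^ a) * ln (Num.max ((5 / r) `^ a) 1)
  | -oo%E => 0
  end.

(* Main.v *)
Require Import Defs.
From HB Require Import structures.
From mathcomp Require Import all_boot all_order all_algebra.
From mathcomp Require Import ring lra.
From mathcomp Require Import finmap.
From mathcomp Require Import all_classical all_reals all_analysis.
From mathcomp Require Import measurable_realfun ess_sup_inf.

(* Let S be the semigroup, L its generator and h the density of rho_0. Integrating by
   parts against polynomial cutoffs on boxes shows that smooth f with f, L f in L^2
   have gradient in L^2, hence that L, and then S, are symmetric. So pi is invariant
   and rho_t has density S t h.

   For a smooth truncation T at level a, psi = T^(q/2) and p = q^2/(4(q-1)) T^(q-1)
   satisfy psi'^2 <= p'. The weak Poincare inequality for psi (f) therefore gives
   Var (psi (f)) - r a^q <= beta(r) * (- \int p(f) L f) on the domain of L. With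
   phi' = p, convexity of phi bounds the right-hand side, along a time mesh, by
   decrements of \int phi (S t f); by density of the domain this extends from f to h.
   As J - phi is convex for J(x) = q/(4(q-1)) (x+e)^q, Jensen's inequality replaces
   phi by J, and e -> 0 gives, for F t = \int (S t h)^q,
     (t-s) (K - r a^q) <= beta(r) q/(4(q-1)) (F s - F t)
   as soon as K <= Var (min (S u h, a)^(q/2)) on [s, t].

   By interpolation Var ((S u h)^(q/2)) >= F - F^((q-2)/(q-1)). Take a = ||h||_oo, or
   for finite q' a level at which the tail is controlled by the q'-th moment. In terms
   of R = ln F / (q-1) this reads, after a discretised Gronwall argument,
     R s - R t >= 4 (t-s) / (q beta) * (1 - exp (- R t) - r delta0),
   and all claims follow from elementary bounds on exp. *)

Set Implicit Arguments.
Unset Strict Implicit.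
Unset Printing Implicit Defensive.

Import Order.TTheory GRing.Theory Num.Theory.
Import numFieldNormedType.Exports.

Local Open Scope classical_set_scope.
Local Open Scope ring_scope.

(** * L2 functions on a probability space *)

(** The weak Poincare inequality is informative for functions of finite oscillation only, while the
    power q/2 of a density is in general unbounded. This forces the truncation and the functional
    built from [phi], whose decrement must then be dominated by that of the q-th moment. Since [h]
    need not lie in the domain of the generator, nothing is differentiated in time: evolution
    statements are inequalities between two times, summed over small steps. Identities for the
    semigroup hold almost everywhere only, as the integral against the kernel takes a default value
    where it diverges.

    For finite q' put W = r delta0 / 5. Truncation leaves 2/3 (E - 3 W) of the variance bound E, and
    the oscillation term costs another W: in all 2/3 (E - 9/2 W). The logarithm in the rate, at
    least ln 5 >= 3/2 for r < 1, pays for the factor 2/3, and 9/2 <= 5 explains r / 5.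

    A vanishing rate is treated apart: dissipation then bounds the divergence at every positive
    time, and time 0 follows by lower semicontinuity. *)

Section L2.
Context d (T : measurableType d) (R : realType) (mu : probability T R).
Implicit Types f g h : T -> R.

Definition L2 f := f \in Lfun mu 2%:E.
Definition ip f g : R := \int[mu]_x (f x * g x).
Definition n2 f : R := Num.sqrt (ip f f).

Lemma L2_meas f : L2 f -> measurable_fun setT f.
Proof. by move=> /sub_Lfun_mfun; rewrite inE. Qed.

Lemma L2P f : L2 f <-> measurable_fun setT f /\
  mu.-integrable setT (EFin \o (fun x => f x ^+ 2)).
Proof.
split=> [lf|[mf /integrableP[_ fi]]].
  by split; [exact: L2_meas|exact: Lfun2_integrable_sqr].
rewrite /L2 inE; apply/andP; split; rewrite inE//= /finite_norm unlock poweR_lty//.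
apply: le_lt_trans fi; apply: ge0_le_integral => //.
- by move=> x _; rewrite lee_fin powR_ge0.
- apply/measurable_EFinP; apply: (measurableT_comp (measurable_powR _)) => //.
  exact: measurableT_comp.
- by apply/measurable_EFinP; apply: measurableT_comp => //; exact: measurable_funX.
- by move=> x _ /=; rewrite lee_fin powR_mulrn// -normrX.
Qed.

Lemma L2_int_mul f g : L2 f -> L2 g ->
  mu.-integrable setT (EFin \o (fun x => f x * g x)).
Proof. by move=> lf lg; apply/Lfun1_integrable; exact: Lfun2_mul_Lfun1. Qed.

Lemma L2_cst c : L2 (cst c).
Proof. exact: Lfun_cst. Qed.

Lemma L2_int f : L2 f -> mu.-integrable setT (EFin \o f).
Proof.
move=> lf; have := L2_int_mul lf (L2_cst 1).
by apply: eq_integrable => // x _; rewrite /= mulr1.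
Qed.

Lemma L2_le f g : measurable_fun setT f -> L2 g ->
  (forall x, `|f x| <= `|g x|) -> L2 f.
Proof.
move=> mf /L2P[mg ig] fg; apply/L2P; split => //.
apply: le_integrable ig => //.
  by apply/measurable_EFinP; exact: measurable_funX.
by move=> x _ /=; rewrite lee_fin !normrX lerXn2r// nnegrE.
Qed.

Lemma L2_bnd f M : measurable_fun setT f -> (forall x, `|f x| <= M) -> L2 f.
Proof.
move=> mf fM; apply: (L2_le mf (L2_cst M)) => x.
exact: le_trans (fM x) (ler_norm _).
Qed.

Lemma L2D f g : L2 f -> L2 g -> L2 (f \+ g).
Proof.
move=> lf lg; apply/L2P; split.
  by apply: measurable_funD; exact: L2_meas.
rewrite (_ : _ \o _ = ((EFin \o (fun x => f x * f x)%R) \+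
   (fun x => 2%:E * (EFin \o (fun x => f x * g x)%R) x) \+
   (EFin \o (fun x => g x * g x)%R))%E); last first.
  by apply/funext => x /=; rewrite -EFinM -!EFinD; congr EFin; ring.
apply: integrableD => //; last exact: L2_int_mul.
apply: integrableD => //; first exact: L2_int_mul.
by apply: integrableZl => //; exact: L2_int_mul.
Qed.

Lemma L2Z c f : L2 f -> L2 (c \*o f).
Proof.
move=> lf; apply/L2P; split.
  by apply: measurable_funM => //; exact: L2_meas.
rewrite (_ : _ \o _ = (fun x => (c ^+ 2)%:E * (EFin \o (fun x => f x * f x)%R) x)%E); last first.
  by apply/funext => x /=; rewrite -EFinM; congr EFin; ring.
by apply: integrableZl => //; exact: L2_int_mul.
Qed.

Lemma L2N f : L2 f -> L2 (\- f).
Proof.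
by move=> /(L2Z (-1)); congr (L2 _); apply/funext => x /=; rewrite mulN1r.
Qed.

Lemma L2B f g : L2 f -> L2 g -> L2 (f \- g).
Proof. by move=> lf /L2N; exact: L2D. Qed.

Lemma L2_norm f : L2 f -> L2 (Num.norm \o f).
Proof.
move=> lf; apply: (L2_le _ lf) => [|x]; last by rewrite /= normr_id.
by apply: measurableT_comp => //; exact: L2_meas.
Qed.

Lemma ipE f g : ip f g = \int[mu]_x (f x * g x). Proof. by []. Qed.

Lemma ipC f g : ip f g = ip g f.
Proof. by apply: eq_Rintegral => x _; rewrite mulrC. Qed.

Lemma ipDl f g h : L2 f -> L2 g -> L2 h -> ip (f \+ g) h = ip f h + ip g h.
Proof.
move=> lf lg lh; rewrite /ip -RintegralD//; try exact: L2_int_mul.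
by apply: eq_Rintegral => x _ /=; rewrite mulrDl.
Qed.

Lemma ipZl c f g : L2 f -> L2 g -> ip (c \*o f) g = c * ip f g.
Proof.
move=> lf lg; rewrite /ip -RintegralZl//; last exact: L2_int_mul.
by apply: eq_Rintegral => x _ /=; rewrite mulrA.
Qed.

Lemma ipNl f g : L2 f -> L2 g -> ip (\- f) g = - ip f g.
Proof.
move=> lf lg; rewrite -mulN1r -ipZl//; congr ip.
by apply/funext => x /=; rewrite mulN1r.
Qed.

Lemma ipBl f g h : L2 f -> L2 g -> L2 h -> ip (f \- g) h = ip f h - ip g h.
Proof. by move=> lf lg lh; rewrite -ipNl// -ipDl//; exact: L2N. Qed.

Lemma ipDr f g h : L2 f -> L2 g -> L2 h -> ip h (f \+ g) = ip h f + ip h g.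
Proof. by move=> *; rewrite ipC ipDl// !(ipC h). Qed.

Lemma ipBr f g h : L2 f -> L2 g -> L2 h -> ip h (f \- g) = ip h f - ip h g.
Proof. by move=> *; rewrite ipC ipBl// !(ipC h). Qed.

Lemma ipZr c f g : L2 f -> L2 g -> ip f (c \*o g) = c * ip f g.
Proof. by move=> *; rewrite ipC ipZl// ipC. Qed.

Lemma ip_ge0 f : 0 <= ip f f.
Proof. by apply: Rintegral_ge0 => x _; rewrite -expr2 sqr_ge0. Qed.

Lemma n2_ge0 f : 0 <= n2 f. Proof. exact: sqrtr_ge0. Qed.

Lemma n2_sqr f : n2 f ^+ 2 = ip f f.
Proof. by rewrite sqr_sqrtr// ip_ge0. Qed.

Lemma n2Z c f : L2 f -> n2 (c \*o f) = `|c| * n2 f.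
Proof.
move=> lf; rewrite /n2 ipZl//; last exact: L2Z.
by rewrite ipZr// mulrA -expr2 sqrtrM ?sqr_ge0// sqrtr_sqr.
Qed.

Lemma n2N f : n2 (\- f) = n2 f.
Proof. by rewrite /n2 /ip; congr Num.sqrt; apply: eq_Rintegral => x _ /=; rewrite mulrNN. Qed.

Lemma n2C f g : n2 (f \- g) = n2 (g \- f).
Proof. by rewrite -n2N; congr n2; apply/funext => x /=; rewrite opprB. Qed.

Lemma CS f g : L2 f -> L2 g -> `|ip f g| <= n2 f * n2 g.
Proof.
move=> lf lg.
(* Nonnegativity of the squared norm of a f + b g; the choice a = - <f, g>, b = <f, f> gives the
   inequality after division by <f, f>. *)
have H a b : 0 <= a ^+ 2 * ip f f + 2 * (a * b) * ip f g + b ^+ 2 * ip g g.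
  have := ip_ge0 ((a \*o f) \+ (b \*o g)).
  rewrite ipDl; [|exact: L2Z|exact: L2Z|by apply: L2D; exact: L2Z].
  rewrite !ipDr; try exact: L2Z.
  rewrite !ipZl; try by try exact: L2Z.
  rewrite !ipZr; try by try exact: L2Z.
  by rewrite (ipC g f); congr (_ <= _); ring.
have E : (ip f g) ^+ 2 <= ip f f * ip g g.
  have Hf := ip_ge0 f; have Hg := ip_ge0 g.
  have [f0|f0] := eqVneq (ip f f) 0.
    have := H (- (1 + ip g g) * ip f g) 1; rewrite f0 => H1.
    have : 0 <= ip f g ^+ 2 * (- 2 - ip g g) * 1 - 0 + (ip g g - ip f g ^+2 * ip g g).
      by move: H1; congr (_ <= _); ring.
    move: (H (- (1 + ip g g)^-1 * 1) 1) => _ _.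
    have [->|fg] := eqVneq (ip f g) 0; first by rewrite expr0n mul0r.
    (* Degenerate case <f, f> = 0: this choice makes the form equal to - 2 - <g, g> < 0, so <f, g>
       cannot be nonzero. *)
    have := H (- (1 + ip g g) / ip f g) 1; rewrite f0 mulr0 add0r.
    rewrite mulr1 -mulrA -mulrA mulVf// mulr1 expr1n mul1r; lra.
  have fp : 0 < ip f f by rewrite lt_def f0.
  have := H (- ip f g) (ip f f).
  have -> : (- ip f g) ^+ 2 * ip f f + 2 * (- ip f g * ip f f) * ip f g + ip f f ^+ 2 * ip g g
     = ip f f * (ip f f * ip g g - ip f g ^+ 2) by ring.
  by rewrite pmulr_rge0// subr_ge0.
rewrite -(@ler_pXn2r _ 2)// ?nnegrE ?mulr_ge0 ?n2_ge0//.
by rewrite real_normK ?num_real// exprMn !n2_sqr.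
Qed.

Lemma n2D f g : L2 f -> L2 g -> n2 (f \+ g) <= n2 f + n2 g.
Proof.
move=> lf lg; rewrite -(@ler_pXn2r _ 2)// ?nnegrE ?addr_ge0 ?n2_ge0//.
have lfg := L2D lf lg.
rewrite n2_sqr ipDl// !ipDr// (ipC g f) sqrrD !n2_sqr.
have := CS lf lg; have := ler_norm (ip f g); lra.
Qed.

Lemma n2_tri f g h : L2 f -> L2 g -> L2 h -> n2 (f \- h) <= n2 (f \- g) + n2 (g \- h).
Proof.
move=> lf lg lh; apply: le_trans (n2D (L2B lf lg) (L2B lg lh)).
by rewrite (_ : f \- h = (f \- g) \+ (g \- h))//; apply/funext => x /=; ring.
Qed.

Lemma n2B f g : L2 f -> L2 g -> n2 (f \- g) <= n2 f + n2 g.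
Proof. by move=> lf lg; rewrite -(n2N g); apply: n2D => //; exact: L2N. Qed.

Lemma n2B_ge f g : L2 f -> L2 g -> `|n2 f - n2 g| <= n2 (f \- g).
Proof.
move=> lf lg; rewrite ler_norml; apply/andP; split.
  have := n2D (L2B lg lf) lf.
  rewrite (_ : (g \- f) \+ f = g); last by apply/funext => x /=; ring.
  rewrite n2C; lra.
have := n2D (L2B lf lg) lg.
rewrite (_ : (f \- g) \+ g = f); last by apply/funext => x /=; ring.
lra.
Qed.

Lemma n2_le f g : L2 f -> L2 g -> (forall x, `|f x| <= `|g x|) -> n2 f <= n2 g.
Proof.
move=> lf lg fg; rewrite ler_wsqrtr// /ip; apply: le_Rintegral => //; try exact: L2_int_mul.
by move=> x _; rewrite -!expr2 -real_normK ?num_real// -[leRHS]real_normK ?num_real// lerXn2r// nnegrE.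
Qed.

Lemma n2_cst c : n2 (cst c) = `|c|.
Proof.
rewrite /n2 (_ : ip _ _ = c ^+ 2) ?sqrtr_sqr//.
transitivity (\int[mu]_(x in setT) (c * c)); first by [].
have m1 : mu [set: T] = 1%E := probability_setT mu.
rewrite Rintegral_cst//; set z := fine _.
have -> : z = fine 1%E by rewrite /z; congr fine; exact: m1.
by rewrite /= mulr1 expr2.
Qed.

Lemma L2normE f : L2 f -> ('N[mu]_2%:E[EFin \o f] = (n2 f)%:E)%E.
Proof.
move=> lf.
rewrite unlock /n2 /ip -powR12_sqrt ?ip_ge0// -poweR_EFin.
rewrite fineK ?integrable_fin_num//; last exact: L2_int_mul.
congr (_ `^ _)%E; apply: eq_integral => x _ /=.
by rewrite powR_mulrn// real_normK ?num_real// expr2.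
Qed.

Lemma ip_ae f f' g : measurable_fun setT f -> measurable_fun setT f' -> measurable_fun setT g ->
  {ae mu, forall x, f x = f' x} -> ip f g = ip f' g.
Proof.
move=> mf mf' mg ff'; rewrite /ip /Rintegral; congr fine.
apply: ae_eq_integral => //.
- by apply/measurable_EFinP; exact: measurable_funM.
- by apply/measurable_EFinP; exact: measurable_funM.
- by apply: filterS ff' => x /= ->.
Qed.

Lemma n2_ae f g : measurable_fun setT f -> measurable_fun setT g ->
  {ae mu, forall x, f x = g x} -> n2 f = n2 g.
Proof.
move=> mf mg fg; rewrite /n2; congr Num.sqrt.
by rewrite (ip_ae mf mg)// ipC (ip_ae mf mg)// ipC.
Qed.

Lemma n2_eq0 f : L2 f -> n2 f = 0 -> {ae mu, forall x, f x = 0}.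
Proof.
move=> lf /eqP; rewrite sqrtr_eq0 => f0.
have {f0}f0 : ip f f = 0 by apply/eqP; rewrite eq_le f0 ip_ge0.
have : (\int[mu]_x `|(f x * f x)%:E| = 0)%E.
  rewrite (eq_integral (fun x => (f x * f x)%:E)).
    by rewrite -(fineK (integrable_fin_num _ (L2_int_mul lf lf)))//; congr EFin.
  by move=> x _; rewrite gee0_abs// lee_fin -expr2 sqr_ge0.
move/ae_eq_integral_abs => -/(_ measurableT); case.
  by apply/measurable_EFinP; apply: measurable_funM; exact: L2_meas.
move=> N [mN N0 sub]; exists N; split => // x /= fx; apply: sub => /= H.
by apply: fx; have /eqP := H I; rewrite eqe mulf_eq0 orbb => /eqP.
Qed.

End L2.

(** * Induction on nonnegative measurable functions: mixtures and densities *)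

Section measurable_induction.
Context d (T : measurableType d) (R : realType).
Local Open Scope ereal_scope.
Import HBNNSimple.

(** Monotone approximation by simple functions carries an identity from indicators to all
    nonnegative measurable functions; the two integral formulas below are instances. *)
Lemma ge0_measurable_ind (C : (T -> \bar R) -> Prop) :
  (forall A, measurable A -> C (fun x => (\1_A x)%:E)) ->
  (forall (c : R) f, (0 <= c)%R -> measurable_fun setT f -> (forall x, 0 <= f x) ->
    C f -> C (fun x => c%:E * f x)) ->
  (forall f g, measurable_fun setT f -> (forall x, 0 <= f x) ->
    measurable_fun setT g -> (forall x, 0 <= g x) -> C f -> C g -> C (fun x => f x + g x)) ->
  (forall F : (T -> \bar R)^nat, (forall n, measurable_fun setT (F n)) ->
    (forall n x, 0 <= F n x) -> (forall x, {homo F^~ x : m n / (m <= n)%N >-> m <= n}) ->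
    (forall n, C (F n)) -> C (fun x => limn (F^~ x))) ->
  forall f, measurable_fun setT f -> (forall x, 0 <= f x) -> C f.
Proof.
move=> C1 CZ CD CL f mf f0.
pose f_ := nnsfun_approx measurableT mf.
have -> : f = (fun x => limn (fun n => (f_ n x)%:E)).
  by apply/funext => x; apply/esym/cvg_lim => //; exact: cvg_nnsfun_approx.
apply: (CL (fun n x => (f_ n x)%:E)).
- by move=> n; exact/measurable_EFinP.
- by move=> n x; rewrite lee_fin.
- by move=> x m n mn; rewrite lee_fin; exact/lefP/nd_nnsfun_approx.
move=> n; move: (f_ n) => {f_ mf f0 f}f.
(* A negative value y contributes nothing because [f] is nonnegative; taking the maximum with 0 lets
   the induction on the list of values use [CZ] for every entry. *)
have -> : (fun x => (f x)%:E) = (fun x => \sum_(y <- (fset_set (range f) : seq R))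
    (Num.max 0 y)%:E * (\1_(f @^-1` [set y]) x)%:E).
  apply/funext => x; rewrite fimfunE fsbig_finite//= -sumEFin.
  apply: eq_bigr => y _; rewrite -EFinM; congr EFin.
  have [y0|y0] := leP 0%R y; first by [].
  rewrite mul0r; case: (pselect (f x = y)) => [fxy|fxy].
    by move: y0; rewrite -fxy ltNge fun_ge0.
  by rewrite indicE memNset// mulr0.
elim: (fset_set (range f) : seq R) => [|y s IH].
  under eq_fun do rewrite big_nil.
  have := CZ 0%R (fun x => (\1_(set0 : set T) x)%:E) (lexx _).
  rewrite (_ : (fun x => 0%:E * _) = fun=> 0); last by apply/funext => x; rewrite mul0e.
  by apply => //; [exact/measurable_EFinP|exact: C1].
under eq_fun do rewrite big_cons.
apply: CD => //.
- by apply: measurable_funeM; exact/measurable_EFinP.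
- by move=> x; rewrite mule_ge0// lee_fin// le_max lexx.
- by apply: emeasurable_sum => z; apply: measurable_funeM; exact/measurable_EFinP.
- by move=> x; apply: sume_ge0 => z _; rewrite mule_ge0// lee_fin// le_max lexx.
apply: CZ => //; first by rewrite le_max lexx.
- exact/measurable_EFinP.
- exact: C1.
Qed.

(** Serves twice: for Chapman-Kolmogorov, where [mu] is k (s + t) x, and for invariance, where both
    [mu] and [nu] are pi. *)
Lemma integral_mixture d' (Y : measurableType d') (mu : {measure set T -> \bar R})
    (nu : {measure set Y -> \bar R}) (l : Y -> {measure set T -> \bar R}) :
  (forall U, measurable U -> measurable_fun setT (l ^~ U)) ->
  (forall U, measurable U -> mu U = \int[nu]_y l y U) ->
  forall f, measurable_fun setT f -> (forall x, 0 <= f x) ->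
    \int[mu]_x f x = \int[nu]_y \int[l y]_x f x.
Proof.
move=> ml H.
have ml2 f : measurable_fun setT f -> (forall x, 0 <= f x) ->
    measurable_fun setT (fun y => \int[l y]_x f x).
  by move=> mf f0; exact: measurable_fun_integral_kernel.
apply: ge0_measurable_ind.
- move=> A mA; rewrite integral_indic// setIT H//.
  by apply: eq_integral => y _; rewrite integral_indic// setIT.
- move=> c f c0 mf f0 E; rewrite ge0_integralZl_EFin// E.
  have i0 y : setT y -> 0 <= \int[l y]_x f x by move=> _; exact: integral_ge0.
  rewrite -(ge0_integralZl_EFin nu measurableT i0 (ml2 _ mf f0) c0).
  by apply: eq_integral => y _; rewrite ge0_integralZl_EFin.
- move=> f g mf f0 mg g0 Ef Eg; rewrite (ge0_integralD mu measurableT (fun x _ => f0 x) mf (fun x _ => g0 x) mg) Ef Eg.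
  have i0 h : (forall x, 0 <= h x) -> forall y, setT y -> 0 <= \int[l y]_x h x.
    by move=> h0 y _; exact: integral_ge0.
  rewrite -(ge0_integralD nu measurableT (i0 _ f0) (ml2 _ mf f0) (i0 _ g0) (ml2 _ mg g0)).
  by apply: eq_integral => y _; rewrite ge0_integralD.
- move=> F mF F0 ndF EF; rewrite monotone_convergence//.
  under eq_fun do rewrite EF.
  rewrite -monotone_convergence//; last 3 first.
    by move=> n; exact: ml2.
    by move=> n y _; exact: integral_ge0.
    move=> y _ m n mn; apply: ge0_le_integral => // x _; exact: ndF.
  apply: eq_integral => y _; by rewrite -monotone_convergence.
Qed.

Lemma integral_density (mu lam : {measure set T -> \bar R}) (w : T -> R) :
  measurable_fun setT w -> (forall x, 0 <= w x)%R ->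
  (forall U, measurable U -> mu U = \int[lam]_(x in U) (w x)%:E) ->
  forall f, measurable_fun setT f -> (forall x, 0 <= f x) ->
    \int[mu]_x f x = \int[lam]_x (f x * (w x)%:E).
Proof.
move=> mw w0 H.
have mw' : measurable_fun setT (fun x => (w x)%:E) by exact/measurable_EFinP.
have w0' x : 0 <= (w x)%:E by rewrite lee_fin.
have mM f : measurable_fun setT f -> measurable_fun setT (fun x => f x * (w x)%:E).
  by move=> mf; exact: emeasurable_funM.
apply: ge0_measurable_ind.
- move=> A mA; rewrite integral_indic// setIT H// integral_mkcond.
  apply: eq_integral => x _; rewrite /patch indicE; case: ifPn => xA; first by rewrite mul1e.
  by rewrite mul0e.
- move=> c f c0 mf f0 E; rewrite ge0_integralZl_EFin// E -ge0_integralZl_EFin//; last 2 first.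
    by move=> x _; exact: mule_ge0.
    exact: mM.
  by apply: eq_integral => y _; rewrite muleA.
- move=> f g mf f0 mg g0 Ef Eg; rewrite ge0_integralD// Ef Eg -ge0_integralD//; first last.
    exact: mM.
    by move=> y _; exact: mule_ge0.
    exact: mM.
    by move=> y _; exact: mule_ge0.
  by apply: eq_integral => y _; rewrite ge0_muleDl.
- move=> F mF F0 ndF EF; rewrite monotone_convergence//.
  under eq_fun do rewrite EF.
  rewrite -monotone_convergence//; last 3 first.
    by move=> n; exact: mM.
    by move=> n y _; exact: mule_ge0.
    by move=> y _ m n mn; rewrite lee_wpmul2r//; exact: ndF.
  apply: eq_integral => y _.
  have cv : cvgn (F^~ y) by apply: ereal_nondecreasing_is_cvgn; exact: ndF.
  by under eq_fun do rewrite muleC; rewrite limeMl// muleC.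
Qed.

End measurable_induction.

(** * The semigroup on L2 *)

Section near0.
Context (R : realType).

Lemma near0_right (Q : R -> Prop) : (\forall t \near 0^'+, Q t) <->
  exists2 dl : R, 0 < dl & forall t, 0 < t -> t < dl -> Q t.
Proof.
split=> [|[dl dl0 H]].
  rewrite /at_right /within /=  => /nbhs_ballP[dl /= dl0 H]; exists dl => // t t0 tdl.
  by apply: H => //; rewrite /ball/= sub0r normrN gtr0_norm.
by near=> t; apply: H.
Unshelve. all: by end_near. Qed.

(** Bridge between the extended-real limits in the hypotheses on the semigroup and the epsilon-delta
    form used from here on. *)
Lemma cvg_EFin0P (u : R -> \bar R) (v : R -> R) :
  (forall t, 0 < t -> u t = (v t)%:E) -> (forall t, 0 < t -> 0 <= v t) ->
  (u t @[t --> 0^'+] --> 0%E) <->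
  forall e : R, 0 < e -> exists2 dl : R, 0 < dl & forall t, 0 < t -> t < dl -> v t < e.
Proof.
move=> uv v0; split=> [H e e0|H].
  suff [dl dl0 Hd] : exists2 dl : R, 0 < dl & forall t, 0 < t -> t < dl -> (u t < e%:E)%E.
    by exists dl => // t t0 td; rewrite -lte_fin -uv// Hd.
  apply/near0_right.
  have : nbhs (0%E : \bar R) (fun z => (z < e%:E)%E).
    by apply: open_nbhs_nbhs; split; [exact: open_ereal_lt_ereal|rewrite /= lte_fin].
  by move/H.
have {}H : v t @[t --> 0^'+] --> 0.
  apply/cvgrPdist_lt => e /H [dl dl0 Hd]; apply/near0_right; exists dl => // t t0 td.
  by rewrite sub0r normrN ger0_norm ?v0// Hd.
apply: cvg_EFin.
  by apply/near0_right; exists 1 => // t t0 _; rewrite uv.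
apply: cvg_trans H; apply: near_eq_cvg.
by apply/near0_right; exists 1 => // t t0 _; rewrite /= uv.
Qed.

End near0.

Lemma integral_cst_prob d (T : measurableType d) (R : realType) (P : probability T R) (r : \bar R) :
  (\int[P]_x r = r)%E.
Proof.
rewrite integral_cst// -[RHS]mule1; congr (_ * _)%E; exact: probability_setT.
Qed.

Section semigroup_basic.
Context {R : realType} {d : nat}.
Variables (V : 'rV[R]_d -> R) (k : R -> R.-pker 'rV[R]_d ~> 'rV[R]_d).
Variable pi : probability 'rV[R]_d R.
Hypothesis hk : langevin_transition V k.
Local Notation T := 'rV[R]_d.
Local Notation S := (semigroup k).
Implicit Types (f g : T -> R) (s t : R).

(** The kernel is known only through the diffusions that realise it: this is their Markov property
    at time s on the whole space, with the law of [X s] rewritten as k s x. *)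
Lemma chapman_kolmogorov s t x A : 0 <= s -> 0 <= t -> measurable A ->
  (k (s + t) x A = \int[k s x]_y k t y A)%E.
Proof.
move=> s0 t0 mA.
have [dW [W [P [F [B [X [[sde mk] X0]]]]]]] := hk x.
have FT u : 0 <= u -> F u setT.
  move=> u0; have [_ /(_ set0) + _] := filtration_sigma (sde_filtration sde) u0.
  have [F0 _ _] := filtration_sigma (sde_filtration sde) u0.
  by rewrite setD0; apply.
have E1 u U : 0 <= u -> measurable U -> P (X u @^-1` U) = k u x U.
  move=> u0 mU; have := mk 0 u setT U (lexx _) u0 (FT _ (lexx _)) mU.
  rewrite setTI subr0 => ->.
  under eq_integral do rewrite X0.
  by rewrite integral_cst_prob.
rewrite -(E1 _ _ (addr_ge0 s0 t0))//.
have := mk s (s + t) setT A s0 _ (FT _ s0) mA; rewrite setTI => ->; last by rewrite lerDl.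
rewrite (addrC s) addrK.
transitivity (\int[pushforward P (X s)]_y k t y A)%E; last first.
  by apply: eq_measure_integral => U mU _; rewrite -E1.
rewrite ge0_integral_pushforward//.
exact: measurable_kernel.
Qed.

Lemma S_meas t f : measurable_fun setT f -> measurable_fun setT (S t f).
Proof.
move=> mf; rewrite /semigroup /Rintegral.
apply: (measurableT_comp (@fine_measurable _ _ measurableT)) => //.
under eq_fun do rewrite integralE.
apply: emeasurable_funB.
  apply: measurable_fun_integral_kernel => //; first exact: measurable_kernel.
  by apply: measurable_funepos; exact/measurable_EFinP.
apply: measurable_fun_integral_kernel => //; first exact: measurable_kernel.
by apply: measurable_funeneg; exact/measurable_EFinP.
Qed.

Lemma S_cst t c : S t (cst c) = cst c.
Proof.
apply/funext => x; rewrite /semigroup Rintegral_cst//.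
by rewrite (_ : k t x setT = 1%E) ?prob_kernel//= mulr1.
Qed.

Lemma S_ge0 t f : (forall x, 0 <= f x) -> forall x, 0 <= S t f x.
Proof. by move=> f0 x; apply: Rintegral_ge0. Qed.

Lemma SD t f g x : (k t x).-integrable setT (EFin \o f) ->
  (k t x).-integrable setT (EFin \o g) -> S t (f \+ g) x = S t f x + S t g x.
Proof. by move=> fi gi; rewrite /semigroup RintegralD. Qed.

Lemma SB t f g x : (k t x).-integrable setT (EFin \o f) ->
  (k t x).-integrable setT (EFin \o g) -> S t (f \- g) x = S t f x - S t g x.
Proof. by move=> fi gi; rewrite /semigroup RintegralB. Qed.

Lemma SZ t c f x : (k t x).-integrable setT (EFin \o f) ->
  S t (c \*o f) x = c * S t f x.
Proof. by move=> fi; rewrite /semigroup RintegralZl. Qed.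

End semigroup_basic.

Section semigroup_L2.
Context {R : realType} {d : nat}.
Variables (V : 'rV[R]_d -> R) (k : R -> R.-pker 'rV[R]_d ~> 'rV[R]_d).
Variable pi : probability 'rV[R]_d R.
Hypothesis hk : langevin_transition V k.
Hypothesis hsemi : L2_contraction_semigroup k pi.
Local Notation T := 'rV[R]_d.
Local Notation S := (semigroup k).
Local Notation L2 := (L2 pi).
Local Notation n2 := (n2 pi).
Local Notation ip := (ip pi).
Implicit Types (f g : T -> R) (s t : R).

Lemma S_L2 t f : 0 <= t -> L2 f -> L2 (S t f).
Proof. by move=> t0; exact: semigroup_L2 hsemi _ _ t0. Qed.

Lemma S_contr t f : 0 <= t -> L2 f -> n2 (S t f) <= n2 f.
Proof.
move=> t0 lf; have := semigroup_contraction hsemi t0 lf.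
by rewrite /L2norm !L2normE//; exact: S_L2.
Qed.

(** Invariance of pi would give this, but it is derived later, from symmetry. Instead, contraction
    bounds the L2 norm of S t applied to min(|f|, n) by that of f, so the limit of the squares is
    integrable, hence finite almost everywhere. *)
Lemma S_int t f : 0 <= t -> L2 f -> {ae pi, forall x, (k t x).-integrable setT (EFin \o f)}.
Proof.
move=> t0 lf.
pose F n x := Num.min `|f x| n%:R.
have mf := L2_meas lf.
have mF n : measurable_fun setT (F n).
  by apply: measurable_minr => //; exact: measurableT_comp.
have F0 n x : 0 <= F n x by rewrite le_min normr_ge0 ler0n.
have ndF x m n : (m <= n)%N -> F m x <= F n x.
  by move=> mn; rewrite /F le_min !ge_min lexx/= ler_nat mn orbT.
have lF n : L2 (F n).
  apply: (L2_le (mF n) (L2_norm lf)) => x /=.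
  by rewrite ger0_norm// normr_id ge_min lexx.
have Fi n x : (k t x).-integrable setT (EFin \o F n).
  apply: measurable_bounded_integrable => //; first by rewrite prob_kernel ltry.
  by exists n%:R; split; [exact: num_real|move=> M nM y _ /=; rewrite ger0_norm// ge_min (ltW nM) orbT].
pose G x := limn (fun n => ((S t (F n) x) ^+ 2)%:E).
have mS n : measurable_fun setT (fun x => ((S t (F n) x) ^+ 2)%:E).
  by apply/measurable_EFinP/measurable_funX; exact: S_meas.
have ndS x m n : (m <= n)%N -> S t (F m) x <= S t (F n) x.
  by move=> mn; apply: le_Rintegral => // y _; exact: ndF.
have ndS2 x m n : (m <= n)%N -> (((S t (F m) x) ^+ 2)%:E <= ((S t (F n) x) ^+ 2)%:E)%E.
  by move=> mn; rewrite lee_fin lerXn2r// ?nnegrE ?S_ge0// ndS.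
have EG : (\int[pi]_x G x <= (n2 f ^+ 2)%:E)%E.
  rewrite /G monotone_convergence//; last 2 first.
    by move=> n x _; rewrite lee_fin sqr_ge0.
    by move=> x _ m n; exact: ndS2.
  apply: lime_le.
    apply: ereal_nondecreasing_is_cvgn => m n mn; apply: ge0_le_integral => //.
      by move=> x _; rewrite lee_fin sqr_ge0.
    by move=> x _; exact: ndS2.
  apply: nearW => n.
  have -> : (\int[pi]_x (S t (F n) x ^+ 2)%:E = (n2 (S t (F n)) ^+ 2)%:E)%E.
    rewrite n2_sqr /ip /Rintegral fineK//.
    by apply: integrable_fin_num => //; apply: L2_int_mul; exact: S_L2.
  rewrite lee_fin lerXn2r ?nnegrE ?n2_ge0//.
  apply: le_trans (S_contr t0 (lF n)) _.
  by apply: n2_le => // x; rewrite ger0_norm// ge_min lexx.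
have mG : measurable_fun setT G.
  apply: (emeasurable_fun_cvg (fun n x => ((S t (F n) x) ^+ 2)%:E)) => // x _.
  by apply: ereal_nondecreasing_is_cvgn => m n; exact: ndS2.
have G0 x : (0 <= G x)%E.
  apply: lime_ge.
    by apply: ereal_nondecreasing_is_cvgn => m n; exact: ndS2.
  by apply: nearW => n; rewrite lee_fin sqr_ge0.
have iG : pi.-integrable setT G.
  apply/integrableP; split => //.
  under eq_integral do rewrite gee0_abs//.
  exact: le_lt_trans EG (ltry _).
have := integrable_ae measurableT iG.
apply: filterS => x /(_ I) Gx.
apply/integrableP; split; first exact/measurable_EFinP.
have -> : (fun y => `|(EFin \o f) y|)%E = (fun y => limn (fun n => (F n y)%:E)).
  apply/funext => y /=; apply/esym/cvg_lim => //; apply: cvg_EFin.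
    by apply: nearW.
  apply/cvgrPdist_le => e e0; near=> n.
  rewrite /= /F min_l ?subrr ?normr0 ?(ltW e0)//.
  by near: n; exact: nbhs_infty_ger.
rewrite monotone_convergence//; last by move=> y _ m n mn; rewrite lee_fin ndF.
  (* Only squares are controlled; the bound comes from a <= 1 + a^2. *)
  apply: (@le_lt_trans _ _ (1 + fine (G x))%:E); last exact: ltry.
  apply: lime_le.
    apply: ereal_nondecreasing_is_cvgn => m n mn; apply: ge0_le_integral => //.
      by move=> y _; rewrite lee_fin.
      exact/measurable_EFinP.
      by exact/measurable_EFinP.
    by move=> y _; rewrite lee_fin ndF.
  apply: nearW => n.
  have -> : (\int[k t x]_y (F n y)%:E = (S t (F n) x)%:E)%E.
    rewrite /semigroup /Rintegral fineK//.
    exact: (integrable_fin_num measurableT (Fi n x)).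
  have : (((S t (F n) x) ^+ 2)%:E <= G x)%E.
    apply: lime_ge; first by apply: ereal_nondecreasing_is_cvgn => a b; exact: ndS2.
    by near=> m; apply: ndS2; near: m; exact: nbhs_infty_ge.
  rewrite -{1}(fineK Gx) !lee_fin; set a := S t _ _; move=> H.
  have := sqr_ge0 (a - 1/2); nra.
- by move=> n; exact/measurable_EFinP.
- by move=> n y _; rewrite lee_fin.
Unshelve. all: by end_near. Qed.

End semigroup_L2.

Section ae_tools.
Context d (T : measurableType d) (R : realType) (mu : {measure set T -> \bar R}).
Implicit Types f g h : T -> R.

Lemma ae_sym_eq f g : {ae mu, forall x, f x = g x} -> {ae mu, forall x, g x = f x}.
Proof. by apply: filterS => x ->. Qed.

Lemma ae_trans_eq g f h : {ae mu, forall x, f x = g x} -> {ae mu, forall x, g x = h x} ->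
  {ae mu, forall x, f x = h x}.
Proof. by apply: filterS2 => x -> ->. Qed.

End ae_tools.

Section aeL2.
Context d (T : measurableType d) (R : realType) (mu : probability T R).
Implicit Types f g h : T -> R.

Lemma n2_aeL f g : L2 mu f -> L2 mu g -> {ae mu, forall x, f x = g x} -> n2 mu f = n2 mu g.
Proof. by move=> lf lg; apply: n2_ae; [exact: L2_meas lf|exact: L2_meas lg]. Qed.

Lemma ip_aeL f f' g : L2 mu f -> L2 mu f' -> L2 mu g ->
  {ae mu, forall x, f x = f' x} -> ip mu f g = ip mu f' g.
Proof.
by move=> lf lf' lg; apply: ip_ae; [exact: L2_meas lf|exact: L2_meas lf'|exact: L2_meas lg].
Qed.

End aeL2.

Section semigroup_ae.
Context {R : realType} {d : nat}.
Variables (V : 'rV[R]_d -> R) (k : R -> R.-pker 'rV[R]_d ~> 'rV[R]_d).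
Variable pi : probability 'rV[R]_d R.
Hypothesis hk : langevin_transition V k.
Hypothesis hsemi : L2_contraction_semigroup k pi.
Local Notation T := 'rV[R]_d.
Local Notation S := (semigroup k).
Local Notation L2 := (L2 pi).
Local Notation n2 := (n2 pi).
Local Notation ip := (ip pi).
Implicit Types (f g h : T -> R) (s t : R).

Lemma S_D t f g : 0 <= t -> L2 f -> L2 g ->
  {ae pi, forall x, S t (f \+ g) x = (S t f \+ S t g) x}.
Proof.
move=> t0 lf lg; apply: filterS2 (S_int hsemi t0 lf) (S_int hsemi t0 lg) => x; exact: SD.
Qed.

Lemma S_B t f g : 0 <= t -> L2 f -> L2 g ->
  {ae pi, forall x, S t (f \- g) x = (S t f \- S t g) x}.
Proof.
move=> t0 lf lg; apply: filterS2 (S_int hsemi t0 lf) (S_int hsemi t0 lg) => x; exact: SB.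
Qed.

Lemma S_Z t c f : 0 <= t -> L2 f ->
  {ae pi, forall x, S t (c \*o f) x = (c \*o S t f) x}.
Proof. by move=> t0 lf; apply: filterS (S_int hsemi t0 lf) => x; exact: SZ. Qed.

Lemma n2S_B t f g : 0 <= t -> L2 f -> L2 g -> n2 (S t f \- S t g) <= n2 (f \- g).
Proof.
move=> t0 lf lg; have lfg := L2B lf lg.
apply: le_trans (S_contr hsemi t0 lfg); rewrite le_eqVlt; apply/orP; left; apply/eqP.
apply: n2_aeL; last exact/ae_sym_eq/S_B.
  by apply: L2B; exact: S_L2.
exact: S_L2.
Qed.

(** Contraction applied to f - g, which has norm 0, stands in for absolute continuity of the
    kernels. *)
Lemma S_ae t f g : 0 <= t -> L2 f -> L2 g -> {ae pi, forall x, f x = g x} ->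
  {ae pi, forall x, S t f x = S t g x}.
Proof.
move=> t0 lf lg fg.
have lSf := S_L2 hsemi t0 lf; have lSg := S_L2 hsemi t0 lg.
have E : n2 (f \- g) = 0.
  rewrite (@n2_aeL _ _ _ pi (f \- g) (cst 0)) ?n2_cst ?normr0//.
    exact: L2B.
    exact: L2_cst.
  by apply: filterS fg => x /= ->; rewrite subrr.
have : n2 (S t f \- S t g) = 0.
  by apply/eqP; rewrite eq_le n2_ge0 -E n2S_B.
move/(n2_eq0 (L2B lSf lSg)); apply: filterS => x /= /eqP.
by rewrite subr_eq0 => /eqP.
Qed.

(** Chapman-Kolmogorov in integrated form. The inner integral is an extended real; it is finite for
    k s x-almost every z because the total integral is. *)
Let S_semi_ge0 s t f : 0 <= s -> 0 <= t -> L2 f -> (forall x, 0 <= f x) ->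
  {ae pi, forall x, S (s + t) f x = S s (S t f) x}.
Proof.
move=> s0 t0 lf f0; have mf := L2_meas lf.
apply: filterS (S_int hsemi (addr_ge0 s0 t0) lf) => x fi.
have E : (\int[k (s + t) x]_y (f y)%:E = \int[k s x]_z \int[k t z]_y (f y)%:E)%E.
  apply: integral_mixture.
  - by move=> U mU; exact: measurable_kernel.
  - by move=> U mU; exact: chapman_kolmogorov.
  - exact/measurable_EFinP.
  - by move=> y; rewrite lee_fin.
have mI : measurable_fun setT (fun z => \int[k t z]_y (f y)%:E)%E.
  apply: measurable_fun_integral_kernel => //; first exact: measurable_kernel.
  exact/measurable_EFinP.
have I0 z : (0 <= \int[k t z]_y (f y)%:E)%E.
  by apply: integral_ge0 => y _; rewrite lee_fin.
rewrite {1}/semigroup /Rintegral E {1}/semigroup /Rintegral; congr fine.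
apply: ae_eq_integral => //.
  apply/measurable_EFinP; exact: S_meas.
have : (k s x).-integrable setT (fun z => \int[k t z]_y (f y)%:E)%E.
  apply/integrableP; split => //.
  under eq_integral do rewrite gee0_abs//.
  rewrite -E; exact: integrable_lty.
move/(integrable_ae measurableT); apply: filterS => z /(_ I) zf _.
by rewrite /= fineK.
Qed.

Lemma S_semi s t f : 0 <= s -> 0 <= t -> L2 f ->
  {ae pi, forall x, S (s + t) f x = S s (S t f) x}.
Proof.
move=> s0 t0 lf; have mf := L2_meas lf.
pose p x := Num.max (f x) 0; pose m x := Num.max (- f x) 0.
have lp : L2 p.
  apply: (L2_le _ lf); first exact: measurable_maxr.
  move=> x; rewrite /p; case: (leP (f x) 0) => fx; rewrite ?normr0//.
have lm : L2 m.
  apply: (L2_le _ lf); first by apply: measurable_maxr => //; exact: measurableT_comp.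
  move=> x; rewrite /m; case: (leP (- f x) 0) => fx; rewrite ?normr0// normrN//.
have E : f = p \- m.
  apply/funext => x; rewrite /= /p /m.
  by case: (leP (f x) 0) => fx; case: (leP (- f x) 0) => fx2; lra.
have lSp := S_L2 hsemi t0 lp; have lSm := S_L2 hsemi t0 lm.
have st0 := addr_ge0 s0 t0.
rewrite E; apply: ae_trans_eq (S_B st0 lp lm) _.
have H1 : {ae pi, forall x, (S (s + t) p \- S (s + t) m) x = (S s (S t p) \- S s (S t m)) x}.
  apply: filterS2 (S_semi_ge0 s0 t0 lp _) (S_semi_ge0 s0 t0 lm _); first by move=> x /= -> ->.
    by move=> x; rewrite le_max lexx orbT.
  by move=> x; rewrite le_max lexx orbT.
apply: ae_trans_eq H1 _; apply: ae_trans_eq (ae_sym_eq (S_B s0 lSp lSm)) _.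
apply: S_ae => //; first exact: L2B.
  by apply: S_L2 => //; exact: L2B.
exact/ae_sym_eq/S_B.
Qed.

Lemma S_cont f : L2 f -> forall e, 0 < e ->
  exists2 dl, 0 < dl & forall t, 0 < t -> t < dl -> n2 (S t f \- f) < e.
Proof.
move=> lf; have := semigroup_strongly_continuous hsemi lf.
move/cvg_EFin0P; apply => t t0; last exact: n2_ge0.
by rewrite /L2norm L2normE//; apply: L2B => //; apply: S_L2 => //; exact: ltW.
Qed.

Definition dq t f : T -> R := fun x => (S t f x - f x) / t.

Lemma dqE t f : dq t f = t^-1 \*o (S t f \- f).
Proof. by apply/funext => x; rewrite /dq /= mulrC. Qed.

Lemma dq_L2 t f : 0 <= t -> L2 f -> L2 (dq t f).
Proof. by move=> t0 lf; rewrite dqE; apply: L2Z; apply: L2B => //; exact: S_L2. Qed.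

Lemma genP f g : L2_generator k pi f g <-> [/\ L2 f, L2 g &
  forall e, 0 < e -> exists2 dl, 0 < dl & forall t, 0 < t -> t < dl -> n2 (dq t f \- g) < e].
Proof.
split=> -[lf lg H]; split => //.
  move/cvg_EFin0P : H; apply => t t0; last exact: n2_ge0.
  by rewrite /L2norm L2normE//; apply: (L2B (dq_L2 (ltW t0) lf)).
apply/(@cvg_EFin0P _ _ (fun t => n2 (dq t f \- g))) => // t t0; last exact: n2_ge0.
by rewrite /L2norm L2normE//; apply: (L2B (dq_L2 (ltW t0) lf)).
Qed.

Lemma S_comm_dq u t f : 0 <= u -> 0 <= t -> L2 f ->
  {ae pi, forall x, dq t (S u f) x = S u (dq t f) x}.
Proof.
move=> u0 t0 lf; have lu := S_L2 hsemi u0 lf; have lt := S_L2 hsemi t0 lf.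
have H1 : {ae pi, forall x, S t (S u f) x = S u (S t f) x}.
  by apply: ae_trans_eq (ae_sym_eq (S_semi t0 u0 lf)) _; rewrite addrC; exact: S_semi.
have := S_Z t^-1 u0 (L2B lt lf); rewrite -dqE => /ae_sym_eq H2.
apply: ae_trans_eq H2.
apply: filterS2 H1 (S_B u0 lt lf) => x; rewrite /dq /= => -> ->.
by rewrite mulrC.
Qed.

Lemma gen_S u f g : 0 <= u -> L2_generator k pi f g -> L2_generator k pi (S u f) (S u g).
Proof.
move=> u0 /genP[lf lg H]; apply/genP; split; [exact: S_L2|exact: S_L2|].
move=> e /H [dl dl0 Hd]; exists dl => // t t0 td.
apply: le_lt_trans (Hd _ t0 td).
apply: le_trans (n2S_B u0 (dq_L2 (ltW t0) lf) lg).
rewrite le_eqVlt; apply/orP; left; apply/eqP; apply: n2_aeL.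
- apply: L2B; last exact: S_L2.
  by apply: dq_L2; [exact: ltW|exact: S_L2].
- by apply: L2B; apply: S_L2 => //; apply: dq_L2 => //; exact: ltW.
by apply: filterS (S_comm_dq u0 (ltW t0) lf) => x /= ->.
Qed.

(* Uniform in u because S u commutes with the difference quotient and contracts. *)
Lemma gen_unif f g : L2_generator k pi f g -> forall e, 0 < e ->
  exists2 dl, 0 < dl & forall t u, 0 < t -> t < dl -> 0 <= u ->
    n2 (dq t (S u f) \- S (u + t) g) < e.
Proof.
move=> fg e e0; have /genP[lf lg H] := fg.
have e2 : 0 < e / 2 by rewrite divr_gt0.
have [d1 d10 H1] := H _ e2; have [d2 d20 H2] := S_cont lg e2.
exists (Num.min d1 d2); first by rewrite lt_min d10.
move=> t u t0; rewrite lt_min => /andP[td1 td2] u0.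
have t0' := ltW t0; have ut0 := addr_ge0 u0 t0'.
have ldq := dq_L2 t0' lf; have lSg := S_L2 hsemi t0' lg.
have -> : n2 (dq t (S u f) \- S (u + t) g) = n2 (S u (dq t f) \- S u (S t g)).
  apply: n2_aeL.
  - apply: L2B; last exact: S_L2.
    by apply: dq_L2 => //; exact: S_L2.
  - by apply: L2B; exact: S_L2.
  by apply: filterS2 (S_comm_dq u0 t0' lf) (S_semi u0 t0' lg) => x /= -> ->.
apply: le_lt_trans (n2S_B u0 ldq lSg) _.
apply: le_lt_trans (n2_tri ldq lg lSg) _.
by rewrite (splitr e); apply: ltrD; [exact: H1|rewrite n2C; exact: H2].
Qed.

End semigroup_ae.

(** * Completeness of L2 and density of the domain *)

Section completeness.
Context d (T : measurableType d) (R : realType) (mu : probability T R).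
Implicit Types f g h : T -> R.
Local Notation L2 := (L2 mu).
Local Notation n2 := (n2 mu).
Local Notation ip := (ip mu).

Lemma L2_ipE f : L2 f -> (\int[mu]_x (f x ^+ 2)%:E = (n2 f ^+ 2)%:E)%E.
Proof.
move=> lf; rewrite n2_sqr ipE /Rintegral fineK//.
exact: (integrable_fin_num measurableT (L2_int_mul lf lf)).
Qed.

(** Fatou's lemma for the squares. Completeness, the gradient estimate and the semicontinuity of the
    moment all rest on it. *)
Lemma fatou_L2 (v : (T -> R)^nat) (w : T -> R) c : (forall m, L2 (v m)) -> (forall m, n2 (v m) <= c) ->
  measurable_fun setT w -> {ae mu, forall x, v m x @[m --> \oo] --> w x} ->
  L2 w /\ n2 w <= c.
Proof.
move=> lv vc mw vw.
have c0 : 0 <= c := le_trans (n2_ge0 mu (v 0%N)) (vc 0%N).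
pose F n x := ((v n x) ^+ 2)%:E.
have mF n : measurable_fun setT (F n).
  by apply/measurable_EFinP/measurable_funX; exact: L2_meas (lv n).
have mw2 : measurable_fun setT (fun x => (w x ^+ 2)%:E).
  exact/measurable_EFinP/measurable_funX.
have F0 n x : setT x -> (0 <= F n x)%E by rewrite lee_fin sqr_ge0.
have E : ae_eq mu setT (fun x => (w x ^+ 2)%:E) (fun x => limn_einf (F^~ x)).
  apply: filterS vw => x vx _.
  have H : F n x @[n --> \oo] --> (w x ^+ 2)%:E.
    by apply: cvg_EFin; [exact: nearW|rewrite /comp /=; under eq_fun do rewrite expr2; rewrite expr2; exact: cvgM].
  by rewrite is_cvg_limn_einfE ?(cvg_lim _ H)//; apply/cvg_ex; eexists; exact: H.
have le : (\int[mu]_x (w x ^+ 2)%:E <= (c ^+ 2)%:E)%E.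
  rewrite (ae_eq_integral (fun x => limn_einf (F^~ x)))//; last first.
    apply: (emeasurable_fun_cvg (fun n x => einfs (F^~ x) n)); first exact: measurable_fun_einfs.
    by move=> x _; rewrite limn_einf_lim; exact: is_cvg_einfs.
  apply: le_trans (fatou mu measurableT mF F0) _.
  rewrite limn_einf_lim; apply: lime_le; first exact: is_cvg_einfs.
  apply: nearW => n; apply: (@le_trans _ _ (\int[mu]_x F n x)%E).
    by apply: ereal_inf_lbound; exists n => /=.
  by rewrite L2_ipE// lee_fin lerXn2r// nnegrE ?n2_ge0.
have lw : L2 w.
  apply/L2P; split => //; apply/integrableP; split => //.
  under eq_integral do rewrite gee0_abs ?lee_fin ?sqr_ge0//.
  exact: le_lt_trans le (ltry _).
split=> //; rewrite -(@ler_pXn2r _ 2)// ?nnegrE ?n2_ge0//.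
by rewrite -lee_fin -L2_ipE.
Qed.

Lemma n2_sum (u : (T -> R)^nat) n : (forall n, L2 (u n)) ->
  L2 (fun x => \sum_(0 <= k < n) u k x) /\
  n2 (fun x => \sum_(0 <= k < n) u k x) <= \sum_(0 <= k < n) n2 (u k).
Proof.
move=> lu; elim: n => [|n [l1 l2]].
  under eq_fun do rewrite big_nil; rewrite big_nil; split; first exact: L2_cst.
  by rewrite n2_cst normr0.
rewrite (_ : (fun x => _) = (fun x => \sum_(0 <= k < n) u k x) \+ u n); last first.
  by apply/funext => x; rewrite big_nat_recr.
split; first exact: L2D.
by rewrite big_nat_recr//=; apply: le_trans (n2D l1 (lu n)) _; rewrite lerD.
Qed.

(** Riesz-Fischer: the partial sums of |u (n+1) - u n| have L2 norm at most 2, so by monotone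
    convergence they stay bounded almost everywhere, and the telescoping series converges absolutely
    there. *)
Lemma L2_fast_complete (u : (T -> R)^nat) : (forall n, L2 (u n)) ->
  (forall n, n2 (u n.+1 \- u n) <= 2^-1 ^+ n) ->
  exists w, [/\ L2 w & {ae mu, forall x, u n x @[n --> \oo] --> w x}].
Proof.
move=> lu hu.
pose D n x := `|u n.+1 x - u n x|.
have lD n : L2 (D n) by apply: L2_norm; exact: L2B.
have n2DD n : n2 (D n) <= 2^-1 ^+ n.
  by apply: le_trans (hu n); apply: n2_le => //; [exact: L2B|move=> x /=; rewrite /D normr_id].
pose g N x := \sum_(0 <= k < N) D k x.
have lg N : L2 (g N) by case: (n2_sum N lD).
have ng N : n2 (g N) <= 2.
  have [_ H] := n2_sum N lD; apply: le_trans H _.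
  apply: (@le_trans _ _ (\sum_(0 <= k < N) 2^-1 ^+ k)); first exact: ler_sum.
  have -> : \sum_(0 <= k < N) 2^-1 ^+ k = 2 - 2 * 2^-1 ^+ N :> R.
    elim: N => [|N IH]; first by rewrite big_nil expr0 mulr1 subrr.
    by rewrite big_nat_recr//= IH exprS; field.
  by rewrite gerBl mulr_ge0// exprn_ge0// invr_ge0.
have ndg x m n : (m <= n)%N -> g m x <= g n x.
  move=> /subnKC <-; elim: (n - m)%N => [|j IH]; rewrite ?addn0// addnS.
  by apply: le_trans IH _; rewrite /g [leRHS]big_nat_recr//= lerDl normr_ge0.
have g0 n x : 0 <= g n x by apply: sumr_ge0 => i _; exact: normr_ge0.
pose G x := limn (fun n => ((g n x) ^+ 2)%:E).
have ndg2 x m n : (m <= n)%N -> (((g m x) ^+ 2)%:E <= ((g n x) ^+ 2)%:E)%E.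
  by move=> mn; rewrite lee_fin lerXn2r// ?nnegrE// ndg.
have mg n : measurable_fun setT (fun x => ((g n x) ^+ 2)%:E).
  by apply/measurable_EFinP/measurable_funX; exact: L2_meas (lg n).
have cg x : cvgn (fun n => ((g n x) ^+ 2)%:E).
  by apply: ereal_nondecreasing_is_cvgn => m n; exact: ndg2.
have mG : measurable_fun setT G.
  by apply: (emeasurable_fun_cvg (fun n x => ((g n x) ^+ 2)%:E)) => // x _; exact: cg.
have G0 x : (0 <= G x)%E.
  by apply: lime_ge => //; apply: nearW => n; rewrite lee_fin sqr_ge0.
have iG : mu.-integrable setT G.
  apply/integrableP; split => //.
  under eq_integral do rewrite gee0_abs//.
  rewrite /G monotone_convergence//; last 2 first.
    by move=> n x _; rewrite lee_fin sqr_ge0.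
    by move=> x _ m n; exact: ndg2.
  apply: (@le_lt_trans _ _ 4%:E); last exact: ltry.
  apply: lime_le.
    apply: ereal_nondecreasing_is_cvgn => m n mn; apply: ge0_le_integral => //.
      by move=> x _; rewrite lee_fin sqr_ge0.
    by move=> x _; exact: ndg2.
  apply: nearW => n; rewrite L2_ipE// lee_fin.
  have := ng n; have := n2_ge0 mu (g n); nra.
have cu : {ae mu, forall x, cvgn (u^~ x)}.
  have := integrable_ae measurableT iG; apply: filterS => x /(_ I) Gx.
  have gG n : g n x <= 1 + fine (G x).
    have : (((g n x) ^+ 2)%:E <= G x)%E.
      by apply: lime_ge => //; near=> m; apply: ndg2; near: m; exact: nbhs_infty_ge.
    rewrite -{1}(fineK Gx) lee_fin => H.
    have := sqr_ge0 (g n x - 1/2); nra.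
  have : cvgn (series (fun n => u n.+1 x - u n x)).
    apply: normed_cvg; apply: nondecreasing_is_cvgn.
      by move=> m n mn; exact: ndg.
    by exists (1 + fine (G x)) => _ [n _ <-]; exact: gG.
  rewrite (_ : series _ = (fun n => u n x - u 0%N x)); last first.
    by apply/funext => n; rewrite /series/= telescope_sumr.
  move=> /cvg_ex[l cl]; apply/cvg_ex; exists (l + u 0%N x).
  rewrite (_ : u^~ x = (fun n => (u n x - u 0%N x) + u 0%N x)); last first.
    by apply/funext => n; rewrite subrK.
  by apply: cvgD cl _; exact: cvg_cst.
(* The limit superior is measurable without singling out the set of convergence; where it is
   infinite, [fine] gives 0. *)
pose w x := fine (limn_esup (fun n => (u n x)%:E)).
have mw : measurable_fun setT w.
  apply: (measurableT_comp (@fine_measurable _ _ measurableT)) => //.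
  apply: measurable_fun_limn_esup => n; apply/measurable_EFinP; exact: L2_meas (lu n).
have uw : {ae mu, forall x, u n x @[n --> \oo] --> w x}.
  apply: filterS cu => x /cvg_ex[l ul].
  have H : (u n x)%:E @[n --> \oo] --> l%:E.
    by apply: cvg_EFin; [exact: nearW|exact: ul].
  by rewrite /w (cvg_limn_einf_sup H).2.
exists w; split => //.
apply: (fatou_L2 (c := n2 (u 0%N) + 2) lu _ mw uw).1 => n.
have -> : u n = u 0%N \+ (u n \- u 0%N) by apply/funext => x /=; ring.
apply: le_trans (n2D (lu _) (L2B (lu n) (lu 0%N))) _; rewrite lerD2l.
apply: le_trans (ng n); apply: n2_le => //; first exact: L2B.
move=> x /=; rewrite -(telescope_sumr (u^~ x))// (ger0_norm (g0 n x)).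
exact: ler_norm_sum.
Unshelve. all: by end_near. Qed.

Lemma L2_complete (u : (T -> R)^nat) : (forall n, L2 (u n)) ->
  (forall e, 0 < e -> exists N, forall n, (N <= n)%N -> n2 (u n \- u N) <= e) ->
  exists2 w, L2 w & forall e, 0 < e -> exists N, forall n, (N <= n)%N -> n2 (u n \- w) <= e.
Proof.
move=> lu hu.
have hu' k : exists N, forall n, (N <= n)%N -> n2 (u n \- u N) <= 2^-1 ^+ k / 2.
  by apply: hu; rewrite divr_gt0// exprn_gt0// invr_gt0.
have [N HN] := choice hu'.
(* Summing the N j makes the indices monotone in k while keeping ph k >= N k. *)
pose ph k := (\sum_(j < k.+1) N j)%N.
have phN k : (N k <= ph k)%N by rewrite /ph big_ord_recr/= leq_addl.
have phS k : (ph k <= ph k.+1)%N by rewrite /ph (big_ord_recr k.+1)/= leq_addr.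
have cau k m n : (ph k <= m)%N -> (ph k <= n)%N -> n2 (u m \- u n) <= 2^-1 ^+ k.
  move=> km kn; apply: le_trans (n2_tri (lu m) (lu (N k)) (lu n)) _.
  rewrite (splitr (2^-1 ^+ k)) lerD//; first by apply: HN; exact: leq_trans km.
  by rewrite n2C; apply: HN; exact: leq_trans kn.
have [w [lw uw]] := L2_fast_complete (fun k => lu (ph k)) (fun k => cau k _ _ (phS k) (leqnn _)).
exists w => // e e0.
have [k ke] : exists k, 2^-1 ^+ k <= e :> R.
  have : (2^-1 ^+ k : R) @[k --> \oo] --> 0 by apply: cvg_expr; rewrite ger0_norm ?invf_lt1 ?ltr1n.
  move/cvgrPdist_le => /(_ _ e0) [k _ /(_ k (leqnn k))]; rewrite /= sub0r normrN ger0_norm ?exprn_ge0//.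
  by exists k.
exists (ph k) => n kn.
(* The Cauchy bound between u n and the subsequence passes to the limit along the subsequence. *)
apply: (@fatou_L2 (fun j => u n \- u (ph (j + k)%N)) (u n \- w) e _ _ _ _).2.
- by move=> j; exact: L2B.
- move=> j; apply: le_trans ke; apply: cau => //.
  by elim: j => [|j IH]; rewrite ?add0n// addSn; apply: leq_trans IH (phS _).
- by apply: measurable_funB; [exact: L2_meas (lu n)|exact: L2_meas lw].
- apply: filterS uw => x ux; apply: cvgB; first exact: cvg_cst.
  by move: ux; rewrite -(cvg_shiftn k).
Qed.

End completeness.

Lemma ae_and d (T : measurableType d) (R : realType) (mu : {measure set T -> \bar R})
  (P Q : T -> Prop) : {ae mu, forall x, P x} -> {ae mu, forall x, Q x} ->
  {ae mu, forall x, P x /\ Q x}.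
Proof. by apply: filterS2 => x. Qed.

Section mid.
Context d (T : measurableType d) (R : realType) (mu : probability T R).
Implicit Types f g h : T -> R.

Definition mid f g : T -> R := fun x => (f x + g x) / 2.

Lemma midE f g : mid f g = 2^-1 \*o (f \+ g).
Proof. by apply/funext => x; rewrite /mid /= mulrC. Qed.

Lemma L2_mid f g : L2 mu f -> L2 mu g -> L2 mu (mid f g).
Proof. by move=> lf lg; rewrite midE; apply: L2Z; exact: L2D. Qed.

Lemma n2_mid f g f' g' : L2 mu f -> L2 mu g -> L2 mu f' -> L2 mu g' ->
  n2 mu (mid f g \- mid f' g') <= (n2 mu (f \- f') + n2 mu (g \- g')) / 2.
Proof.
move=> lf lg lf' lg'.
have -> : mid f g \- mid f' g' = 2^-1 \*o ((f \- f') \+ (g \- g')).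
  by apply/funext => x; rewrite /mid /=; field.
rewrite n2Z; last by apply: L2D; exact: L2B.
rewrite ger0_norm ?invr_ge0// mulrC ler_wpM2r ?invr_ge0//.
by apply: n2D; exact: L2B.
Qed.

Lemma n2_subae f f' g g' : L2 mu f -> L2 mu f' -> L2 mu g -> L2 mu g' ->
  {ae mu, forall x, f x = f' x} -> {ae mu, forall x, g x = g' x} ->
  n2 mu (f \- g) = n2 mu (f' \- g').
Proof.
move=> lf lf' lg lg' ff gg; apply: n2_aeL; [exact: L2B|exact: L2B|].
by apply: filterS2 ff gg => x /= -> ->.
Qed.

Lemma n2_small f g : L2 mu f -> L2 mu g -> (forall e, 0 < e -> n2 mu (f \- g) <= e) ->
  {ae mu, forall x, f x = g x}.
Proof.
move=> lf lg H.
have : n2 mu (f \- g) = 0.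
  apply/eqP; rewrite eq_le n2_ge0 andbT; apply/ler_addgt0Pr => e e0; rewrite add0r; exact: H.
move/(n2_eq0 (L2B lf lg)); apply: filterS => x /= /eqP.
by rewrite subr_eq0 => /eqP.
Qed.

End mid.

Section dense.
Context {R : realType} {d : nat}.
Variables (V : 'rV[R]_d -> R) (k : R -> R.-pker 'rV[R]_d ~> 'rV[R]_d).
Variable pi : probability 'rV[R]_d R.
Hypothesis hk : langevin_transition V k.
Hypothesis hsemi : L2_contraction_semigroup k pi.
Local Notation T := 'rV[R]_d.
Local Notation S := (semigroup k).
Local Notation L2 := (L2 pi).
Local Notation n2 := (n2 pi).
Local Notation ip := (ip pi).
Implicit Types (f g h : T -> R) (s t a : R).

(** The realising diffusion starts at x for every outcome, and the Markov property with both times 0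
    reads off the kernel. *)
Lemma kernel0E x A : measurable A -> k 0 x A = \d_x A.
Proof.
move=> mA.
have [dW [W [P [F [B [X [[sde mk] X0]]]]]]] := hk x.
have FT : F 0 setT.
  have [F0 H _] := filtration_sigma (sde_filtration sde) (lexx 0).
  by have := H _ F0; rewrite setD0.
have := mk 0 0 setT A (lexx _) (lexx _) FT mA.
rewrite setTI subrr.
under eq_integral do rewrite X0.
rewrite integral_cst_prob => <-.
rewrite diracE; case: (boolP (x \in A)) => [xA|xA].
  rewrite (_ : _ @^-1` _ = setT); first exact: probability_setT.
  by rewrite -subTset => w _ /=; rewrite X0; exact: set_mem.
rewrite (_ : _ @^-1` _ = set0) ?measure0//.
by rewrite -subset0 => w /=; rewrite X0 => /mem_set; rewrite (negbTE xA).
Qed.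

Lemma S0 f : measurable_fun setT f -> S 0 f = f.
Proof.
move=> mf; apply/funext => x; rewrite /semigroup /Rintegral.
have -> : (\int[k 0 x]_y (f y)%:E = \int[\d_x]_y (f y)%:E)%E.
  by apply: eq_measure_integral => A mA _; exact: kernel0E.
rewrite integral_dirac//; last exact/measurable_EFinP.
by rewrite diracT mul1e.
Qed.

Lemma S_mid t f g : 0 <= t -> L2 f -> L2 g ->
  {ae pi, forall x, S t (mid f g) x = mid (S t f) (S t g) x}.
Proof.
move=> t0 lf lg; rewrite !midE.
apply: ae_trans_eq (S_Z hsemi 2^-1 t0 (L2D lf lg)) _.
by apply: filterS (S_D hsemi t0 lf lg) => x /= ->.
Qed.

(* avg n a f is the dyadic Riemann sum of (1/a) \int_0^a S s f ds with 2^n nodes; its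
   limit lies in the domain, which avoids integrating L^2-valued functions. *)
Fixpoint avg n a f : T -> R :=
  if n is n'.+1 then mid (avg n' (a / 2) f) (S (a / 2) (avg n' (a / 2) f)) else f.

Lemma avg_L2 n a f : 0 <= a -> L2 f -> L2 (avg n a f).
Proof.
elim: n a => [//|n IH] a a0 lf /=; have a2 : 0 <= a / 2 by rewrite divr_ge0.
by apply: L2_mid; [exact: IH|apply: S_L2 => //; exact: IH].
Qed.

(** [avg p a f] is a mean of S u f over grid points u in [0, a), which S s moves into [s, s + a). *)
Lemma avg_near dl e f : L2 f -> (forall t, 0 <= t -> t < dl -> n2 (S t f \- f) <= e) ->
  forall p a s, 0 < a -> 0 <= s -> s + a <= dl -> n2 (S s (avg p a f) \- f) <= e.
Proof.
move=> lf H; elim=> [|p IH] a s a0 s0 sa /=.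
  by apply: H => //; apply: lt_le_trans sa; rewrite ltrDl.
have a2 : 0 < a / 2 by rewrite divr_gt0.
have sa2 : 0 <= s + a / 2 by rewrite addr_ge0// ltW.
have lA := avg_L2 p (ltW a2) lf; set A := avg p (a / 2) f in lA *.
have lSA := S_L2 hsemi (ltW a2) lA.
have -> : n2 (S s (mid A (S (a / 2) A)) \- f) = n2 (mid (S s A) (S (s + a / 2) A) \- mid f f).
  apply: n2_subae => //.
  - by apply: S_L2 => //; exact: L2_mid.
  - by apply: L2_mid; exact: S_L2.
  - exact: L2_mid.
  - apply: ae_trans_eq (S_mid s0 lA lSA) _.
    by apply: filterS (S_semi hk hsemi s0 (ltW a2) lA) => x; rewrite /mid => ->.
  - by apply: nearW => x; rewrite /mid; field.
apply: le_trans (n2_mid _ _ lf lf) _; try exact: S_L2.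
rewrite ler_pdivrMr// mulr_natr mulr2n lerD//; apply: IH => //.
  by apply: le_trans sa; rewrite lerD2l ler_pdivrMr// mulr_natr mulr2n lerDl ltW.
by apply: le_trans sa; rewrite -addrA -splitr.
Qed.

(** Refining the grid replaces f, on each of the 2^n blocks of length a / 2^n, by its mean over one
    block; contraction carries the error unchanged through the halving. *)
Lemma avg_cauchy dl e f : L2 f -> (forall t, 0 <= t -> t < dl -> n2 (S t f \- f) <= e) ->
  forall n p a, 0 < a -> a / 2 ^+ n <= dl -> n2 (avg (n + p) a f \- avg n a f) <= e.
Proof.
move=> lf H; elim=> [|n IH] p a a0 ad.
  rewrite add0n /= -[avg p a f]S0; last by exact: L2_meas (avg_L2 p (ltW a0) lf).
  by apply: (avg_near lf H) => //; rewrite add0r -[leLHS]divr1.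
rewrite addSn /=.
have a2 : 0 < a / 2 by rewrite divr_gt0.
have lA := avg_L2 (n + p) (ltW a2) lf; have lB := avg_L2 n (ltW a2) lf.
have {}IH : n2 (avg (n + p) (a / 2) f \- avg n (a / 2) f) <= e.
  by apply: IH => //; rewrite -mulrA -invfM -exprS.
set A := avg (n + p) _ _ in lA IH *; set B := avg n _ _ in lB IH *.
have lSA := S_L2 hsemi (ltW a2) lA; have lSB := S_L2 hsemi (ltW a2) lB.
apply: le_trans (n2_mid lA lSA lB lSB) _.
rewrite ler_pdivrMr// mulr_natr mulr2n lerD//.
exact: le_trans (n2S_B hsemi (ltW a2) lA lB) IH.
Qed.

Lemma S_cont0 f : L2 f -> forall e, 0 < e ->
  exists2 dl, 0 < dl & forall t, 0 <= t -> t < dl -> n2 (S t f \- f) <= e.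
Proof.
move=> lf e e0; have [dl dl0 H] := S_cont hsemi lf e0; exists dl => // t.
rewrite le_eqVlt => /predU1P[<- _|t0 td]; last exact/ltW/H.
have -> : S 0 f = f by apply: S0; exact: L2_meas lf.
suff -> : f \- f = cst 0 by rewrite n2_cst normr0 ltW.
by apply/funext => x /=; rewrite subrr.
Qed.

Lemma half_small (x e : R) : 0 < e -> exists N, forall n, (N <= n)%N -> x / 2 ^+ n < e.
Proof.
move=> e0.
have : (`|x| * (2^-1 ^+ n) : R) @[n --> \oo] --> `|x| * 0.
  by apply: cvgMr; apply: cvg_expr; rewrite ger0_norm ?invf_lt1 ?ltr1n.
rewrite mulr0 => /cvgrPdist_lt /(_ _ e0) [N _ HN]; exists N => n Nn.
have := HN n Nn; rewrite /= sub0r normrN normrM normr_id => H.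
apply: le_lt_trans H; apply: le_trans (ler_norm _) _.
by rewrite normrM -exprVn.
Qed.

Definition is_avg a f u := L2 u /\ forall e, 0 < e -> exists N, forall n, (N <= n)%N ->
  n2 (avg n a f \- u) <= e.

Lemma avg_ex a f : 0 < a -> L2 f -> exists u, is_avg a f u.
Proof.
move=> a0 lf.
have [|u lu H] := L2_complete (fun n => avg_L2 n (ltW a0) lf); last by exists u.
move=> e e0; have [dl dl0 Hd] := S_cont0 lf e0.
have [N HN] := half_small a dl0; exists N => n /subnKC <-.
by apply: (avg_cauchy lf Hd) => //; apply: ltW; exact: HN.
Qed.

(** Telescoping: with b = a / 2^m and g = avg p b f, the finer average is the mean of S (j b) g over
    j < 2^m, and S b - 1 leaves only the end terms S a g - g. The induction halves a, using (1 + S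
    (a/2)) (S (a/2) - 1) = S a - 1. *)
Lemma S_dq_avg m p a f : 0 < a -> L2 f ->
  {ae pi, forall x, (S (a / 2 ^+ m) (avg (m + p) a f) \- avg (m + p) a f) x =
     (2^-1 ^+ m \*o (S a (avg p (a / 2 ^+ m) f) \- avg p (a / 2 ^+ m) f)) x}.
Proof.
move=> a0 lf; elim: m a a0 => [|m IH] a a0.
  by apply: nearW => x /=; rewrite add0n expr0 divr1 mul1r.
rewrite addSn /=.
have a2 : 0 < a / 2 by rewrite divr_gt0.
have := IH _ a2; rewrite -mulrA -invfM -exprS => {}IH.
set b := a / 2 ^+ m.+1 in IH *.
have b0 : 0 < b by rewrite divr_gt0// exprn_gt0.
have lA := avg_L2 (m + p) (ltW a2) lf; have lg := avg_L2 p (ltW b0) lf.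
set A := avg (m + p) _ _ in lA IH *; set g := avg p _ _ in lg IH *.
have lSA := S_L2 hsemi (ltW a2) lA; have lSg := S_L2 hsemi (ltW a2) lg.
have lbA := S_L2 hsemi (ltW b0) lA.
have H1 := S_mid (ltW b0) lA lSA.
have H2 : {ae pi, forall x, S b (S (a / 2) A) x = S (a / 2) (S b A) x}.
  apply: ae_trans_eq (ae_sym_eq (S_semi hk hsemi (ltW b0) (ltW a2) lA)) _; rewrite addrC.
  exact: S_semi hk hsemi _ _ _ (ltW a2) (ltW b0) lA.
have H3 := S_B hsemi (ltW a2) lbA lA.
have H4 := S_ae hsemi (ltW a2) (L2B lbA lA) (L2Z (2^-1 ^+ m) (L2B lSg lg)) IH.
have H5 := S_Z hsemi (2^-1 ^+ m) (ltW a2) (L2B lSg lg).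
have H6 := S_B hsemi (ltW a2) lSg lg.
have H7 := S_semi hk hsemi (ltW a2) (ltW a2) lg.
rewrite -splitr in H7.
move: (ae_and (ae_and H1 H2) (ae_and (ae_and H3 H4) (ae_and (ae_and H5 H6) (ae_and H7 IH)))).
apply: filterS => x [[E1 E2] [[E3 E4] [[E5 E6] [E7 E8]]]].
rewrite /= E1 /mid E2; move: E3; rewrite E4 /= => E3.
have {}E3 : S (a / 2) (S b A) x = S (a / 2) A x + 2^-1 ^+ m * (S a g x - S (a / 2) g x).
  by rewrite E7; move: E5 E6 => /= E5 E6; rewrite E5 E6 in E3; rewrite E3; ring.
rewrite E3; move: E8 => /= E8.
have {}E8 : S b A x = A x + 2^-1 ^+ m * (S (a / 2) g x - g x) by rewrite -E8; ring.
by rewrite E8 exprS; field.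
Qed.

Lemma avg_dyadic m a f u v : 0 < a -> L2 f -> is_avg a f u -> is_avg (a / 2 ^+ m) f v ->
  {ae pi, forall x, (S (a / 2 ^+ m) u \- u) x = (2^-1 ^+ m \*o (S a v \- v)) x}.
Proof.
move=> a0 lf [lu Hu] [lv Hv]; set b := a / 2 ^+ m in Hv *.
have b0 : 0 < b by rewrite divr_gt0// exprn_gt0.
have lSu := S_L2 hsemi (ltW b0) lu; have lSv := S_L2 hsemi (ltW a0) lv.
apply: n2_small; [exact: L2B|by apply: L2Z; exact: L2B|].
move=> e e0; have e4 : 0 < e / 4 by rewrite divr_gt0.
have [N1 H1] := Hu _ e4; have [N2 H2] := Hv _ e4.
set p := (N1 + N2)%N.
have {}H1 : n2 (avg (m + p) a f \- u) <= e / 4.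
  by apply: H1; rewrite /p; apply: leq_trans (leq_addl m _); rewrite leq_addr.
have {}H2 : n2 (avg p b f \- v) <= e / 4 by apply: H2; rewrite /p leq_addl.
have lA := avg_L2 (m + p) (ltW a0) lf; have lg := avg_L2 p (ltW b0) lf.
have E := S_dq_avg m p a0 lf.
rewrite -/b in E.
set A := avg (m + p) _ _ in lA H1 E; set g := avg p _ _ in lg H2 E.
have lSA := S_L2 hsemi (ltW b0) lA; have lSg := S_L2 hsemi (ltW a0) lg.
have lm := L2Z (2^-1 ^+ m) (L2B lSv lv).
apply: le_trans (n2_tri (L2B lSu lu) (L2B lSA lA) lm) _.
have X1 : n2 ((S b u \- u) \- (S b A \- A)) <= e / 2.
  rewrite (_ : _ \- _ = (S b u \- S b A) \- (u \- A)); last by apply/funext => x /=; ring.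
  apply: le_trans (n2B (L2B lSu lSA) (L2B lu lA)) _.
  have := n2S_B hsemi (ltW b0) lu lA; rewrite (n2C _ u A) => X.
  by have := le_trans X H1; lra.
have X2 : n2 ((S b A \- A) \- (2^-1 ^+ m \*o (S a v \- v))) <= e / 2.
  rewrite (n2_subae (L2B lSA lA) (L2Z (2^-1 ^+ m) (L2B lSg lg)) lm lm E); last exact: nearW.
  rewrite (_ : _ \- _ = 2^-1 ^+ m \*o ((S a g \- S a v) \- (g \- v))); last first.
    by apply/funext => x /=; ring.
  rewrite n2Z; last by apply: L2B; exact: L2B.
  have m1 : `|2^-1 ^+ m| <= 1 :> R.
    by rewrite ger0_norm ?exprn_ge0 ?invr_ge0// exprn_ile1// ?invr_ge0// invf_le1// ler1n.
  apply: le_trans (ler_wpM2r (n2_ge0 _ _) m1) _; rewrite mul1r.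
  apply: le_trans (n2B (L2B lSg lSv) (L2B lg lv)) _.
  have := n2S_B hsemi (ltW a0) lg lv => X.
  by have := le_trans X H2; lra.
lra.
Qed.

Lemma avg_limit_near dl e f : L2 f -> (forall t, 0 <= t -> t < dl -> n2 (S t f \- f) <= e) ->
  forall a s u, 0 < a -> 0 <= s -> s + a <= dl -> is_avg a f u -> n2 (S s u \- f) <= e.
Proof.
move=> lf H a s u a0 s0 sa [lu Hu]; apply/ler_addgt0Pr => e1 /Hu[N /(_ N (leqnn _)) HN].
have lA := avg_L2 N (ltW a0) lf.
apply: le_trans (n2_tri (S_L2 hsemi s0 lu) (S_L2 hsemi s0 lA) lf) _; rewrite addrC.
apply: lerD; first exact: avg_near H _ _ _ _ _ sa.
by apply: le_trans (n2S_B hsemi s0 lu lA) _; rewrite n2C.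
Qed.

(** For u = (1/a) int_0^a S s f ds the generator yields (S a f - f) / a. Telescoping shows that S t
    u - u is close to t times this, first at multiples of b = a / 2^m, then at every small t by
    strong continuity. *)
Lemma avg_gen a f u : 0 < a -> L2 f -> is_avg a f u -> L2_generator k pi u (dq k a f).
Proof.
move=> a0 lf au; have lu := au.1; have lg := dq_L2 hsemi (ltW a0) lf.
set g := dq k a f in lg *.
apply/genP => //; split=> // e e0.
(* Each grid step of length b contributes b / a times S a - 1 applied to an error of size e a / 4,
   hence at most b e / 2. *)
have e1 : 0 < e * a / 4 by rewrite divr_gt0// mulr_gt0.
have [dl dl0 Hd] := S_cont0 lf e1.
have K0 m i : (a / 2 ^+ m) *+ i.+1 <= dl ->
   n2 ((S ((a / 2 ^+ m) *+ i) u \- u) \- ((a / 2 ^+ m) *+ i \*o g)) <= (a / 2 ^+ m) *+ i * (e / 2).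
  set b := a / 2 ^+ m; have b0 : 0 < b by rewrite divr_gt0// exprn_gt0.
  elim: i => [|i IH] bi.
    rewrite mulr0n mul0r.
    have -> : S 0 u = u by apply: S0; exact: L2_meas lu.
    suff -> : u \- u \- (0 \*o g) = cst 0 by rewrite n2_cst normr0.
    by apply/funext => x /=; ring.
  have {}IH := IH (le_trans (ler_wpMn2l (ltW b0) (leqnSn _)) bi).
  have [v av] := avg_ex b0 lf; have lv := av.1.
  set s := b *+ i in IH *; have s0 : 0 <= s by rewrite mulrn_wge0// ltW.
  have sb : b *+ i.+1 = s + b by rewrite mulrSr.
  rewrite sb.
  have lSu := S_L2 hsemi (ltW b0) lu; have lSsu := S_L2 hsemi s0 lu; have lSsv := S_L2 hsemi s0 lv.
  have lSbu := S_L2 hsemi (addr_ge0 s0 (ltW b0)) lu.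
  have lSav := S_L2 hsemi (ltW a0) lv; have lSaf := S_L2 hsemi (ltW a0) lf.
  have lSaSsv := S_L2 hsemi (ltW a0) lSsv.
  have E : {ae pi, forall x, (S (s + b) u \- S s u) x =
      (b \*o (a^-1 \*o (S a (S s v) \- S s v))) x}.
    have H1 := S_semi hk hsemi s0 (ltW b0) lu.
    have H2 := S_B hsemi s0 lSu lu.
    have H3 := S_ae hsemi s0 (L2B lSu lu) (L2Z (2^-1 ^+ m) (L2B lSav lv)) (avg_dyadic a0 lf au av).
    have H4 := S_Z hsemi (2^-1 ^+ m) s0 (L2B lSav lv).
    have H5 := S_B hsemi s0 lSav lv.
    have H6 := S_semi hk hsemi s0 (ltW a0) lv.
    have H7 := S_semi hk hsemi (ltW a0) s0 lv; rewrite addrC in H7.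
    move: (ae_and (ae_and H1 H2) (ae_and (ae_and H3 H4) (ae_and (ae_and H5 H6) H7))).
    apply: filterS => x [[E1 E2] [[E3 E4] [[E5 E6] E7]]].
    rewrite /= E1; move: E2; rewrite E3 E4 /= => <-; rewrite E5 /= -E6 E7.
    rewrite mulrA; congr (_ * _).
    by rewrite /b exprVn mulrAC mulfV ?gt_eqF// mul1r.
  have Lg1 : L2 (b \*o g) by exact: L2Z.
  have Lg2 : L2 (s \*o g) by exact: L2Z.
  rewrite (_ : _ \- _ = ((S s u \- u) \- (s \*o g)) \+ ((S (s + b) u \- S s u) \- (b \*o g))); last first.
    by apply/funext => x /=; ring.
  apply: le_trans (n2D _ _) _; [by apply: L2B => //; exact: L2B|by apply: L2B => //; exact: L2B|].
  rewrite mulrDl; apply: lerD => //.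
  have Lw : L2 (b \*o (a^-1 \*o (S a (S s v) \- S s v))).
    by apply: L2Z; apply: L2Z; exact: L2B.
  rewrite (n2_subae (L2B lSbu lSsu) Lw Lg1 Lg1 E); last exact: nearW.
  rewrite (_ : _ \- _ = (b / a) \*o ((S a (S s v) \- S a f) \- (S s v \- f))); last first.
    by apply/funext => x; rewrite /g /dq /=; field; rewrite gt_eqF.
  rewrite n2Z; last by apply: L2B; exact: L2B.
  rewrite ger0_norm; last by rewrite divr_ge0// ltW.
  rewrite -mulrA ler_pM2l// ler_pdivrMl//.
  have X : n2 (S s v \- f) <= e * a / 4.
    apply: (avg_limit_near lf Hd b0 s0 _ av); rewrite -sb.
    by apply: le_trans bi; rewrite ler_wpMn2l// ltW.
  have Y := le_trans (n2S_B hsemi (ltW a0) lSsv lf) X.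
  apply: le_trans (n2B (L2B lSaSsv lSaf) (L2B lSsv lf)) _; lra.
exists dl => // t t0 td.
have lSu := S_L2 hsemi (ltW t0) lu.
suff X : n2 ((S t u \- u) \- (t \*o g)) <= t * (e / 2).
  rewrite (_ : _ \- _ = t^-1 \*o ((S t u \- u) \- (t \*o g))); last first.
    by apply/funext => x; rewrite /dq /=; field; rewrite gt_eqF.
  rewrite n2Z; last by apply: L2B; [exact: L2B|exact: L2Z].
  rewrite ger0_norm; last by rewrite invr_ge0 ltW.
  rewrite ltr_pdivrMl//; apply: le_lt_trans X _.
  by rewrite ltr_pM2l// ltr_pdivrMr// ltr_pMr// ltr1n.
apply/ler_addgt0Pr => e2 e20.
have ng0 := n2_ge0 pi g.
have e3 : 0 < e2 / 2 by rewrite divr_gt0.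
have [d2 d20 Hd2] := S_cont0 lu e3.
have e4 : 0 < e2 / (2 * (1 + n2 g)) by rewrite divr_gt0// mulr_gt0// ltr_wpDr.
(* The mesh is so fine that moving t to its grid point costs at most e2 / 2 in S t u and e2 / 2 in t
   g, and that the next grid point still lies below dl. *)
have e5 : 0 < Num.min (Num.min d2 (dl - t)) (e2 / (2 * (1 + n2 g))).
  by rewrite !lt_min d20 e4 subr_gt0 td.
have [m /(_ m (leqnn _))] := half_small a e5.
rewrite !lt_min; set b := a / 2 ^+ m => /andP[/andP[bd2 bdl] be].
have b0 : 0 < b by rewrite divr_gt0// exprn_gt0.
pose i := Num.truncn (t / b).
have tb0 : 0 <= t / b by rewrite divr_ge0// ltW.
have /andP[i1 i2] : (i%:R <= t / b < i.+1%:R) by apply: truncn_itv.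
have s1 : b *+ i <= t by rewrite -mulr_natr mulrC -ler_pdivlMr.
have s2 : t < b *+ i.+1 by rewrite -mulr_natr mulrC -ltr_pdivrMr.
have ib : b *+ i.+1 <= dl by rewrite mulrSr; apply: (@le_trans _ _ (t + b)); [rewrite lerD2r|lra].
have := K0 m i ib; rewrite -/b; set s := b *+ i in s1 *.
rewrite mulrSr -/s in s2 ib.
have s0 : 0 <= s by rewrite mulrn_wge0// ltW.
move=> X.
have lSs := S_L2 hsemi s0 lu.
have Y : n2 (S t u \- S s u) <= e2 / 2.
  have ts : 0 <= t - s by rewrite subr_ge0.
  have lts := S_L2 hsemi ts lu.
  rewrite (@n2_subae _ _ _ pi _ (S s (S (t - s) u)) _ (S s u))//; first last.
  - exact: nearW.
  - by have := S_semi hk hsemi s0 ts lu; rewrite addrC subrK.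
  - exact: S_L2.
  apply: le_trans (n2S_B hsemi s0 lts lu) _; apply: Hd2 => //; lra.
have Z : n2 ((s - t) \*o g) <= e2 / 2.
  rewrite n2Z// distrC ger0_norm ?subr_ge0//.
  apply: (@le_trans _ _ (e2 / (2 * (1 + n2 g)) * n2 g)).
    by rewrite ler_wpM2r//; lra.
  rewrite mulrAC ler_pdivrMr ?mulr_gt0 ?ltr_wpDr//; nra.
rewrite (_ : _ \- _ = ((S t u \- S s u) \+ ((S s u \- u) \- (s \*o g))) \+ ((s - t) \*o g)); last first.
  by apply/funext => x /=; ring.
have L1 : L2 (S t u \- S s u) by exact: L2B.
have L3 : L2 ((S s u \- u) \- (s \*o g)) by apply: L2B; [exact: L2B|exact: L2Z].
apply: le_trans (n2D (L2D L1 L3) (L2Z (s - t) lg)) _.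
have W := n2D L1 L3.
have : s * (e / 2) <= t * (e / 2) by rewrite ler_wpM2r// divr_ge0// ltW.
lra.
Qed.

Lemma gen_dense f e : L2 f -> 0 < e ->
  exists u g, L2_generator k pi u g /\ n2 (u \- f) <= e.
Proof.
move=> lf e0; have [dl dl0 Hd] := S_cont0 lf e0.
have [u au] := avg_ex dl0 lf; exists u, (dq k dl f); split; first exact: avg_gen.
have -> : u = S 0 u by apply/esym/S0; exact: L2_meas au.1.
by apply: (avg_limit_near lf Hd dl0 (lexx _) _ au); rewrite add0r.
Qed.

End dense.

(** * Integration by parts for the Gibbs measure *)

Section rV_measurable.
Context {R : realType} (n : nat).
Local Notation T := 'rV[R]_n.

Lemma measurable_rV_box (A : 'I_n -> set R) : (forall i, measurable (A i)) ->
  measurable [set x : T | forall i, A i (x ord0 i)].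
Proof.
move=> mA.
rewrite (_ : [set x | _] = \big[setI/setT]_(i < n) ((fun x : T => x ord0 i : R) @^-1` A i)).
  apply: bigsetI_measurable => i _; rewrite -[X in measurable X]setTI.
  exact: measurable_rV_coord.
rewrite -bigcap_seq; apply/seteqP; split => x /= h i.
  by move=> _; exact: h.
by apply: (h i) => /=; rewrite mem_index_enum.
Qed.

(** Joins the topology to the product sigma-algebra: an open set is the union of the cubes with
    rational centre and radius 1/(m+1) that it contains, a countable family. *)
Lemma measurable_rV_open (U : set T) : open U -> measurable U.
Proof.
move=> oU.
pose box (c : 'rV[rat]_n) (m : nat) :=
  [set x : T | forall i, (fun z => `|z - ratr (c ord0 i)| < m.+1%:R^-1) (x ord0 i)].
have mbox c m : measurable (box c m).
  apply: (measurable_rV_box (A := fun i => [set z | `|z - ratr (c ord0 i)| < m.+1%:R^-1])) => i.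
  rewrite (_ : [set _ | _] = ball (ratr (c ord0 i) : R) (m.+1%:R^-1)); first exact: measurable_ball.
  by apply/seteqP; split => z /=; rewrite /ball/= distrC.
pose B (j : nat) := if @choice.unpickle ('rV[rat]_n * nat)%type j is Some cm then
  (if `[< box cm.1 cm.2 `<=` U >] then box cm.1 cm.2 else set0) else set0.
rewrite (_ : U = \bigcup_j B j); last first.
  apply/seteqP; split => [x Ux|x [j _]]; last first.
    rewrite /B; case: choice.unpickle => // -[c m] /=.
    by case: ifPn => // /asboolP; exact.
  have /nbhs_ballP[e /= e0 He] : nbhs x U by apply: open_nbhs_nbhs.
  have [m me] : exists m : nat, m.+1%:R^-1 < e / 2.
    have e20 : 0 < e / 2 by rewrite divr_gt0.
    exists (Num.truncn (e / 2)^-1); rewrite invf_plt ?posrE//.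
    exact: truncnS_gt.
  have /choice[c Hc] : forall i : 'I_n, exists c : rat, `|x ord0 i - ratr c| < m.+1%:R^-1.
    move=> i; have m0 : (0 : R) < m.+1%:R^-1 by [].
    move: m0; set r := m.+1%:R^-1 => r0.
    have xr : x ord0 i - r < x ord0 i + r by lra.
    have [c] := rat_in_itvoo xr.
    by rewrite in_itv/= => H; exists c; rewrite ltr_norml; lra.
  exists (choice.pickle (\row_i c i, m)) => //; rewrite /B choice.pickleK /=.
  have xb : box (\row_i c i) m x by move=> i /=; rewrite mxE.
  suff -> : `[< box (\row_i c i) m `<=` U >] by [].
  apply/asboolP => y yb; apply: He.
  rewrite -ball_normE /ball_ /= /Num.norm /= mx_normrE; apply/bigmax_ltP; split => // -[i j] _ /=.
  rewrite (ord1 i) !mxE; have := yb j; have := Hc j; rewrite /= mxE => h1 h2.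
  have -> : x ord0 j - y ord0 j = (x ord0 j - ratr (c j)) - (y ord0 j - ratr (c j)) by ring.
  apply: le_lt_trans (ler_normB _ _) _.
  by move: me h1 h2; set r := m.+1%:R^-1 => me h1 h2; lra.
apply: bigcup_measurable => j _; rewrite /B; case: choice.unpickle => // -[c m] /=.
by case: ifPn.
Qed.

Lemma continuous_rV_measurable (f : T -> R) : continuous f -> measurable_fun setT f.
Proof.
move=> cf; apply: (measurability _ (RGenOInfty.measurableE R)) => //.
move=> _ [_ [a ->] <-]; rewrite setTI; apply: measurable_rV_open.
by apply: open_comp => // x _; exact: cf.
Qed.

Lemma continuous_rV_box_bounded (f : T -> R) (N : R) : continuous f ->
  exists C, forall x : T, (forall i, `|x ord0 i| <= N) -> `|f x| <= C.
Proof.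
move=> cf.
have cpt : compact [set x : T | forall i, `[- N, N]%classic (x ord0 i)].
  by apply: (@rV_compact _ _ (fun=> `[- N, N]%classic)) => i; exact: segment_compact.
have := compact_bounded (@continuous_compact _ _ f _ (continuous_subspaceT cf) cpt).
move=> [M [_ HM]]; exists (M + 1) => x xN; apply: (HM (M + 1)); first by rewrite ltrDl.
by exists x => // i /=; rewrite in_itv/= -ler_norml.
Qed.

Definition upd (i : 'I_n) (t : R) (x : T) : T := \row_j (if j == i then t else x ord0 j).

Lemma updE i t x j : upd i t x ord0 j = if j == i then t else x ord0 j.
Proof. by rewrite mxE. Qed.

End rV_measurable.

Section slice.
Context {R : realType}.
Local Open Scope ereal_scope.

Let mbox n (N : R) : measurable [set x : 'rV[R]_n | forall i, (`|x ord0 i| <= N)%R].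
Proof.
apply: (measurable_rV_box (A := fun i => [set z | (`|z| <= N)%R])) => i.
rewrite (_ : [set _ | _] = `[(- N)%R, N]%classic); first exact: measurable_itv.
by apply/seteqP; split => z /=; rewrite in_itv/= -ler_norml.
Qed.

Lemma lebesgue_rV_box_lty n (N : R) :
  lebesgue_rV n [set x : 'rV[R]_n | forall i, (`|x ord0 i| <= N)%R] < +oo.
Proof.
have E : [set z : R | (`|z| <= N)%R] = `[(- N)%R, N]%classic.
  by apply/seteqP; split => z /=; rewrite in_itv/= -ler_norml.
rewrite (@lebesgue_rV_box _ n (fun=> [set z | (`|z| <= N)%R])); last first.
  by move=> i; rewrite E; exact: measurable_itv.
under eq_bigr do rewrite E lebesgue_measure_itv.
set P := \prod_(i < n) _.
suff /andP[] : (0 <= P < +oo)%E by [].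
rewrite /P; elim/big_ind: _ => [|x y /andP[x0 xy] /andP[y0 yy]|i _].
- by rewrite lee01 ltry.
- by rewrite mule_ge0//= lte_mul_pinfty// ge0_fin_numE.
- case: ifPn => [h|_]; last by rewrite lexx ltry.
  rewrite (_ : (_ - _)%E = (N + N)%:E); last by rewrite /= -EFinD opprK.
  by rewrite lee_fin ltry andbT; move: h; rewrite /= lte_fin => h; lra.
Qed.

Lemma bounded_box_integrable n (G : 'rV[R]_n -> R) (N C : R) :
  measurable_fun setT G -> (forall x, (`|G x| <= C)%R) ->
  (forall x : 'rV[R]_n, ~ (forall i, (`|x ord0 i| <= N)%R) -> G x = 0%R) ->
  (lebesgue_rV n).-integrable setT (EFin \o G).
Proof.
move=> mG GC G0.
set D := [set x : 'rV[R]_n | forall i, (`|x ord0 i| <= N)%R].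
have -> : EFin \o G = (EFin \o G) \_ D.
  apply/funext => x; rewrite patchE; case: ifPn => //= xD.
  by rewrite G0// => h; move: xD; rewrite mem_set.
apply/(integrable_mkcond (EFin \o G) (@mbox n N)).
apply: measurable_bounded_integrable.
- exact: mbox.
- exact: lebesgue_rV_box_lty.
- exact: measurable_funTS.
- by exists C; split; [exact: num_real|move=> M CM x _ /=; exact: le_trans (GC x) (ltW CM)].
Qed.

(** Fubini along the recursive definition of [lebesgue_rV]: if i is the first coordinate it is
    integrated innermost, otherwise the first coordinate is frozen and the induction hypothesis
    applies to the rest. Boundedness and bounded support give the integrability that Fubini
    requires. *)
Lemma integral_rV_slice0 n (i : 'I_n) (G : 'rV[R]_n -> R) (N C : R) :
  measurable_fun setT G -> (forall x, (`|G x| <= C)%R) ->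
  (forall x : 'rV[R]_n, ~ (forall j, (`|x ord0 j| <= N)%R) -> G x = 0%R) ->
  (forall x, \int[lebesgue_measure]_t (G (upd i t x))%:E = 0) ->
  \int[lebesgue_rV n]_x (G x)%:E = 0.
Proof.
elim: n i G => [[]//|n IH] i G mG GC G0 Gs.
have iG := bounded_box_integrable mG GC G0.
have mc := @measurable_rV_cons R n.
have E : \int[lebesgue_rV n.+1]_x (G x)%:E =
  \int[lebesgue_measure \x lebesgue_rV n]_z (G (rV_cons z))%:E.
  rewrite /= /lebesgue_rV_succ.
  rewrite (@integral_pushforward _ _ _ _ _ _ mc (lebesgue_measure \x lebesgue_rV n) setT (EFin \o G))//.
  - exact/measurable_EFinP.
  - rewrite preimage_setT.
    move/integrableP : iG => [_ iG]; apply/integrableP; split.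
      by apply/measurable_EFinP; exact: measurableT_comp mG mc.
    move: iG; rewrite /= /lebesgue_rV_succ ge0_integral_pushforward ?preimage_setT//.
    by do 2 apply: measurableT_comp => //.
rewrite E.
have iGc : (lebesgue_measure \x lebesgue_rV n).-integrable setT (fun z => (G (rV_cons z))%:E).
  move/integrableP : iG => [_ iG]; apply/integrableP; split.
    by apply/measurable_EFinP; exact: measurableT_comp mG mc.
  move: iG; rewrite /= /lebesgue_rV_succ ge0_integral_pushforward ?preimage_setT//.
  by do 2 apply: measurableT_comp => //.
case: (unliftP ord0 i) => [j ij|i0].
  rewrite -integral12_prod_meas1//; apply: integral0_eq => a _.
  rewrite /fubini_F; apply: (IH j (fun v => G (rV_cons (a, v)))).
  - apply: measurableT_comp mG _; apply: measurableT_comp mc _.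
    exact: measurable_fun_pair.
  - by move=> x; exact: GC.
  - move=> x h; apply: G0 => H; apply: h => l.
    by have := H (lift ord0 l); rewrite mxE liftK.
  - move=> x; rewrite -[RHS](Gs (rV_cons (a, x))); apply: eq_integral => t _.
    congr (G _)%:E; apply/rowP => l; rewrite !mxE ij.
    case: (unliftP ord0 l) => [l' ->|->]; last by rewrite (negbTE (neq_lift ord0 j)).
    by rewrite /= mxE (inj_eq lift_inj).
rewrite -integral21_prod_meas1//; apply: integral0_eq => v _.
rewrite /fubini_G -[RHS](Gs (rV_cons (0%R, v))); apply: eq_integral => t _.
congr (G _)%:E; apply/rowP => l; rewrite !mxE i0.
by case: (unliftP ord0 l) => [l' ->|->] //=; rewrite ?eqxx// eq_sym neq_lift.
Qed.

End slice.

Section continuity.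
Context {R : realType} {E : topologicalType}.
Implicit Types f g : E -> R.

Lemma continuous_mul f g : continuous f -> continuous g -> continuous (fun x => f x * g x).
Proof. by move=> cf cg x; apply: cvgM; [exact: cf|exact: cg]. Qed.

Lemma continuous_add f g : continuous f -> continuous g -> continuous (fun x => f x + g x).
Proof. by move=> cf cg x; apply: cvgD; [exact: cf|exact: cg]. Qed.

Lemma continuous_opp f : continuous f -> continuous (fun x => - f x).
Proof. by move=> cf x; apply: cvgN; exact: cf. Qed.

Lemma continuous_const (a : R) : continuous (fun _ : E => a).
Proof. by move=> x; exact: cvg_cst. Qed.

Lemma continuous_pow f m : continuous f -> continuous (fun x => f x ^+ m).
Proof.
move=> cf; elim: m => [|m IH]; first by under eq_fun do rewrite expr0; exact: continuous_const.
by under eq_fun do rewrite exprS; exact: continuous_mul.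
Qed.

Lemma continuous_postcomp (h : R -> R) f : continuous h -> continuous f -> continuous (fun x => h (f x)).
Proof. by move=> ch cf x; apply: continuous_comp; [exact: cf|exact: ch]. Qed.

Lemma continuous_bigsum I (r : seq I) (P : pred I) (f : I -> E -> R) :
  (forall j, continuous (f j)) -> continuous (fun x => \sum_(j <- r | P j) f j x).
Proof.
move=> cf; elim: r => [|j r IH]; first by under eq_fun do rewrite big_nil; exact: continuous_const.
by under eq_fun do rewrite big_cons; case: (P j); [apply: continuous_add; [exact: cf|exact: IH]|exact: IH].
Qed.

Lemma continuous_bigprod I (r : seq I) (P : pred I) (f : I -> E -> R) :
  (forall j, continuous (f j)) -> continuous (fun x => \prod_(j <- r | P j) f j x).
Proof.
move=> cf; elim: r => [|j r IH]; first by under eq_fun do rewrite big_nil; exact: continuous_const.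
by under eq_fun do rewrite big_cons; case: (P j); [apply: continuous_mul; [exact: cf|exact: IH]|exact: IH].
Qed.

End continuity.

Section directional.
Context {R : realType} {E : normedModType R}.

(** Reduces directional derivatives to one variable, where the chain rule applies. *)
Lemma is_derive_line (F : E -> R) x v dF :
  is_derive x v F dF <-> is_derive (0 : R) 1 (fun h : R => F (h *: v + x)) dF.
Proof.
have eqf : (fun h : R => h^-1 *: (((fun h0 : R => F (h0 *: v + x)) \o shift 0) (h *: 1) - F (0 *: v + x)))
   = (fun h : R => h^-1 *: ((F \o shift x) (h *: v) - F x)).
  by apply/funext => h /=; rewrite scale0r add0r addr0 /GRing.scale /= mulr1.
split=> -[H1 H2]; split.
- by move: H1; rewrite /derivable eqf.
- by move: H2; rewrite /derive eqf.
- by move: H1; rewrite /derivable eqf.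
- by move: H2; rewrite /derive eqf.
Qed.

Lemma is_derive_comp_dir (f : R -> R) (g : E -> R) x v df dg :
  is_derive (g x) 1 f df -> is_derive x v g dg -> is_derive x v (f \o g) (df * dg).
Proof.
move=> Hf /is_derive_line Hg; apply/is_derive_line.
have Hf' : is_derive (g (0 *: v + x)) 1 f df by rewrite scale0r add0r.
exact: (@is_derive1_comp _ f (fun h : R => g (h *: v + x)) 0 df dg).
Qed.

End directional.

Section box_ibp.
Context {R : realType} {n : nat}.
Local Notation T := 'rV[R]_n.
Local Notation e_ i := (delta_mx ord0 i : T).
Implicit Types (i : 'I_n) (x : T) (N : R).

Lemma updD i (h t : R) x : upd i (h + t) x = h *: e_ i + upd i t x.
Proof.
apply/rowP => j; rewrite !mxE eqxx /=.
by case: (j == i); rewrite ?mulr1 ?mulr0 ?add0r.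
Qed.

Lemma is_derive_upd (w dw : T -> R) i x (t : R) :
  (forall y, is_derive y (e_ i) w (dw y)) ->
  is_derive t 1 (fun t => w (upd i t x)) (dw (upd i t x)).
Proof.
move=> /(_ (upd i t x)) /is_derive_line H; apply/is_derive_line.
suff -> : (fun h : R => w (upd i (h *: 1 + t) x)) = (fun h : R => w (h *: e_ i + upd i t x)) by [].
by apply/funext => h; rewrite -updD /GRing.scale/= mulr1.
Qed.

Lemma continuous_upd i x : continuous (fun t : R => upd i t x).
Proof.
move=> t; rewrite (_ : (fun t => upd i t x) = (fun t : R => t *: e_ i + upd i 0 x)).
  by apply: cvgD; [apply: cvgZr_tmp|exact: cvg_cst].
by apply/funext => s; rewrite -updD addr0.
Qed.

Lemma ftc_vanish (g dg : R -> R) N : 0 < N -> (forall t : R, is_derive t (1 : R) g (dg t)) ->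
  continuous dg -> g N = 0 -> g (- N) = 0 ->
  (\int[lebesgue_measure]_(t in `[(- N)%R, N]) (dg t)%:E = 0)%E.
Proof.
move=> N0 dgP cdg gN gN'.
have cg : continuous g by move=> t; apply/differentiable_continuous/derivable1_diffP; case: (dgP t).
rewrite (@continuous_FTC2 _ dg g) ?gN ?gN' ?subee//.
- by lra.
- exact: continuous_subspaceT.
- split; [by move=> t _; case: (dgP t)|exact: cvg_at_right_filter (cg _)|exact: cvg_at_left_filter (cg _)].
- by move=> t _; rewrite derive1E; case: (dgP t).
Qed.

Definition box N : set T := [set x | forall i, `|x ord0 i| <= N].

Lemma measurable_box N : measurable (box N).
Proof.
apply: (measurable_rV_box (A := fun i => [set z | `|z| <= N])) => i.
rewrite (_ : [set _ | _] = `[- N, N]%classic); first exact: measurable_itv.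
by apply/seteqP; split => z /=; rewrite in_itv/= -ler_norml.
Qed.

Definition ind N x : R := \1_(box N) x.

Lemma ind1 N x : box N x -> ind N x = 1.
Proof. by move=> H; rewrite /ind indicE mem_set. Qed.

Lemma ind0 N x : ~ box N x -> ind N x = 0.
Proof. by move=> H; rewrite /ind indicE memNset. Qed.

Lemma measurable_ind N : measurable_fun setT (ind N).
Proof. by apply: measurable_indic; exact: measurable_box. Qed.

Lemma ind_continuous_integrable N (f : T -> R) : continuous f ->
  (lebesgue_rV n).-integrable setT (EFin \o (fun x => ind N x * f x)).
Proof.
move=> cf; have [C HC] := continuous_rV_box_bounded N cf.
apply: (@bounded_box_integrable _ _ _ N `|C|).
- by apply: measurable_funM; [exact: measurable_ind|exact: continuous_rV_measurable].
- move=> x; have [xN|xN] := pselect (box N x); last by rewrite ind0// mul0r normr0.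
  by rewrite ind1// mul1r (le_trans (HC x xN))// ler_norm.
- by move=> x xN; rewrite ind0// mul0r.
Qed.

(** Fundamental theorem on each segment parallel to the i-th axis: only the two faces orthogonal to
    it matter, as [ind] kills the lines that miss the box. *)
Lemma ibp_vanish (w dw : T -> R) i N : 0 < N ->
  (forall y, is_derive y (e_ i) w (dw y)) -> continuous dw ->
  (forall x, `|x ord0 i| = N -> w x = 0) ->
  (\int[lebesgue_rV n]_x (ind N x * dw x)%:E = 0)%E.
Proof.
move=> N0 dP cdw w0; have [C HC] := continuous_rV_box_bounded N cdw.
apply: (@integral_rV_slice0 _ _ i _ N `|C|).
- by apply: measurable_funM; [exact: measurable_ind|exact: continuous_rV_measurable].
- move=> x; have [xN|xN] := pselect (box N x); last by rewrite ind0// mul0r normr0.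
  by rewrite ind1// mul1r (le_trans (HC x xN))// ler_norm.
- by move=> x xN; rewrite ind0// mul0r.
move=> x.
have [H|H] := pselect (forall j, j != i -> `|x ord0 j| <= N); last first.
  apply: integral0_eq => t _; rewrite ind0 ?mul0r// => bx; apply: H => j ji.
  by have := bx j; rewrite updE (negbTE ji).
transitivity (\int[lebesgue_measure]_(t in `[(- N)%R, N]) (dw (upd i t x))%:E)%E.
  rewrite [RHS]integral_mkcond; apply: eq_integral => t _; rewrite patchE.
  have [tN|tN] := boolP (t \in `[(- N)%R, N]%classic).
    rewrite ind1 ?mul1r// => j; rewrite updE; case: eqP => [_|/eqP]; last exact: H.
    by move: tN; rewrite inE/= in_itv/= -ler_norml.
  rewrite ind0 ?mul0r// => bx; move: tN; rewrite notin_setE/= in_itv/= -ler_norml; apply.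
  by have := bx i; rewrite updE eqxx.
apply: (@ftc_vanish (fun t => w (upd i t x))) => //.
- by move=> t; exact: is_derive_upd.
- move=> t; apply: (@continuous_comp _ _ _ (fun t => upd i t x) dw); last exact: cdw.
  exact: continuous_upd.
- by apply: w0; rewrite updE eqxx gtr0_norm.
- by apply: w0; rewrite updE eqxx normrN gtr0_norm.
Qed.

(** A polynomial has explicit derivatives everywhere. It behaves as a cutoff on the box only, so the
    integrands built from it carry the factor [ind], and its zeros on the faces remove the boundary
    terms. *)
Definition bump N (t : R) : R := 1 - (t / N) ^+ 2.
Definition cutoff N x : R := \prod_j bump N (x ord0 j).
Definition dcutoff N i x : R := - 2 * x ord0 i / N ^+ 2 * \prod_(j | j != i) bump N (x ord0 j).

Lemma continuous_coord i : continuous (fun x : T => x ord0 i).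
Proof. by move=> x; exact: coord_continuous. Qed.

Lemma continuous_bump N : continuous (bump N).
Proof.
move=> t; apply: cvgB; first exact: cvg_cst.
by rewrite /exprz /=; apply: (@cvgM _ _ _ _ (fun t => t / N) (fun t => t / N));
  apply: cvgMl; exact: cvg_id.
Qed.

Let cbj N j : continuous (fun x : T => bump N (x ord0 j)).
Proof. by apply: continuous_postcomp; [exact: continuous_bump|exact: continuous_coord]. Qed.

Lemma continuous_cutoff N : continuous (cutoff N).
Proof. by apply: continuous_bigprod => j; exact: cbj. Qed.

Lemma continuous_dcutoff N i : continuous (dcutoff N i).
Proof.
apply: continuous_mul; last by apply: continuous_bigprod => j; exact: cbj.
by apply: continuous_mul; [apply: continuous_mul; [exact: continuous_const|exact: continuous_coord]|exact: continuous_const].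
Qed.

Lemma is_derive_cutoff N i x : is_derive x (e_ i) (cutoff N) (dcutoff N i x).
Proof.
apply/is_derive_line.
rewrite (_ : (fun h : R => _) = (fun h : R => (\prod_(j | j != i) bump N (x ord0 j)) *
    (1 - ((h + x ord0 i) / N) ^+ 2))); last first.
  apply/funext => h; rewrite /cutoff (bigD1 i)//= mulrC; congr (_ * _).
    by apply: eq_bigr => j ji; rewrite !mxE eqxx/= (negbTE ji) mulr0 add0r.
  by rewrite /bump !mxE !eqxx mulr1.
apply: is_derive_eq.
rewrite /dcutoff /GRing.scale /= -exprVn; ring.
Qed.

Lemma bump_box N t : 0 < N -> `|t| <= N -> 0 <= bump N t <= 1.
Proof.
move=> N0 tN; rewrite /bump gerBl sqr_ge0 andbT subr_ge0 -(expr1n _ 2).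
rewrite -real_normK ?num_real// lerXn2r ?nnegrE// normrM normfV (gtr0_norm N0).
by rewrite ler_pdivrMr// mul1r.
Qed.

Lemma cutoff_box N x : 0 < N -> box N x -> 0 <= cutoff N x <= 1.
Proof.
move=> N0 bx; apply/andP; split.
  by apply: prodr_ge0 => j _; case/andP: (bump_box N0 (bx j)).
by apply: prodr_ile1 => j _; exact: bump_box.
Qed.

Lemma dcutoff_box N i x : 0 < N -> box N x -> `|dcutoff N i x| <= 2 / N.
Proof.
move=> N0 bx; rewrite /dcutoff normrM.
have -> : 2 / N = (2 * N / N ^+ 2) * 1 by field; rewrite gt_eqF.
apply: ler_pM => //.
  rewrite !normrM normfV normrN (ger0_norm (sqr_ge0 N)) (ger0_norm (ler0n _ 2)).
  by rewrite ler_wpM2r ?invr_ge0 ?sqr_ge0// ler_wpM2l.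
rewrite ger0_norm.
  by apply: prodr_ile1 => j _; exact: bump_box.
by apply: prodr_ge0 => j _; case/andP: (bump_box N0 (bx j)).
Qed.

Lemma cutoff_face N i x : 0 < N -> `|x ord0 i| = N -> cutoff N x = 0.
Proof.
move=> N0 xN; rewrite /cutoff (bigD1 i)//= /bump expr_div_n -[x ord0 i ^+ 2]real_normK ?num_real// xN.
by rewrite divff ?expf_neq0 ?gt_eqF// subrr mul0r.
Qed.

Lemma cvg_ind x : ind N.+1%:R x @[N --> \oo] --> (1 : R).
Proof.
apply: cvg_near_cst; near=> N; rewrite ind1// => j.
apply: (@le_trans _ _ `|x|); first by rewrite /Num.norm /= mx_normrE; apply: (le_bigmax _ _ (ord0, j)).
apply: (@le_trans _ _ N%:R); last by rewrite ler_nat.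
by near: N; exact: nbhs_infty_ger.
Unshelve. all: by end_near. Qed.

Lemma cvg_cutoff x : cutoff N.+1%:R x @[N --> \oo] --> (1 : R).
Proof.
suff : cutoff N.+1%:R x @[N --> \oo] --> \prod_(j <- index_enum 'I_n) (1 : R) by rewrite big1_eq.
rewrite /cutoff; elim: (index_enum 'I_n) => [|j r IH].
  by under eq_fun do rewrite big_nil; rewrite big_nil; exact: cvg_cst.
under eq_fun do rewrite big_cons; rewrite big_cons; apply: cvgM => //.
rewrite /bump -[X in _ --> X]subr0; apply: cvgB; first exact: cvg_cst.
have H : x ord0 j / N.+1%:R @[N --> \oo] --> (0 : R).
  by rewrite -[X in _ --> X](mulr0 (x ord0 j)); apply: cvgMr; exact: cvg_harmonic.
rewrite -[X in _ --> X](mulr0 (0 : R)); under eq_fun do rewrite expr2.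
by apply: cvgM; exact: H.
Qed.

Lemma cvg_dcutoff i x : dcutoff N.+1%:R i x @[N --> \oo] --> (0 : R).
Proof.
have H : 2 / N.+1%:R @[N --> \oo] --> (0 : R).
  by rewrite -[X in _ --> X](mulr0 (2 : R)); apply: cvgMr; exact: cvg_harmonic.
apply/cvgrPdist_lt => e e0; move/cvgrPdist_lt : H => /(_ e e0) H.
near=> N; rewrite sub0r normrN.
have bx : box N.+1%:R x.
  move=> j; apply: (@le_trans _ _ `|x|); first by rewrite /Num.norm /= mx_normrE; apply: (le_bigmax _ _ (ord0, j)).
  apply: (@le_trans _ _ N%:R); last by rewrite ler_nat.
  by near: N; exact: nbhs_infty_ger.
apply: le_lt_trans (dcutoff_box i _ bx) _ => //.
have : `|0 - 2 / N.+1%:R| < e by near: N.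
by rewrite sub0r normrN ger0_norm.
Unshelve. all: by end_near. Qed.

End box_ibp.

Lemma Rintegral_sum d (T : measurableType d) (R : realType) (mu : {measure set T -> \bar R})
    I (r : seq I) (f : I -> T -> R) : (forall i, mu.-integrable setT (EFin \o f i)) ->
  \int[mu]_x (\sum_(i <- r) f i x) = \sum_(i <- r) \int[mu]_x f i x.
Proof.
move=> fi; elim: r => [|i r IH].
  rewrite big_nil -[RHS](@Rintegral_set0 _ _ _ mu (cst 0)).
  by rewrite /Rintegral !integral0_eq// => x _; rewrite big_nil.
under eq_Rintegral do rewrite big_cons.
rewrite big_cons -IH RintegralD//.
rewrite (_ : _ \o _ = (fun x => \sum_(i <- r) (EFin \o f i) x)%E); last first.
  by apply/funext => x; rewrite /= -sumEFin.
by apply: integrable_sum.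
Qed.

Section gibbs_ibp.
Context {R : realType} {n : nat}.
Local Notation T := 'rV[R]_n.
Local Notation e_ i := (delta_mx ord0 i : T).
Variables (V : T -> R) (pi : probability T R).
Hypothesis hV : C1 V.
Hypothesis hpi : gibbs V pi.
Local Notation L2 := (L2 pi).
Local Notation n2 := (n2 pi).
Local Notation ip := (ip pi).
Implicit Types (i : 'I_n) (x : T) (N : R) (u v : T -> R).

Lemma is_derive_partial u i x : differentiable u x -> is_derive x (e_ i) u (partial i u x).
Proof. by move=> du; apply: derivableP; exact: diff_derivable. Qed.

Lemma smooth_cont u : smooth u -> continuous u.
Proof. by move=> su x; apply: differentiable_continuous; exact: (su [::]). Qed.

Lemma smooth_partial u i : smooth u -> smooth (partial i u).
Proof. by move=> su s x; have := su (rcons s i) x; rewrite -cats1 foldr_cat. Qed.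

Lemma continuous_V : continuous V.
Proof. by move=> x; apply: differentiable_continuous; exact: hV.1. Qed.

Lemma gradE f i x : grad f x ord0 i = partial i f x.
Proof. by rewrite mxE. Qed.

Lemma continuous_partialV i : continuous (partial i V).
Proof.
have -> : partial i V = (fun x => grad V x ord0 i) by apply/funext => x; rewrite gradE.
by move=> x; apply: (@continuous_comp _ _ _ (grad V) (fun y : T => y ord0 i)); [exact: hV.2|exact: coord_continuous].
Qed.

Let W x := expR (- V x).

Let cW : continuous W.
Proof. by apply: continuous_postcomp; [exact: continuous_expR|apply: continuous_opp; exact: continuous_V]. Qed.

Let W0 x : 0 < W x. Proof. exact: expR_gt0. Qed.

Let dW i x : is_derive x (e_ i) W (- partial i V x * W x).
Proof.
rewrite mulrC; apply: (is_derive_comp_dir (f := expR) (g := fun x => - V x)).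
have := is_derive_partial i (hV.1 x) => H.
by apply: is_deriveN.
Qed.

Lemma gibbs_integral (f : T -> R) (Z : R) : 0 < Z ->
  (forall A, measurable A -> pi A = \int[lebesgue_rV n]_(x in A) (W x / Z)%:E)%E ->
  measurable_fun setT f ->
  (\int[pi]_x (f x)%:E = \int[lebesgue_rV n]_x (f x * (W x / Z))%:E)%E.
Proof.
move=> Z0 piE mf.
have w0 x : 0 <= W x / Z by rewrite divr_ge0// ltW.
have mw : measurable_fun setT (fun x => W x / Z).
  by apply: measurable_funM => //; exact: continuous_rV_measurable.
rewrite integralE [RHS]integralE.
have mf' : measurable_fun setT (EFin \o f) by exact/measurable_EFinP.
rewrite (integral_density mw w0 piE (measurable_funepos mf'))// (integral_density mw w0 piE (measurable_funeneg mf'))//.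
congr (_ - _)%E; apply: eq_integral => x _.
  by rewrite !funeposE /= -[0%E]/(0%:E) -!EFin_max -EFinM maxr_pMl// mul0r.
by rewrite !funenegE /= -[0%E]/(0%:E) -!EFin_max -EFinM maxr_pMl// mul0r mulNr.
Qed.

(** When [dv] is the gradient of v, this is exp(V) times the divergence of cutoff^2 v exp(-V) grad
    u. The square allows the cross term to be absorbed into the main term. *)
Definition flux (dv : 'I_n -> T -> R) v u N x : R :=
  cutoff N x ^+ 2 * (\sum_i dv i x * partial i u x + v x * langevin_op V u x)
  + \sum_i 2 * cutoff N x * dcutoff N i x * v x * partial i u x.

Lemma ibp_box u v (dv : 'I_n -> T -> R) N : 0 < N -> smooth u -> continuous v ->
  (forall i, continuous (dv i)) -> (forall i x, is_derive x (e_ i) v (dv i x)) ->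
  continuous (flux dv v u N) /\ (\int[pi]_x (ind N x * flux dv v u N x)%:E = 0)%E.
Proof.
move=> N0 su cv cdv dvP.
have cu i : continuous (partial i u) by apply/smooth_cont/smooth_partial.
have cuu i : continuous (partial i (partial i u)) by apply/smooth_cont/smooth_partial/smooth_partial.
pose dw i x := 2 * cutoff N x * dcutoff N i x * v x * W x * partial i u x
  + cutoff N x ^+ 2 * dv i x * W x * partial i u x
  + cutoff N x ^+ 2 * v x * (- partial i V x * W x) * partial i u x
  + cutoff N x ^+ 2 * v x * W x * partial i (partial i u) x.
pose w i x := cutoff N x * cutoff N x * v x * W x * partial i u x.
have ce := @continuous_cutoff R n N; have cde i := @continuous_dcutoff R n N i.
have cdw i : continuous (dw i).
  have cVi := @continuous_partialV i.
  have c2 := continuous_pow (m := 2) ce.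
  apply: continuous_add; [apply: continuous_add; [apply: continuous_add|]|].
  - by do 5 (apply: continuous_mul => //); exact: continuous_const.
  - by do 3 (apply: continuous_mul => //).
  - by apply: continuous_mul => //; apply: continuous_mul; [exact: continuous_mul|apply: continuous_mul => //; exact: continuous_opp].
  - by do 3 (apply: continuous_mul => //).
have dwP i x : is_derive x (e_ i) (w i) (dw i x).
  have H1 := is_derive_cutoff N i x; have H2 := dvP i x; have H3 := dW i x.
  have H4 := is_derive_partial i (smooth_partial i su [::] x).
  apply: is_derive_eq.
  by rewrite /dw /GRing.scale /=; ring.
have w0 i x : `|x ord0 i| = N -> w i x = 0.
  by move=> xN; rewrite /w (cutoff_face N0 xN) !mul0r.
have E x : flux dv v u N x * W x = \sum_i dw i x.
  rewrite /flux /langevin_op /laplacian /dotp mulrDl mulr_suml.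
  pose c := cutoff N x ^+ 2 * W x.
  rewrite [RHS](eq_bigr (fun i => (2 * cutoff N x * dcutoff N i x * v x * partial i u x) * W x
     + c * (dv i x * partial i u x) + (- (c * v x)) * (grad V x ord0 i * grad u x ord0 i)
     + c * v x * partial i (partial i u) x)); last first.
    by move=> i _; rewrite /dw /c !gradE; ring.
  by rewrite !big_split/= -!mulr_sumr -mulr_suml /c; ring.
have cfl : continuous (flux dv v u N).
  have -> : flux dv v u N = (fun x => (\sum_i dw i x) * (W x)^-1).
    by apply/funext => x; rewrite -E mulfK// gt_eqF.
  apply: continuous_mul; first exact: continuous_bigsum.
  rewrite (_ : (fun x => (W x)^-1) = (fun x => expR (V x))).
    by apply: continuous_postcomp; [exact: continuous_expR|exact: continuous_V].
  by apply/funext => x; rewrite /W expRN invrK.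
split => //.
have [Z Z0 piE] := hpi.
rewrite (gibbs_integral Z0 piE); last first.
  by apply: measurable_funM; [exact: measurable_ind|exact: continuous_rV_measurable].
have -> : (fun x => (ind N x * flux dv v u N x * (W x / Z))%:E) =
   (fun x => \sum_i (Z^-1)%:E * (ind N x * dw i x)%:E)%E.
  apply/funext => x; rewrite (_ : _ * _ * _ = \sum_i Z^-1 * (ind N x * dw i x)); last first.
    by rewrite -mulr_sumr -mulr_sumr -E; ring.
  by rewrite -sumEFin.
rewrite integral_sum//; last first.
  by move=> i; apply: integrableZl => //; exact: ind_continuous_integrable.
rewrite big1// => i _; rewrite integralZl//; last exact: ind_continuous_integrable.
by rewrite (ibp_vanish N0 (dwP i) (cdw i) (w0 i)) mule0.
Qed.

Lemma ind_continuous_int (f : T -> R) N : continuous f ->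
  pi.-integrable setT (EFin \o (fun x => ind N x * f x)).
Proof.
move=> cf; have [C HC] := continuous_rV_box_bounded N cf.
apply: L2_int; apply: (@L2_bnd _ _ _ _ _ `|C|).
  by apply: measurable_funM; [exact: measurable_ind|exact: continuous_rV_measurable].
move=> x; have [xN|xN] := pselect (box N x); last by rewrite ind0// mul0r normr0.
by rewrite ind1// mul1r (le_trans (HC x xN))// ler_norm.
Qed.

(** Caccioppoli estimate: for v = u, the vanishing integral of the flux bounds that of cutoff^2
    |grad u|^2 independently of the box, since Young's inequality absorbs the cross term into half
    of the main one. Fatou then lets the box grow. *)
Lemma grad_L2 u : smooth u -> L2 u -> L2 (langevin_op V u) -> forall i, L2 (partial i u).
Proof.
move=> su lu lLu i.
have cu := smooth_cont su.
have cp j : continuous (partial j u) by apply/smooth_cont/smooth_partial.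
(* Young gives 2 E D u p >= - E^2 p^2 / 2 - 2 D^2 u^2, and D^2 <= 4: hence 8 for each of the n
   coordinates. *)
pose h x := `|u x * langevin_op V u x| + (8 * n%:R) * (u x * u x).
have ih : pi.-integrable setT (EFin \o h).
  rewrite (_ : EFin \o h = ((EFin \o (fun x => `|u x * langevin_op V u x|)%R) \+
      (fun x => (8 * n%:R)%:E * (EFin \o (fun x => u x * u x)%R) x))%E)//.
  apply: integrableD => //; first by apply: integrable_norm; exact: L2_int_mul.
  by apply: integrableZl => //; exact: L2_int_mul.
pose C := fine (\int[pi]_x (h x)%:E)%E.
pose v (m : nat) x := ind m.+1%:R x * (cutoff m.+1%:R x * partial i u x).
have lv m : L2 (v m).
  have cf : continuous (fun x => cutoff m.+1%:R x * partial i u x).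
    by apply: continuous_mul => //; exact: continuous_cutoff.
  have [M HM] := continuous_rV_box_bounded m.+1%:R cf.
  apply: (@L2_bnd _ _ _ _ _ `|M|).
    by apply: measurable_funM; [exact: measurable_ind|exact: continuous_rV_measurable].
  move=> x; rewrite /v; have [xN|xN] := pselect (box m.+1%:R x); last by rewrite ind0// mul0r normr0.
  by rewrite ind1// mul1r (le_trans (HM x xN))// ler_norm.
have vC m : n2 (v m) <= Num.sqrt (2 * C).
  set N : R := m.+1%:R; have N0 : 0 < N by rewrite ltr0n.
  have [cfl ifl] := ibp_box N0 su cu cp (fun j x => is_derive_partial j (su [::] x)).
  rewrite -(@ler_pXn2r _ 2) ?nnegrE ?n2_ge0 ?sqrtr_ge0//.
  have C0 : 0 <= C.
    apply: fine_ge0; apply: integral_ge0 => x _; rewrite lee_fin addr_ge0//.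
    by rewrite mulr_ge0// -expr2 sqr_ge0.
  rewrite [leRHS]sqr_sqrtr ?mulr_ge0// -lee_fin -L2_ipE//.
  have iv := L2_int_mul (lv m) (lv m).
  apply: (@le_trans _ _ (\int[pi]_x ((2%:E * ((ind N x * flux (partial^~ u) u u N x)%:E + (h x)%:E))))%E).
    apply: le_integral => //.
    apply: integrableZl => //; apply: integrableD => //; exact: ind_continuous_int.
    move=> x _; rewrite -EFinD -EFinM lee_fin.
    have h0 : 0 <= h x by rewrite addr_ge0// mulr_ge0// -expr2 sqr_ge0.
    rewrite /v; have [xN|xN] := pselect (box N x); last first.
      by rewrite ind0// !mul0r expr0n/= add0r mulr_ge0.
    rewrite ind1// !mul1r /flux.
    have [e0 e1] := andP (cutoff_box N0 xN).
    set E := cutoff N x in e0 e1 *.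
    have HS : \sum_j 2 * E * dcutoff N j x * u x * partial j u x >=
        \sum_j (- (2^-1 * (E ^+ 2 * partial j u x ^+ 2)) - 8 * (u x * u x)).
      apply: ler_sum => j _; set p := partial j u x; set D := dcutoff N j x.
      have D2 : `|D| <= 2.
        apply: le_trans (dcutoff_box j N0 xN) _.
        by rewrite ler_pdivrMr// ler_peMr// ler1n.
      have DD : D ^+ 2 <= 4.
        rewrite -real_normK ?num_real// (_ : 4 = 2 ^+ 2); last by rewrite -natrX.
        by rewrite lerXn2r ?nnegrE.
      have := sqr_ge0 (E * p + 2 * D * u x); have := sqr_ge0 (u x).
      rewrite -subr_ge0 => u0 q0; nra.
    have {}HS : - (2^-1 * (E ^+ 2 * \sum_j partial j u x * partial j u x)) - 8 * n%:R * (u x * u x) <=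
        \sum_j 2 * E * dcutoff N j x * u x * partial j u x.
      apply: le_trans HS; rewrite sumrB sumr_const card_ord -[_ *+ n]mulr_natr sumrN -!mulr_sumr.
      rewrite [X in _ <= - (_ * (_ * X)) - _](eq_bigr (fun j => partial j u x * partial j u x)) => [|j _]; last by rewrite expr2.
      by rewrite le_eqVlt; apply/orP; left; apply/eqP; ring.
    move: HS; set S := \sum_j 2 * _ * _ * _ * _; set A := \sum_j _ * _ => HS.
    have Ai : partial i u x ^+ 2 <= A.
      rewrite /A (bigD1 i)//= -expr2 lerDl; apply: sumr_ge0 => j _.
      by rewrite -expr2 sqr_ge0.
    rewrite /h; set Bb := u x * langevin_op V u x; set U := 8 * n%:R * _.
    rewrite -/U in HS.
    have e2 : 0 <= E ^+ 2 <= 1 by rewrite sqr_ge0/= expr_le1.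
    have E2A : E ^+ 2 * partial i u x ^+ 2 <= E ^+ 2 * A by rewrite ler_wpM2l// sqr_ge0.
    have E2B : - `|Bb| <= E ^+ 2 * Bb.
      case/andP: e2 => e20 e21; have := ler_norm Bb; have := ler_norm (- Bb); rewrite normrN.
      by have := normr_ge0 Bb; nra.
    by rewrite exprMn; lra.
  rewrite integralZl//; last by apply: integrableD => //; exact: ind_continuous_int.
  rewrite integralD//; last exact: ind_continuous_int.
  rewrite ifl add0e /C EFinM fineK//.
  exact: integrable_fin_num.
apply: (fatou_L2 lv vC _ _).1; first exact: continuous_rV_measurable.
apply: nearW => x; rewrite /v -[X in _ --> X]mul1r; apply: cvgM; first exact: cvg_ind.
by rewrite -[X in _ --> X]mul1r; apply: cvgM; [exact: cvg_cutoff|exact: cvg_cst].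
Qed.

(** Dominated convergence in the flux identity as the box grows; [grad_L2] makes the term with the
    derivative of the cutoff integrable. *)
Lemma ibp_L2 u v (dv : 'I_n -> T -> R) : smooth u -> L2 u -> L2 (langevin_op V u) ->
  continuous v -> (forall i, continuous (dv i)) -> (forall i x, is_derive x (e_ i) v (dv i x)) ->
  L2 v -> (forall i, L2 (dv i)) ->
  ip v (langevin_op V u) = - \sum_i ip (dv i) (partial i u).
Proof.
move=> su lu lLu cv cdv dvP lv ldv.
have lp := grad_L2 su lu lLu.
pose g x := \sum_i dv i x * partial i u x + v x * langevin_op V u x.
(* The factor 4 bounds 2 E D, as 0 <= E <= 1 and |D| <= 2 / N <= 2. *)
pose h x := `|g x| + \sum_i 4 * `|v x * partial i u x|.
have isum : pi.-integrable setT (EFin \o (fun x => \sum_i dv i x * partial i u x)).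
  rewrite (_ : _ \o _ = (fun x => \sum_i (EFin \o (fun x => dv i x * partial i u x)%R) x)%E); last first.
    by apply/funext => x; rewrite /= -sumEFin.
  by apply: integrable_sum => // i _; exact: L2_int_mul.
have ivL := L2_int_mul lv lLu.
have ig : pi.-integrable setT (EFin \o g).
  rewrite (_ : _ \o _ = (EFin \o (fun x => \sum_i dv i x * partial i u x)%R) \+
     (EFin \o (fun x => v x * langevin_op V u x)%R))%E//; exact: integrableD.
have ih : pi.-integrable setT (EFin \o h).
  rewrite (_ : _ \o _ = (EFin \o (fun x => `|g x|)%R) \+
     (fun x => \sum_i 4%:E * (EFin \o (fun x => `|v x * partial i u x|)%R) x))%E; last first.
    by apply/funext => x; rewrite /h /= EFinD; congr (_ + _)%E; rewrite -sumEFin.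
  apply: integrableD => //; first exact: integrable_norm.
  by apply: integrable_sum => // i _; apply: integrableZl => //; apply: integrable_norm; exact: L2_int_mul.
pose F (m : nat) x := ind m.+1%:R x * flux dv v u m.+1%:R x.
have HF m := ibp_box (ltr0Sn R m) su cv cdv dvP.
have cF : {ae pi, forall x, setT x -> (F m x)%:E @[m --> \oo] --> (g x)%:E}.
  apply: nearW => x _; apply: cvg_EFin; first exact: nearW.
  rewrite /comp /F /flux /= -[X in _ --> X]mul1r; apply: cvgM; first exact: cvg_ind.
  rewrite -[X in _ --> X]addr0; apply: cvgD.
    have He : cutoff m.+1%:R x ^+ 2 @[m --> \oo] --> (1 : R).
      rewrite -[X in _ --> X](mulr1 (1 : R)); under eq_fun do rewrite expr2.
      by apply: cvgM; exact: cvg_cutoff.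
    by rewrite -[X in _ --> X]mul1r; apply: cvgM; [exact: He|exact: cvg_cst].
  suff : \sum_i 2 * cutoff m.+1%:R x * dcutoff m.+1%:R i x * v x * partial i u x @[m --> \oo] -->
     \sum_(i < n) (0 : R) by rewrite big1_eq.
  elim: (index_enum _) => [|i r IH].
    by under eq_fun do rewrite big_nil; rewrite big_nil; exact: cvg_cst.
  under eq_fun do rewrite big_cons; rewrite big_cons; apply: cvgD => //.
  rewrite -[X in _ --> X](mul0r (partial i u x)); apply: cvgM; last exact: cvg_cst.
  rewrite -[X in _ --> X](mul0r (v x)); apply: cvgM; last exact: cvg_cst.
  rewrite -[X in _ --> X](mulr0 (2 * 1 : R)); apply: cvgM; last exact: cvg_dcutoff.
  by apply: cvgM; [exact: cvg_cst|exact: cvg_cutoff].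
have dom : {ae pi, forall x m, setT x -> (`|(F m x)%:E| <= (h x)%:E)%E}.
  apply: nearW => x m _; rewrite lee_fin /F.
  have h0 : 0 <= h x by rewrite addr_ge0// sumr_ge0// => i _; rewrite mulr_ge0.
  set N : R := m.+1%:R; have N0 : 0 < N by rewrite ltr0n.
  have [xN|xN] := pselect (box N x); last by rewrite ind0// mul0r normr0.
  rewrite ind1// mul1r /flux.
  have /andP[e0 e1] := cutoff_box N0 xN.
  apply: le_trans (ler_normD _ _) _; apply: lerD.
    by rewrite normrM ler_piMl// ger0_norm ?sqr_ge0// expr_le1.
  apply: le_trans (ler_norm_sum _ _ _) _; apply: ler_sum => j _.
  have D2 : `|dcutoff N j x| <= 2.
    apply: le_trans (dcutoff_box j N0 xN) _.
    by rewrite ler_pdivrMr// ler_peMr// ler1n.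
  rewrite (_ : 2 * _ * _ * _ * _ = (2 * (cutoff N x * dcutoff N j x)) * (v x * partial j u x)); last by ring.
  rewrite normrM ler_wpM2r// normrM (ger0_norm (ler0n _ 2)) (_ : 4 = 2 * 2); last by ring.
  rewrite ler_wpM2l// normrM (ger0_norm e0).
  by apply: le_trans (ler_piMl _ e1) D2.
have mF m : measurable_fun setT (fun x => (F m x)%:E).
  apply/measurable_EFinP/measurable_funM; first exact: measurable_ind.
  by apply: continuous_rV_measurable; case: (HF m).
have [_ _ H] := dominated_convergence measurableT mF (measurable_int _ ig) cF ih dom.
have g0 : (\int[pi]_x (g x)%:E = 0)%E.
  have : (\int[pi]_x (F m x)%:E)%E @[m --> \oo] --> (0 : \bar R)%E.
    by rewrite (_ : (fun _ => _) = cst 0%E); [exact: cvg_cst|apply/funext => m; exact: (HF m).2].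
  by move/(cvg_unique _ H) => -> //; exact: ereal_hausdorff.
have : \int[pi]_x (\sum_i dv i x * partial i u x + v x * langevin_op V u x) = 0.
  by rewrite /Rintegral g0.
rewrite RintegralD// => /eqP; rewrite addrC addr_eq0 => /eqP; rewrite ipE => ->.
by congr (- _); rewrite Rintegral_sum// => i; exact: L2_int_mul.
Qed.

End gibbs_ibp.

(** * Symmetry and invariance *)

Section ip_close.
Context d (T : measurableType d) (R : realType) (mu : probability T R).
Implicit Types f g : T -> R.

Lemma ip_close f f' g g' : L2 mu f -> L2 mu f' -> L2 mu g -> L2 mu g' ->
  `|ip mu f g - ip mu f' g'| <= n2 mu (f \- f') * n2 mu g + n2 mu f' * n2 mu (g \- g').
Proof.
move=> lf lf' lg lg'.
have -> : ip mu f g - ip mu f' g' = ip mu (f \- f') g + ip mu f' (g \- g').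
  by rewrite ipBl// ipBr//; ring.
apply: le_trans (ler_normD _ _) _.
by apply: lerD; apply: CS => //; exact: L2B.
Qed.

Lemma n2_le_close f f' e : L2 mu f -> L2 mu f' -> n2 mu (f \- f') <= e -> n2 mu f' <= n2 mu f + e.
Proof.
move=> lf lf' H; have := n2B_ge lf lf'; rewrite ler_norml => /andP[H1 H2]; lra.
Qed.

Lemma ip_close1 f f' g g' e : L2 mu f -> L2 mu f' -> L2 mu g -> L2 mu g' ->
  e <= 1 -> n2 mu (f \- f') <= e -> n2 mu (g \- g') <= e ->
  `|ip mu f g - ip mu f' g'| <= e * (n2 mu f + n2 mu g + 1).
Proof.
move=> lf lf' lg lg' e1 ef eg.
apply: le_trans (ip_close lf lf' lg lg') _.
have := n2_le_close lf lf' ef.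
have := n2_ge0 mu f; have := n2_ge0 mu f'; have := n2_ge0 mu g.
have := n2_ge0 mu (f \- f'); have := n2_ge0 mu (g \- g'); nra.
Qed.

End ip_close.

Lemma eq_of_small_error (R : realType) (a b C : R) : 0 <= C ->
  (forall e, 0 < e -> e <= 1 -> `|a - b| <= e * C) -> a = b.
Proof.
move=> C0 H; apply/eqP; rewrite -subr_eq0 -normr_le0; apply/ler_addgt0Pr => e e0; rewrite add0r.
have C1 : 0 < 1 + C by lra.
have e1 : 0 < Num.min 1 (e / (1 + C)) by rewrite lt_min ltr01 divr_gt0.
apply: le_trans (H _ e1 _) _; first by rewrite ge_min lexx.
apply: (@le_trans _ _ (e / (1 + C) * C)); first by rewrite ler_wpM2r// ge_min lexx orbT.
by rewrite mulrAC ler_pdivrMr//; nra.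
Qed.

Section symmetry.
Context {R : realType} {d : nat}.
Variables (V : 'rV[R]_d -> R) (k : R -> R.-pker 'rV[R]_d ~> 'rV[R]_d).
Variable pi : probability 'rV[R]_d R.
Hypothesis hV : C1 V.
Hypothesis hpi : gibbs V pi.
Hypothesis hk : langevin_transition V k.
Hypothesis hsemi : L2_contraction_semigroup k pi.
Hypothesis hcore : smooth_core V k pi.
Local Notation T := 'rV[R]_d.
Local Notation S := (semigroup k).
Local Notation L2 := (L2 pi).
Local Notation n2 := (n2 pi).
Local Notation ip := (ip pi).
Implicit Types (f g h u w : T -> R) (s t a : R).

(** Both sides equal minus the Dirichlet form, the sum over i of the inner products of the i-th
    partial derivatives. *)
Lemma core_sym u w : smooth u -> L2_generator k pi u (langevin_op V u) ->
  smooth w -> L2_generator k pi w (langevin_op V w) ->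
  ip w (langevin_op V u) = ip u (langevin_op V w).
Proof.
have H (a b : T -> R) : smooth a -> L2_generator k pi a (langevin_op V a) ->
    smooth b -> L2_generator k pi b (langevin_op V b) ->
    ip b (langevin_op V a) = - \sum_i ip (partial i b) (partial i a).
  move=> sa [la lLa _] sb [lb lLb _].
  apply: (ibp_L2 hV hpi sa la lLa (smooth_cont sb)).
  - by move=> i; apply/smooth_cont/smooth_partial.
  - by move=> i x; apply: is_derive_partial; exact: (sb [::]).
  - exact: lb.
  - exact: grad_L2 sb lb lLb.
move=> su gu sw gw; apply: etrans (H u w su gu sw gw) _.
apply: etrans _ (esym (H w u sw gw su gu)); apply: f_equal.
by apply: eq_bigr => i _; exact: ipC.
Qed.

Lemma core_approx f g e : L2_generator k pi f g -> 0 < e ->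
  exists h, [/\ smooth h, L2_generator k pi h (langevin_op V h),
    n2 (f \- h) <= e & n2 (g \- langevin_op V h) <= e].
Proof.
move=> fg e0; have [h [sh gh H1 H2]] := hcore fg e0; exists h; split => //.
  case: fg gh => lf lg _ [lh lLh _]; move: H1.
  by rewrite /L2norm L2normE ?lte_fin; [exact: ltW|exact: (L2B lf lh)].
case: fg gh => lf lg _ [lh lLh _]; move: H2.
by rewrite /L2norm L2normE ?lte_fin; [exact: ltW|exact: (L2B lg lLh)].
Qed.

Lemma gen_sym f g f' g' : L2_generator k pi f g -> L2_generator k pi f' g' ->
  ip f g' = ip g f'.
Proof.
move=> G G'; have [lf lg _] := G; have [lf' lg' _] := G'.
have n0 h : 0 <= n2 h := n2_ge0 pi h.
apply: (@eq_of_small_error _ _ _ ((n2 f + n2 g' + 1) + (n2 g + n2 f' + 1))).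
  by rewrite !addr_ge0.
move=> e e0 e1.
have [h [sh gh H1 H2]] := core_approx G e0.
have [h' [sh' gh' H1' H2']] := core_approx G' e0.
have [lh lLh _] := gh; have [lh' lLh' _] := gh'.
rewrite (_ : ip f g' - ip g f' = (ip f g' - ip h (langevin_op V h')) -
    (ip g f' - ip (langevin_op V h) h')); last first.
  by rewrite (core_sym sh' gh' sh gh) (ipC pi h'); ring.
apply: le_trans (ler_normB _ _) _; rewrite mulrDr.
apply: lerD; first exact: (ip_close1 lf lh lg' lLh' e1 H1 H2').
exact: (ip_close1 lg lLh lf' lh' e1 H2 H1').
Qed.

Lemma iter_L2 t f n : 0 <= t -> L2 f -> L2 (iter n (S t) f).
Proof. by move=> t0 lf; elim: n => [//|n IH] /=; exact: S_L2. Qed.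

Lemma iter_contr t f n : 0 <= t -> L2 f -> n2 (iter n (S t) f) <= n2 f.
Proof.
move=> t0 lf; elim: n => [//|n IH] /=; apply: le_trans IH.
by apply: S_contr => //; exact: iter_L2.
Qed.

Lemma iter_gen t f g n : 0 <= t -> L2_generator k pi f g ->
  L2_generator k pi (iter n (S t) f) (iter n (S t) g).
Proof. by move=> t0 G; elim: n => [//|n IH] /=; exact: (gen_S hk hsemi). Qed.

Lemma iter_dq t f g n : 0 <= t -> L2 f -> L2 g ->
  n2 (dq k t (iter n (S t) f) \- iter n (S t) g) <= n2 (dq k t f \- g).
Proof.
move=> t0 lf lg; elim: n => [//|n IH]; apply: le_trans IH => /=.
have lif := iter_L2 n t0 lf; have lig := iter_L2 n t0 lg.
have ldq := dq_L2 hsemi t0 lif.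
apply: le_trans (n2S_B hsemi t0 ldq lig).
rewrite le_eqVlt; apply/orP; left; apply/eqP; apply: n2_subae.
- by apply: dq_L2 => //; exact: S_L2.
- exact: S_L2.
- exact: S_L2.
- exact: S_L2.
- exact: (S_comm_dq hk hsemi t0 t0 lif).
- exact: nearW.
Qed.

Lemma iter_S t f n : 0 <= t -> L2 f ->
  {ae pi, forall x, iter n (S t) f x = S (t *+ n) f x}.
Proof.
move=> t0 lf; elim: n => [|n IH] /=.
  by apply: nearW => x; rewrite mulr0n (S0 hk)//; exact: L2_meas lf.
have H := S_ae hsemi t0 (iter_L2 n t0 lf) (S_L2 hsemi (mulrn_wge0 n t0) lf) IH.
apply: ae_trans_eq H _; rewrite mulrS; apply: ae_sym_eq.
exact: S_semi hk hsemi _ _ _ t0 (mulrn_wge0 n t0) lf.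
Qed.

(* Moving one factor S s at a time from f to f' costs o(s) by symmetry of the
   generator, uniformly along the orbits, and there are t / s factors. *)
Lemma S_sym_gen t f g f' g' : 0 < t -> L2_generator k pi f g -> L2_generator k pi f' g' ->
  ip (S t f) f' = ip f (S t f').
Proof.
move=> t0 G G'; have /genP[|lf lg H] := G => //; have /genP[|lf' lg' H'] := G' => //.
have n0 h : 0 <= n2 h := n2_ge0 pi h.
apply: (@eq_of_small_error _ _ _ (t * (n2 f + n2 f'))); first by rewrite mulr_ge0 ?addr_ge0// ltW.
move=> e e0 e1.
have [d1 d10 H1] := H _ e0; have [d2 d20 H2] := H' _ e0.
have d0 : 0 < Num.min d1 d2 by rewrite lt_min d10.
pose N := Num.truncn (t / Num.min d1 d2).
pose s := t / N.+1%:R.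
have s0 : 0 < s by rewrite divr_gt0.
have sd : s < Num.min d1 d2.
  by rewrite ltr_pdivrMr// mulrC -ltr_pdivrMr//; exact: truncnS_gt.
move: sd; rewrite lt_min => /andP[sd1 sd2].
have ts : t = s *+ N.+1 by rewrite -mulr_natr mulfVK.
(* Both terms are <a, b> plus s times a pairing with a difference quotient. Once the quotients are
   replaced by generators the pairings cancel by [gen_sym], and each replacement costs at most e. *)
have step j m : `|ip (iter j.+1 (S s) f) (iter m (S s) f') - ip (iter j (S s) f) (iter m.+1 (S s) f')|
    <= s * (e * (n2 f + n2 f')).
  have s0' := ltW s0.
  set a := iter j (S s) f; set b := iter m (S s) f'.
  have la : L2 a := iter_L2 j s0' lf; have lb : L2 b := iter_L2 m s0' lf'.
  have ga := iter_gen j s0' G; have gb := iter_gen m s0' G'.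
  have lSa := S_L2 hsemi s0' la; have lSb := S_L2 hsemi s0' lb.
  have lda := dq_L2 hsemi s0' la; have ldb := dq_L2 hsemi s0' lb.
  have [_ lga _] := ga; have [_ lgb _] := gb.
  have -> : ip (iter j.+1 (S s) f) b - ip a (iter m.+1 (S s) f') =
      s * (ip (dq k s a \- iter j (S s) g) b - ip a (dq k s b \- iter m (S s) g')).
    have E1 : ip (iter j.+1 (S s) f) b = ip a b + s * ip (dq k s a) b.
      rewrite -ipZl// -ipDl//; last exact: L2Z.
      by congr ip; apply/funext => x /=; rewrite /dq; field; rewrite gt_eqF.
    have E2 : ip a (iter m.+1 (S s) f') = ip a b + s * ip a (dq k s b).
      rewrite -ipZr// -ipDr//; last exact: L2Z.
      by congr ip; apply/funext => x /=; rewrite /dq; field; rewrite gt_eqF.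
    rewrite E1 E2 ipBl// ipBr//.
    have := gen_sym ga gb; rewrite -/a -/b => ->; ring.
  rewrite normrM (gtr0_norm s0) ler_wpM2l//.
  apply: le_trans (ler_normB _ _) _; rewrite mulrDr addrC.
  apply: lerD.
    apply: le_trans (CS la (L2B ldb lgb)) _; rewrite mulrC.
    apply: ler_pM => //; last exact: iter_contr.
    by apply: le_trans (iter_dq m s0' lf' lg') _; apply/ltW/H2.
  apply: le_trans (CS (L2B lda lga) lb) _.
  apply: ler_pM => //; last exact: iter_contr.
  by apply: le_trans (iter_dq j s0' lf lg) _; apply/ltW/H1.
have tot j m : `|ip (iter j (S s) f) (iter m (S s) f') - ip f (iter (j + m) (S s) f')|
    <= (s *+ j) * (e * (n2 f + n2 f')).
  elim: j m => [|j IH] m; first by rewrite add0n subrr normr0 mulr0n mul0r.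
  rewrite mulrS mulrDl.
  set A := ip _ _; set B := ip _ _.
  have -> : A - B = (A - ip (iter j (S s) f) (iter m.+1 (S s) f')) +
      (ip (iter j (S s) f) (iter m.+1 (S s) f') - B) by ring.
  apply: le_trans (ler_normD _ _) _; apply: lerD; first exact: step.
  by rewrite /B addSnnS; exact: IH.
have := tot N.+1 0%N; rewrite addn0 -ts.
have E1 : ip (iter N.+1 (S s) f) f' = ip (S t f) f'.
  apply: ip_aeL (_) (_) lf' _; [exact: (iter_L2 _ (ltW s0) lf)|exact: (S_L2 hsemi (ltW t0) lf)|].
  by rewrite ts; exact: (iter_S _ (ltW s0) lf).
have E2 : ip f (iter N.+1 (S s) f') = ip f (S t f').
  rewrite ipC [RHS]ipC.
  apply: ip_aeL (_) (_) lf _; [exact: (iter_L2 _ (ltW s0) lf')|exact: (S_L2 hsemi (ltW t0) lf')|].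
  by rewrite ts; exact: (iter_S _ (ltW s0) lf').
rewrite E2 [iter 0 _ _]/= E1 => /le_trans; apply.
by rewrite le_eqVlt; apply/orP; left; apply/eqP; ring.
Qed.

Lemma S_sym t f f' : 0 <= t -> L2 f -> L2 f' -> ip (S t f) f' = ip f (S t f').
Proof.
rewrite le_eqVlt => /predU1P[<- lf lf'|t0 lf lf'].
  by rewrite !(S0 hk)//; [exact: L2_meas lf'|exact: L2_meas lf].
have n0 h : 0 <= n2 h := n2_ge0 pi h.
apply: (@eq_of_small_error _ _ _ ((n2 (S t f) + n2 f' + 1) + (n2 f + n2 (S t f') + 1))).
  by rewrite !addr_ge0.
move=> e e0 e1.
have [u [g [G H]]] := gen_dense hk hsemi lf e0.
have [u' [g' [G' H']]] := gen_dense hk hsemi lf' e0.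
have [lu _ _] := G; have [lu' _ _] := G'.
have t0' := ltW t0.
have lSf := S_L2 hsemi t0' lf; have lSf' := S_L2 hsemi t0' lf'.
have lSu := S_L2 hsemi t0' lu; have lSu' := S_L2 hsemi t0' lu'.
rewrite n2C in H; rewrite n2C in H'.
rewrite (_ : ip (S t f) f' - ip f (S t f') = (ip (S t f) f' - ip (S t u) u') - (ip f (S t f') - ip u (S t u'))); last first.
  by rewrite (S_sym_gen t0 G G') opprB addrA subrK.
apply: le_trans (ler_normB _ _) _; rewrite mulrDr.
by apply: lerD; apply: ip_close1 => //; apply: le_trans (n2S_B hsemi t0' _ _) _.
Qed.

Lemma L2_indic (A : set T) : measurable A -> L2 (\1_A).
Proof.
move=> mA; apply: (@L2_bnd _ _ _ _ _ 1); first exact: measurable_indic.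
by move=> x; rewrite indicE; case: (_ \in _); rewrite ?normr1 ?normr0.
Qed.

Lemma S_indic t (A : set T) x : measurable A -> (S t (\1_A) x)%:E = k t x A.
Proof.
move=> mA; rewrite /semigroup /Rintegral integral_indic// setIT fineK//.
exact: (finite_kernel_measure (k t) x mA).
Qed.

(** Symmetry tested against the constant 1, which S t fixes. *)
Lemma invariant_set t (A : set T) : 0 <= t -> measurable A ->
  (pi A = \int[pi]_x k t x A)%E.
Proof.
move=> t0 mA; have lA := L2_indic mA.
have := S_sym t0 lA (L2_cst pi 1); rewrite S_cst.
rewrite /ip; under eq_Rintegral do rewrite mulr1.
under [in RHS]eq_Rintegral do rewrite mulr1.
rewrite /Rintegral integral_indic// setIT => H.
have -> : (\int[pi]_x k t x A = \int[pi]_x (S t (\1_A) x)%:E)%E.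
  by apply: eq_integral => x _; rewrite S_indic.
rewrite -[RHS]fineK; last first.
  by apply: integrable_fin_num => //; apply: L2_int; exact: S_L2.
by rewrite H fineK//; exact: fin_num_measure.
Qed.

Lemma invariant_integral t (f : T -> \bar R) : 0 <= t -> measurable_fun setT f ->
  (forall x, 0 <= f x)%E -> (\int[pi]_x f x = \int[pi]_x \int[k t x]_y f y)%E.
Proof.
move=> t0 mf f0; apply: integral_mixture => //.
  by move=> U mU; exact: measurable_kernel.
by move=> U mU; exact: invariant_set.
Qed.

(** Pointwise Jensen for the probability k t x, from the affine minorant at S t f x, followed by
    invariance. The inequality lives in the extended reals because J (f) is not assumed
    integrable. *)
Lemma jensen (J p : R -> R) t f : 0 <= t -> L2 f -> (forall x, 0 <= f x) ->
  measurable_fun setT J -> (forall y, 0 <= y -> 0 <= J y) ->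
  (forall x y, 0 <= x -> 0 <= y -> J x + p x * (y - x) <= J y) ->
  (\int[pi]_x (J (S t f x))%:E <= \int[pi]_x (J (f x))%:E)%E.
Proof.
move=> t0 lf f0 mJ J0 Jp.
have mf := L2_meas lf; have mSf := S_meas k t mf.
have mJf : measurable_fun setT (fun x => (J (f x))%:E) by exact/measurable_EFinP/measurableT_comp.
have JSf0 x : (0 <= (J (S t f x))%:E)%E by rewrite lee_fin J0// S_ge0.
have Jf0 x : (0 <= (J (f x))%:E)%E by rewrite lee_fin J0.
rewrite (invariant_integral t0 mJf Jf0).
apply: ae_ge0_le_integral => //.
- exact/measurable_EFinP/measurableT_comp.
- by move=> x _; exact: integral_ge0.
- by apply: measurable_fun_integral_kernel => // U mU; exact: measurable_kernel.
apply: filterS (S_int hsemi t0 lf) => x fi _.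
have [H|] := ltP (\int[k t x]_y (J (f y))%:E)%E +oo%E; last by rewrite leye_eq => /eqP ->; rewrite leey.
have iJ : (k t x).-integrable setT (fun y => (J (f y))%:E).
  apply/integrableP; split => //.
  by under eq_integral do rewrite gee0_abs//.
set b := S t f x.
have icst c : (k t x).-integrable setT (EFin \o (fun=> c)).
  apply: measurable_bounded_integrable => //; first by rewrite prob_kernel ltry.
  by exists `|c|; split; [exact: num_real|move=> M continuous_mul y _; exact: ltW].
have ib : (k t x).-integrable setT (EFin \o (fun y => J b + p b * (f y - b))).
  rewrite (_ : _ \o _ = (EFin \o (fun=> J b - p b * b)%R) \+ (fun y => (p b)%:E * (EFin \o f) y))%E; last first.
    by apply/funext => y; rewrite /= -EFinM -EFinD; congr EFin; ring.
  apply: integrableD => //; last exact: integrableZl.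
have E : (\int[k t x]_y (J b + p b * (f y - b))%:E = (J b)%:E)%E.
  rewrite -[LHS](fineK (integrable_fin_num measurableT ib)); congr EFin.
  rewrite -/(Rintegral (k t x) setT (fun y => J b + p b * (f y - b))).
  transitivity (\int[k t x]_y ((J b - p b * b) + p b * f y)).
    by apply: eq_Rintegral => y _; ring.
  have ipf : (k t x).-integrable setT (EFin \o (fun y => p b * f y)).
    rewrite (_ : _ \o _ = (fun y => (p b)%:E * (EFin \o f) y)%E); first exact: integrableZl.
    by apply/funext => y; rewrite /= -EFinM.
  apply: (etrans (RintegralD measurableT (icst (J b - p b * b)) ipf)).
  have -> : \int[k t x]_y (p b * f y) = p b * b by exact: (RintegralZl (p b) measurableT fi).
  rewrite Rintegral_cst//.
  rewrite (_ : fine _ = 1); first by ring.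
  by rewrite (_ : k t x setT = 1%E)// prob_kernel.
rewrite -E; apply: le_integral => // y _; rewrite lee_fin.
by apply: Jp => //; exact: S_ge0.
Qed.

End symmetry.

(** * Smooth truncation *)

Section primitive.
Context {R : realType}.
Variable p : R -> R.
Hypothesis cp : continuous p.
Hypothesis ndp : {homo p : x y / x <= y}.
Local Notation mu := (@lebesgue_measure R).

Let intc (f : R -> R) x y : continuous f -> mu.-integrable `]x, y]%classic (EFin \o f).
Proof.
move=> cf; apply: (@integrableS _ _ _ mu `[x, y]%classic) => //.
  by apply: subset_itvr; rewrite bnd_simp.
apply: continuous_compact_integrable; first exact: segment_compact.
by apply: continuous_in_subspaceT => z _; exact: cf.
Qed.

Let D x y := \int[mu]_(s in `]x, y]) p s.

Let D_add x y z : x <= y -> y <= z -> D x z = D x y + D y z.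
Proof.
move=> xy yz; rewrite /D -(@Rintegral_itvB _ p (BRight x) (BRight z) y) ?bnd_simp//; last exact: intc.
by ring.
Qed.

Let D_bnd x y : x <= y -> p x * (y - x) <= D x y <= p y * (y - x).
Proof.
move=> xy.
have E c : c * (y - x) = \int[mu]_(s in `]x, y]) c.
  rewrite Rintegral_cst//= lebesgue_measure_itv /= lte_fin.
  case: ltP => [_ //|yx]; rewrite (_ : y - x = 0) ?mulr0 //.
  by apply/eqP; rewrite subr_eq0; apply/eqP/le_anti; rewrite yx xy.
rewrite !E; apply/andP; split; apply: le_Rintegral => //;
  try (by apply: intc => // s; exact: cvg_cst);
  by move=> s /=; rewrite in_itv/= => /andP[xs sy]; apply: ndp => //; exact: ltW.
Qed.

(** The signed integral of [p] from 0: monotonicity of [p] places the increment from y to x between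
    p y (x - y) and p x (x - y). *)
Lemma convex_primitive : exists phi : R -> R, phi 0 = 0 /\
  forall x y, p y * (x - y) <= phi x - phi y.
Proof.
pose phi x := if 0 <= x then D 0 x else - D x 0.
have phiE x y : y <= x -> phi x - phi y = D y x.
  move=> yx; rewrite /phi.
  case: (leP 0 y) => y0.
    by rewrite (le_trans y0 yx) (D_add y0 yx); ring.
  case: (leP 0 x) => x0.
    by rewrite (D_add (ltW y0) x0); ring.
  by rewrite (D_add yx (ltW x0)); ring.
exists phi; split.
  by rewrite /phi lexx /D set_itvoc0 Rintegral_set0.
move=> x y; have [yx|xy] := leP y x.
  by rewrite phiE//; have /andP[] := D_bnd yx.
have := phiE _ _ (ltW xy); have /andP[_] := D_bnd (ltW xy) => H1 H2.
by lra.
Qed.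

(** The inequality at both end points traps the difference quotient between p x and p (h + x), and
    [p] is continuous. *)
Lemma subgrad_is_derive (phi : R -> R) (x : R) : (forall x y, p y * (x - y) <= phi x - phi y) ->
  is_derive x (1 : R) phi (p x).
Proof.
move=> H.
suff K : h^-1 *: (phi (h + x) - phi x) @[h --> 0^'] --> p x.
  by apply: DeriveDef; [apply/cvg_ex; exists (p x)|apply: cvg_lim => //];
    under eq_fun do rewrite /= scaler1.
apply/cvgrPdist_le => e e0.
have /cvgrPdist_le/(_ _ e0) [dl /= dl0 Hd] : p y @[y --> x] --> p x by exact: cp.
exists dl => // h /=; rewrite sub0r normrN => hd h0.
have := Hd (h + x); rewrite /ball_ /= opprD addrCA subrr addr0 normrN => /(_ hd) Hp.
have A := H (h + x) x; have B := H x (h + x).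
rewrite (_ : h + x - x = h) in A; last by ring.
rewrite (_ : x - (h + x) = - h) in B; last by ring.
set Dp := phi (h + x) - phi x in A *.
have {}B : Dp <= p (h + x) * h by rewrite /Dp; lra.
rewrite /GRing.scale /=.
suff : `|p x - h^-1 * Dp| <= `|p x - p (h + x)| by move=> /le_trans; apply.
have -> : p x - h^-1 * Dp = (p x * h - Dp) / h by field.
rewrite normrM normfV ler_pdivrMr ?normr_gt0// -normrM.
rewrite ler0_norm; last by rewrite subr_le0.
by rewrite -[leRHS]normrN; apply: le_trans (ler_norm _); lra.
Qed.

End primitive.

Section mean_value.
Context {R : realType}.
Implicit Types f df : R -> R.

Lemma mean_value f df (x y : R) : (forall z : R, x <= z <= y -> is_derive z (1 : R) f (df z)) ->
  x <= y -> exists2 c, x <= c <= y & f y - f x = df c * (y - x).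
Proof.
move=> Hf xy; have [z||c] := @MVT_segment R f df x y xy.
- by rewrite in_itv/= => /andP[xz zy]; apply: Hf; rewrite !ltW.
- apply: derivable_within_continuous => z; rewrite in_itv/= => xzy.
  by have [] := Hf z xzy.
by rewrite in_itv => cxy E; exists c.
Qed.

(** Mean value theorem on the half-line; the margin m < 0 makes f differentiable at 0 as well. *)
Lemma derive_convex (m : R) f df : m < 0 -> (forall x : R, m < x -> is_derive x (1 : R) f (df x)) ->
  (forall x y, 0 <= x -> x <= y -> df x <= df y) ->
  forall x y, 0 <= x -> 0 <= y -> f x + df x * (y - x) <= f y.
Proof.
move=> m0 Hf H x y x0 y0; have [xy|/ltW yx] := leP x y.
  have [|c /andP[xc cy] E] := @mean_value f df x y _ xy.
    by move=> z /andP[xz _]; apply: Hf; apply: lt_le_trans xz; exact: lt_le_trans x0.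
  have : df x * (y - x) <= df c * (y - x) by rewrite ler_wpM2r ?subr_ge0// H.
  by lra.
have [|c /andP[yc cx] E] := @mean_value f df y x _ yx.
  by move=> z /andP[yz _]; apply: Hf; apply: lt_le_trans yz; exact: lt_le_trans y0.
have : df c * (x - y) <= df x * (x - y) by rewrite ler_wpM2r ?subr_ge0// H// (le_trans y0).
by lra.
Qed.

Variables f df : R -> R.
Hypothesis Hf : forall x : R, is_derive x (1 : R) f (df x).

Lemma is_derive_continuous : continuous f.
Proof.
by move=> x; apply: differentiable_continuous; apply/derivable1_diffP; have [] := Hf x.
Qed.

Lemma derive_nondecreasing : (forall x, 0 <= df x) -> {homo f : x y / x <= y}.
Proof.
move=> H x y xy; have [c _ E] := mean_value (fun z _ => Hf z) xy.
by rewrite -subr_ge0 E mulr_ge0// subr_ge0.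
Qed.

Lemma derive_lipschitz M : (forall x, `|df x| <= M) -> forall x y, `|f x - f y| <= M * `|x - y|.
Proof.
move=> H x y; wlog xy : x y / y <= x.
  by move=> W; have [/W//|/ltW/W] := leP y x; rewrite distrC [X in M * X]distrC.
by have [c _ ->] := mean_value (fun z _ => Hf z) xy; rewrite normrM ler_wpM2r.
Qed.

End mean_value.

Section truncation.
Context {R : realType}.

Lemma is_derive_powR (c x : R) : 0 < x -> is_derive x (1 : R) (fun u => u `^ c) (c * x `^ (c - 1)).
Proof.
move=> x0; have xi : x \in `]0, +oo[ by rewrite in_itv/= x0.
apply: DeriveDef; first exact: derivable_powR.
by rewrite -derive1E powR_derive1.
Qed.

Lemma is_derive_powR_comp (g : R -> R) dg (c x : R) : (forall y, 0 < g y) ->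
  is_derive x (1 : R) g dg -> is_derive x (1 : R) (fun u => g u `^ c) (c * g x `^ (c - 1) * dg).
Proof.
move=> g0 Hg; exact: (is_derive_comp_dir (f := fun u => u `^ c) (g := g) (is_derive_powR c (g0 x)) Hg).
Qed.

Lemma powR_continuous (c : R) (g : R -> R) : (forall y, 0 < g y) -> continuous g ->
  continuous (fun x => g x `^ c).
Proof.
move=> g0 cg x; apply: (continuous_comp (g := fun u => u `^ c)); first exact: cg.
apply: differentiable_continuous; apply/derivable1_diffP.
by have [] := is_derive_powR c (g0 x).
Qed.

Lemma powR_le (c x y : R) : 0 <= c -> 0 <= x -> x <= y -> x `^ c <= y `^ c.
Proof. by move=> c0 x0 xy; rewrite ge0_ler_powR// nnegrE ?(le_trans x0). Qed.

Lemma powR_lip (c a x y : R) : 1 <= c -> 0 <= x <= a -> 0 <= y <= a ->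
  `|x `^ c - y `^ c| <= c * a `^ (c - 1) * `|x - y|.
Proof.
move=> c1; wlog yx : x y / y <= x.
  by move=> W; have [/W//|/ltW/W H] := leP y x => ? ?; rewrite distrC [X in _ * X]distrC H.
move=> /andP[x0 xa] /andP[y0 ya].
have c0 : 0 < c by lra.
have := powR_le (ltW c0) y0 yx => H.
rewrite !ger0_norm ?subr_ge0//.
apply: le_trans (_ : _ <= c * x `^ (c - 1) * (x - y)) _; last first.
  by rewrite ler_wpM2r ?subr_ge0// ler_wpM2l ?(ltW c0)// powR_le//; lra.
move: y0; rewrite le_eqVlt => /predU1P[y0|y0].
  rewrite -y0 powR0 ?(gt_eqF c0)// !subr0 -mulrA [_ * x]mulrC mulr_powRB1//.
  by rewrite ler_peMl ?powR_ge0.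
have [|z /andP[yz zx] ->] := @mean_value _ (fun u => u `^ c) (fun u => c * u `^ (c - 1)) y x _ yx.
  by move=> z /andP[yz _]; apply: is_derive_powR; exact: lt_le_trans yz.
rewrite ler_wpM2r ?subr_ge0// ler_wpM2l ?(ltW c0)// powR_le//; first lra.
by apply: le_trans yz; exact: ltW.
Qed.

Variables (e a : R).
Hypotheses (e0 : 0 < e) (a0 : 0 < a).

(** The square root is written as a real power so that the rules for powers of positive functions
    give its derivatives of every order. *)
Definition hypot (x : R) := (x ^+ 2 + e ^+ 2) `^ 2^-1.

Lemma hypot_arg (x : R) : 0 < x ^+ 2 + e ^+ 2.
Proof. by rewrite ltr_wpDl ?sqr_ge0 ?exprn_gt0. Qed.

Lemma hypot_gt0 x : 0 < hypot x. Proof. exact: powR_gt0 (hypot_arg x). Qed.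

Lemma hypot_sqr x : hypot x ^+ 2 = x ^+ 2 + e ^+ 2.
Proof. by rewrite /hypot powR12_sqrt ?sqr_sqrtr// ltW// hypot_arg. Qed.

Lemma hypot_gt x : `|x| < hypot x.
Proof.
rewrite -(ltr_pXn2r (n := 2))// ?nnegrE ?normr_ge0 ?(ltW (hypot_gt0 x))//.
by rewrite hypot_sqr real_normK ?num_real// ltrDl exprn_gt0.
Qed.

Lemma hypot_le x : hypot x <= `|x| + e.
Proof.
rewrite -(ler_pXn2r (n := 2))// ?nnegrE ?addr_ge0 ?(ltW e0) ?normr_ge0 ?(ltW (hypot_gt0 x))//.
rewrite hypot_sqr sqrrD real_normK ?num_real// lerD2r lerDl.
by rewrite mulrn_wge0// mulr_ge0// ltW.
Qed.

Lemma is_derive_hypot x : is_derive x (1 : R) hypot (x / hypot x).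
Proof.
have := is_derive_powR_comp (g := fun x => x ^+ 2 + e ^+ 2) (x := x) 2^-1 hypot_arg.
have H : is_derive x (1 : R) (fun x => x ^+ 2 + e ^+ 2) (2 * x).
  have Hm := @is_deriveM _ _ id id x (1 : R) _ _ (is_derive_id _ _) (is_derive_id _ _).
  have := is_deriveD Hm (is_derive_cst (e ^+ 2) x (1 : R)).
  by rewrite (_ : _ + 0 = 2 * x)// /GRing.scale /= !mulr1 addr0 mulr2n mulrDl mul1r.
move=> /(_ _ H); set c := (X in is_derive _ _ _ X -> _); suff -> : c = x / hypot x by [].
rewrite /c (_ : 2^-1 - 1 = - 2^-1 :> R); last by field.
by rewrite powRN -/(hypot x); have := lt0r_neq0 (hypot_gt0 x) => hn; field.
Qed.

Definition sgn_e x := x / hypot x.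

Lemma is_derive_sgn_e x : is_derive x (1 : R) sgn_e (e ^+ 2 / hypot x ^+ 3).
Proof.
have hn := lt0r_neq0 (hypot_gt0 x).
have := is_derive_hypot x => H.
have := @is_deriveV _ hypot x _ _ hn H => HV.
have := @is_deriveM _ _ id (fun x => (hypot x)^-1) x (1 : R) _ _ (is_derive_id _ _) HV.
set c := (X in is_derive _ _ _ X -> _); suff -> : c = e ^+ 2 / hypot x ^+ 3 by [].
rewrite /c /GRing.scale /= mulr1.
have -> : e ^+ 2 = hypot x ^+ 2 - x ^+ 2 by rewrite hypot_sqr; ring.
by field.
Qed.

(* For x >= 0 this is min (x, a) = (a + |x| - |x - a|) / 2 with the absolute values
   replaced by sqrt (x^2 + e^2); it takes values in (0, a) for every real x. *)
Definition trunc x := (a + hypot x - hypot (x - a)) / 2.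
Definition dtrunc x := (sgn_e x - sgn_e (x - a)) / 2.

Lemma is_derive_trunc x : is_derive x (1 : R) trunc (dtrunc x).
Proof.
have H1 := is_derive_hypot x; have H2 := is_derive_hypot (x - a).
have Hs : is_derive x (1 : R) (fun y : R => y - a) 1.
  by rewrite -[X in is_derive _ _ _ X]subr0; exact: is_deriveB.
have H3 := is_derive_comp_dir (f := hypot) (g := fun y : R => y - a) H2 Hs.
have H4 : is_derive x (1 : R) (fun x => 2^-1 *: ((a + hypot x) - hypot (x - a))) (2^-1 *: ((0 + x / hypot x) - (x - a) / hypot (x - a) * 1)).
  by apply: is_deriveZ; apply: is_deriveB.
rewrite (_ : trunc = fun x => 2^-1 *: ((a + hypot x) - hypot (x - a))); last by apply/funext => y; rewrite /trunc /GRing.scale/= mulrC.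
rewrite (_ : dtrunc x = 2^-1 *: ((0 + x / hypot x) - (x - a) / hypot (x - a) * 1))//.
by rewrite /dtrunc /sgn_e /GRing.scale/= add0r mulr1 mulrC.
Qed.

Lemma sgn_e_nd : {homo sgn_e : x y / x <= y}.
Proof.
apply: (derive_nondecreasing is_derive_sgn_e) => x.
by rewrite divr_ge0 ?exprn_ge0// ltW// ?hypot_gt0.
Qed.

Lemma dtrunc_ge0 x : 0 <= dtrunc x.
Proof. by rewrite divr_ge0// subr_ge0 sgn_e_nd// lerBlDr lerDl ltW. Qed.

Lemma sgn_e_lt1 x : `|sgn_e x| < 1.
Proof.
by rewrite normrM normfV (gtr0_norm (hypot_gt0 x)) ltr_pdivrMr ?hypot_gt0// mul1r hypot_gt.
Qed.

Lemma dtrunc_le1 x : dtrunc x <= 1.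
Proof.
rewrite /dtrunc; have := sgn_e_lt1 x; have := sgn_e_lt1 (x - a); rewrite !ltr_norml => /andP[? ?] /andP[? ?].
by lra.
Qed.

Lemma continuous_dtrunc : continuous dtrunc.
Proof.
have cs := is_derive_continuous is_derive_sgn_e.
apply: continuous_mul; last exact: continuous_const; apply: continuous_add => //; apply: continuous_opp.
apply: continuous_postcomp => //; apply: continuous_add; [by move=> x; exact: cvg_id|exact: continuous_const].
Qed.

Lemma trunc_gt0 x : 0 < trunc x.
Proof.
rewrite divr_gt0// subr_gt0 -(ltr_pXn2r (n := 2))// ?nnegrE ?addr_ge0 ?(ltW a0) ?(ltW (hypot_gt0 _))//.
rewrite sqrrD !hypot_sqr.
have : a * (- x) < a * hypot x.
  by rewrite ltr_pM2l//; apply: le_lt_trans (hypot_gt x); rewrite -normrN ler_norm.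
by rewrite mulr2n; lra.
Qed.

Lemma trunc_lt x : trunc x < a.
Proof.
rewrite /trunc ltr_pdivrMr//.
suff : hypot x < a + hypot (x - a) by lra.
rewrite -(ltr_pXn2r (n := 2))// ?nnegrE ?addr_ge0 ?(ltW a0) ?(ltW (hypot_gt0 _))//.
rewrite sqrrD !hypot_sqr.
have : a * (x - a) < a * hypot (x - a).
  by rewrite ltr_pM2l//; apply: le_lt_trans (hypot_gt _); rewrite ler_norm.
by rewrite mulr2n; lra.
Qed.

Lemma trunc_min x : 0 <= x -> `|trunc x - Num.min x a| <= e.
Proof.
move=> x0; have := hypot_gt x; have := hypot_le x; have := hypot_gt (x - a); have := hypot_le (x - a).
rewrite (ger0_norm x0) ler_norml /trunc => H1 H2 H3 H4.
have [xa|ax] := leP x a; [have E : `|x - a| = a - x|have E : `|x - a| = x - a].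
- by rewrite ler0_norm ?opprB// subr_le0.
- by rewrite E in H1 H2; apply/andP; split; lra.
- by rewrite ger0_norm// subr_ge0 ltW.
- by rewrite E in H1 H2; apply/andP; split; lra.
Qed.

End truncation.

Section smooth_calculus.
Context {R : realType} {d : nat}.
Local Notation T := 'rV[R]_d.
Local Notation e_ i := (delta_mx ord0 i : T).
Implicit Types f g : T -> R.

(** [smooth] speaks of lists of partial derivatives; the order-by-order form supports inductions in
    which the product or chain rule creates new functions to be differentiated again. *)
Fixpoint Cn n f : Prop := (forall x, differentiable f x) /\
  if n is m.+1 then forall i, Cn m (partial i f) else True.

Lemma Cn_diff n f x : Cn n f -> differentiable f x.
Proof. by case: n => [|n] [H _]. Qed.

Lemma Cn_le n f : Cn n.+1 f -> Cn n f.
Proof. by elim: n f => [f [H _]//|n IH f [H K]]; split => // i; apply: IH; exact: K. Qed.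

Lemma Cn_partial n f i : Cn n.+1 f -> Cn n (partial i f).
Proof. by case=> _; apply. Qed.

Lemma smoothP f : smooth f <-> forall n, Cn n f.
Proof.
split=> [sf n|H s].
  elim: n f sf => [|n IH] f sf; split => //; try exact: (sf [::]).
  by move=> i; apply: IH; exact: smooth_partial.
elim/last_ind: s f H => [|s i IH] f H x; first by have [] := H 0%N.
by rewrite foldr_rcons; apply: IH => n; exact: Cn_partial.
Qed.

Lemma partial_is_derive i f x df : is_derive x (e_ i) f df -> partial i f x = df.
Proof. by move=> H; rewrite /partial derive_val. Qed.

Lemma Cn_cst n c : Cn n (fun=> c).
Proof.
elim: n c => [|n IH] c; split => //.
move=> i; rewrite (_ : partial i _ = fun=> 0) //.
by apply/funext => x; apply: partial_is_derive; exact: is_derive_cst.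
Qed.

Lemma Cn_add n f g : Cn n f -> Cn n g -> Cn n (fun x => f x + g x).
Proof.
elim: n f g => [|n IH] f g Hf Hg; (split; first by move=> x; apply: differentiableD; [exact: (Cn_diff x Hf)|exact: (Cn_diff x Hg)]) => //.
move=> i; rewrite (_ : partial i _ = fun x => partial i f x + partial i g x).
  by apply: IH; exact: Cn_partial.
apply/funext => x; apply: partial_is_derive.
by apply: is_deriveD; apply: is_derive_partial; [exact: (Cn_diff x Hf)|exact: (Cn_diff x Hg)].
Qed.

Lemma Cn_mul n f g : Cn n f -> Cn n g -> Cn n (fun x => f x * g x).
Proof.
elim: n f g => [|n IH] f g Hf Hg; (split; first by move=> x; apply: differentiableM; [exact: (Cn_diff x Hf)|exact: (Cn_diff x Hg)]) => //.
move=> i; rewrite (_ : partial i _ = fun x => f x * partial i g x + g x * partial i f x).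
  have Hf' := Cn_partial i Hf; have Hg' := Cn_partial i Hg.
  by apply: Cn_add; apply: IH => //; exact: Cn_le.
apply/funext => x; apply: partial_is_derive.
by apply: is_deriveM; apply: is_derive_partial; [exact: (Cn_diff x Hf)|exact: (Cn_diff x Hg)].
Qed.

Lemma Cn_powR n f c : (forall x, 0 < f x) -> Cn n f -> Cn n (fun x => f x `^ c).
Proof.
move=> f0.
have D x : differentiable f x -> differentiable (fun x => f x `^ c) x.
  move=> H; apply: (differentiable_comp (g := fun u => u `^ c)) => //.
  by apply/derivable1_diffP; have [] := is_derive_powR c (f0 x).
elim: n f c f0 D => [|n IH] f c f0 D Hf; (split; first by move=> x; apply: D; exact: (Cn_diff x Hf)) => //.
move=> i; rewrite (_ : partial i _ = fun x => c * (f x `^ (c - 1)) * partial i f x).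
  apply: Cn_mul; last exact: Cn_partial.
  apply: Cn_mul; first exact: Cn_cst.
  apply: IH => //; last exact: Cn_le.
  move=> x H; apply: (differentiable_comp (g := fun u => u `^ (c - 1))) => //.
  by apply/derivable1_diffP; have [] := is_derive_powR (c - 1) (f0 x).
apply/funext => x; apply: partial_is_derive.
apply: (is_derive_comp_dir (f := fun u => u `^ c)); first exact: is_derive_powR.
by apply: is_derive_partial; exact: (Cn_diff x Hf).
Qed.

(** [trunc] is positive on the whole line, so its real powers are smooth even where f vanishes or is
    negative. *)
Lemma smooth_trunc_powR (e a c : R) f : 0 < e -> 0 < a -> smooth f ->
  smooth (fun x => trunc e a (f x) `^ c).
Proof.
move=> e0 a0 /smoothP sf; apply/smoothP => n; apply: Cn_powR => [x|]; first exact: trunc_gt0.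
have H (b : R) : Cn n (fun x => hypot e (f x + b)).
  apply: Cn_powR => [x|]; first exact: hypot_arg.
  have Hb : Cn n (fun x => f x + b) by apply: Cn_add => //; exact: Cn_cst.
  rewrite (_ : (fun x => _) = fun x => (f x + b) * (f x + b) + e ^+ 2); last by apply/funext => x; rewrite expr2.
  by apply: Cn_add; [exact: Cn_mul|exact: Cn_cst].
rewrite (_ : (fun x => _) = fun x => (a + hypot e (f x + 0) + (-1) * hypot e (f x + (- a))) * 2^-1); last first.
  by apply/funext => x; rewrite /trunc addr0 mulN1r.
apply: Cn_mul; last exact: Cn_cst.
apply: Cn_add; first by apply: Cn_add => //; exact: Cn_cst.
by apply: Cn_mul => //; exact: Cn_cst.
Qed.

End smooth_calculus.

Section profile.
Context {R : realType}.
Variables (e a q : R).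
Hypotheses (e0 : 0 < e) (a0 : 0 < a) (q2 : 2 <= q).
Local Notation T := (trunc e a).
Local Notation dT := (dtrunc e a).

(* The weak Poincare inequality is applied to psi (f), and pp (f) is paired with the
   generator; the constant cq is chosen so that dpsi ^ 2 <= dpp. *)
Definition cq := q ^+ 2 / (4 * (q - 1)).
Definition psi x := T x `^ (q / 2).
Definition dpsi x := q / 2 * T x `^ (q / 2 - 1) * dT x.
Definition pp x := cq * T x `^ (q - 1).
Definition dpp x := q ^+ 2 / 4 * T x `^ (q - 2) * dT x.

Let q0 : 0 <= q. Proof. by have := q2; lra. Qed.
Let T0 x : 0 < T x := trunc_gt0 e0 a0 x.
Let Ta x : T x <= a. Proof. exact: ltW (trunc_lt e0 a0 x). Qed.
Let cq0 : 0 <= cq. Proof. by rewrite divr_ge0 ?sqr_ge0// mulr_ge0//; have := q2; lra. Qed.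

Lemma is_derive_psi x : is_derive x (1 : R) psi (dpsi x).
Proof. exact: (is_derive_powR_comp (q / 2) T0 (is_derive_trunc a e0 x)). Qed.

Lemma is_derive_pp x : is_derive x (1 : R) pp (dpp x).
Proof.
have H := is_derive_powR_comp (q - 1) T0 (is_derive_trunc a e0 x).
have := is_deriveZ cq H; rewrite (_ : cq *: _ = dpp x)//.
rewrite /GRing.scale/= /dpp /cq (_ : q - 1 - 1 = q - 2); last by ring.
by have := q2; move=> q2'; field; apply/eqP; lra.
Qed.

Lemma continuous_T : continuous T.
Proof. exact: is_derive_continuous (is_derive_trunc a e0). Qed.

Lemma continuous_dpp : continuous dpp.
Proof.
apply: continuous_mul; last exact: continuous_dtrunc.
apply: continuous_mul; first exact: continuous_const.
by apply: powR_continuous => //; exact: continuous_T.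
Qed.

Lemma powT_le c x : 0 <= c -> T x `^ c <= a `^ c.
Proof. by move=> c0; rewrite ge0_ler_powR// nnegrE ltW. Qed.

Lemma dpsi_dpp x : dpsi x ^+ 2 <= dpp x.
Proof.
rewrite /dpsi /dpp 2!exprMn.
have -> : (T x `^ (q / 2 - 1)) ^+ 2 = T x `^ (q - 2).
  rewrite expr2 -powRD; first by congr (_ `^ _); field.
  by rewrite (gt_eqF (T0 x)) implybT.
have -> : (q / 2) ^+ 2 = q ^+ 2 / 4 by field.
rewrite ler_wpM2l//; first by rewrite mulr_ge0 ?powR_ge0// divr_ge0 ?sqr_ge0.
by rewrite expr2 ler_piMr ?dtrunc_ge0 ?dtrunc_le1.
Qed.

Lemma dpp_bnd x : 0 <= dpp x <= q ^+ 2 / 4 * a `^ (q - 2).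
Proof.
have q4 : 0 <= q ^+ 2 / 4 by rewrite divr_ge0 ?sqr_ge0.
apply/andP; split; first by rewrite mulr_ge0 ?dtrunc_ge0// mulr_ge0 ?powR_ge0.
rewrite -[leRHS]mulr1; apply: ler_pM; rewrite ?dtrunc_ge0 ?dtrunc_le1 ?(mulr_ge0 q4) ?powR_ge0//.
by apply: ler_wpM2l => //; apply: powT_le; have := q2; lra.
Qed.

Lemma pp_bnd x : 0 <= pp x <= cq * a `^ (q - 1).
Proof. apply/andP; split; first by rewrite mulr_ge0 ?powR_ge0.
by rewrite /pp ler_wpM2l// powT_le//; have := q2; lra. Qed.

Lemma psi_bnd x : 0 <= psi x <= a `^ (q / 2).
Proof. by rewrite powR_ge0 powT_le//; have := q2; lra. Qed.

Lemma pp_lip x y : `|pp x - pp y| <= q ^+ 2 / 4 * a `^ (q - 2) * `|x - y|.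
Proof. by apply: (derive_lipschitz is_derive_pp) => z; have /andP[? ?] := dpp_bnd z; rewrite ger0_norm. Qed.

Lemma psi_lip x y : `|psi x - psi y| <= q / 2 * a `^ (q / 2 - 1) * `|x - y|.
Proof.
apply: (derive_lipschitz is_derive_psi) => z.
have q20 : 0 <= q / 2 by have := q2; lra.
rewrite ger0_norm; last by rewrite mulr_ge0 ?dtrunc_ge0// mulr_ge0 ?powR_ge0.
rewrite -[leRHS]mulr1; apply: ler_pM; rewrite ?dtrunc_ge0 ?dtrunc_le1 ?(mulr_ge0 q20) ?powR_ge0//.
by apply: ler_wpM2l => //; apply: powT_le; have := q2; lra.
Qed.

Lemma pp_nd : {homo pp : x y / x <= y}.
Proof. by apply: (derive_nondecreasing is_derive_pp) => x; have /andP[] := dpp_bnd x. Qed.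

Lemma continuous_pp : continuous pp. Proof. exact: is_derive_continuous is_derive_pp. Qed.

(* Je is a primitive of cq (x + e)^(q - 1), which dominates pp on x >= 0. *)
Definition Je x := cq / q * (x + e) `^ q.

Lemma is_derive_Je x : - e < x -> is_derive x (1 : R) Je (cq * (x + e) `^ (q - 1)).
Proof.
move=> ex; have xe : 0 < x + e by lra.
have Hs : is_derive x (1 : R) (fun y : R => y + e) 1.
  by rewrite -[X in is_derive _ _ _ X]addr0; exact: is_deriveD.
have H := is_derive_comp_dir (f := fun u => u `^ q) (g := fun y : R => y + e) (is_derive_powR q xe) Hs.
have := is_deriveZ (cq / q) H; rewrite (_ : _ *: _ = cq * (x + e) `^ (q - 1))//.
by have := q2; rewrite /GRing.scale/= => q2'; field; apply/eqP; lra.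
Qed.

Lemma trunc_le x : 0 <= x -> T x <= x + e.
Proof.
move=> x0; have := trunc_min a e0 x0; rewrite ler_norml => /andP[_ H].
have : Num.min x a <= x by rewrite ge_min lexx.
by lra.
Qed.

(** The derivative is q^2/4 ((x+e)^(q-2) - T^(q-2) dT), nonnegative because T <= x + e and dT <= 1.
    It makes [Je] minus the primitive of [pp] convex on the half-line. *)
Lemma dJ_nd (x y : R) : 0 <= x -> x <= y ->
  cq * (x + e) `^ (q - 1) - pp x <= cq * (y + e) `^ (q - 1) - pp y.
Proof.
move=> x0 xy; have e0' := e0; have q2' := q2.
pose F z := cq * (z + e) `^ (q - 1) - pp z.
pose dF z := q ^+ 2 / 4 * (z + e) `^ (q - 2) - dpp z.
have HF (z : R) : x <= z <= y -> is_derive z (1 : R) F (dF z).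
  move=> /andP[xz _]; apply: is_deriveB; last exact: is_derive_pp.
  have ze : 0 < z + e by lra.
  have Hs : is_derive z (1 : R) (fun y : R => y + e) 1.
    by rewrite -[X in is_derive _ _ _ X]addr0; exact: is_deriveD.
  have H := is_derive_comp_dir (f := fun u => u `^ (q - 1)) (g := fun y : R => y + e) (is_derive_powR (q - 1) ze) Hs.
  have := is_deriveZ cq H; rewrite (_ : cq *: _ = q ^+ 2 / 4 * (z + e) `^ (q - 2))//.
  rewrite /GRing.scale/= /cq (_ : q - 1 - 1 = q - 2); last by ring.
  by field; apply/eqP; lra.
have [c /andP[xc cy] E] := mean_value HF xy.
rewrite -subr_ge0 -/(F y) -/(F x) E mulr_ge0 ?subr_ge0//.
have q4 : 0 <= q ^+ 2 / 4 by rewrite divr_ge0 ?sqr_ge0.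
have c0 := le_trans x0 xc.
apply: le_trans (_ : _ <= q ^+ 2 / 4 * T c `^ (q - 2) * 1) _.
  by rewrite ler_wpM2l ?dtrunc_le1// mulr_ge0 ?powR_ge0.
rewrite mulr1; apply: ler_wpM2l => //; apply: powR_le; [|exact: ltW|exact: trunc_le].
by rewrite subr_ge0.
Qed.

Lemma profile_convex : exists phi : R -> R, [/\ measurable_fun setT phi,
  forall x y, pp y * (x - y) <= phi x - phi y,
  forall y, 0 <= y -> 0 <= Je y - phi y &
  forall x y, 0 <= x -> 0 <= y ->
    Je x - phi x + (cq * (x + e) `^ (q - 1) - pp x) * (y - x) <= Je y - phi y].
Proof.
have [phi [phi0 Hphi]] := convex_primitive continuous_pp pp_nd.
have Hd x := subgrad_is_derive continuous_pp x Hphi.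
have HJ (x : R) : - e < x -> is_derive x (1 : R) (Je \- phi) (cq * (x + e) `^ (q - 1) - pp x).
  by move=> ex; apply: is_deriveB; exact: is_derive_Je.
have e0' := e0; have q2' := q2.
have C : forall x y : R, 0 <= x -> 0 <= y ->
    Je x - phi x + (cq * (x + e) `^ (q - 1) - pp x) * (y - x) <= Je y - phi y.
  have Ne : - e < 0 by lra.
  exact: (derive_convex Ne HJ dJ_nd).
exists phi; split => //.
  by apply: continuous_measurable_fun; exact: is_derive_continuous Hd.
(* Nonnegativity, which [jensen] asks for, comes from the tangent at 0, whose value and slope are
   both nonnegative. *)
move=> y y0; apply: le_trans (C 0 y _ y0); rewrite // phi0 !subr0 add0r.
apply: addr_ge0; first by rewrite /Je mulr_ge0 ?powR_ge0// divr_ge0.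
apply: mulr_ge0 => //; rewrite subr_ge0 /pp; apply: ler_wpM2l => //; apply: powR_le; [lra|exact: ltW|].
by rewrite -[leRHS]add0r; exact: trunc_le.
Qed.

Lemma psi_min x : 0 <= x ->
  `|psi x - (Num.min x a) `^ (q / 2)| <= q / 2 * a `^ (q / 2 - 1) * e.
Proof.
move=> x0; have q2' := q2; have ha := ltW a0.
apply: le_trans (powR_lip (a := a) (c := q / 2) _ _ _) _; first lra.
- by rewrite ltW ?Ta// T0.
- by rewrite ge_min lexx orbT le_min x0 ha.
by apply: ler_wpM2l; [rewrite mulr_ge0 ?powR_ge0//; lra|exact: trunc_min].
Qed.

End profile.

(** * Dissipation through the weak Poincare inequality *)

Section variance.
Context d (T : measurableType d) (R : realType) (mu : probability T R).
Implicit Types f g : T -> R.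

Definition vr f := ip mu f f - ip mu f (cst 1) ^+ 2.

Lemma variance_vr f : L2 mu f -> ('V_mu[f] = (vr f)%:E)%E.
Proof.
move=> lf; rewrite varianceE//.
have E1 : ('E_mu[f] = (ip mu f (cst 1))%:E)%E.
  rewrite unlock /ip /Rintegral fineK; last first.
    by apply: integrable_fin_num => //; exact: (L2_int_mul lf (L2_cst mu 1)).
  by apply: eq_integral => x _; rewrite mulr1.
have E2 : ('E_mu[f ^+ 2] = (ip mu f f)%:E)%E.
  rewrite unlock /ip /Rintegral fineK; last first.
    by apply: integrable_fin_num => //; exact: (L2_int_mul lf lf).
  by apply: eq_integral => x _; rewrite -expr2.
by rewrite E1 E2.
Qed.

Lemma n2_bnd f M : measurable_fun setT f -> (forall x, `|f x| <= M) -> n2 mu f <= M.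
Proof.
move=> mf fM; have M0 := le_trans (normr_ge0 _) (fM point).
rewrite -[leRHS](ger0_norm M0) -(n2_cst mu M); apply: n2_le; [exact: (L2_bnd mu mf fM)|exact: L2_cst|].
by move=> x; rewrite /= (ger0_norm M0).
Qed.

(** Each of the two terms of the variance is quadratic in inputs bounded by M and moves by at most 2
    M e. *)
Lemma vr_close f g M e : measurable_fun setT f -> measurable_fun setT g ->
  (forall x, `|f x| <= M) -> (forall x, `|g x| <= M) -> n2 mu (f \- g) <= e ->
  `|vr f - vr g| <= 4 * M * e.
Proof.
move=> mf mg fM gM fg.
have lf := L2_bnd mu mf fM; have lg := L2_bnd mu mg gM.
have nf := n2_bnd mf fM; have ng := n2_bnd mg gM.
have l1 : L2 mu (cst 1) by exact: L2_cst.
have n1 : n2 mu (cst 1) = 1 by rewrite n2_cst normr1.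
have M0 := le_trans (n2_ge0 mu f) nf.
have e0 := le_trans (n2_ge0 mu _) fg.
have H1 : `|ip mu f f - ip mu g g| <= 2 * M * e.
  apply: le_trans (ip_close lf lg lf lg) _.
  have : n2 mu (f \- g) * n2 mu f <= e * M by rewrite ler_pM ?n2_ge0.
  have : n2 mu g * n2 mu (f \- g) <= M * e by rewrite ler_pM ?n2_ge0.
  by lra.
have H2 : `|ip mu f (cst 1) - ip mu g (cst 1)| <= e.
  rewrite -ipBl//; apply: le_trans (CS (L2B lf lg) l1) _.
  by rewrite n1 mulr1.
have If : `|ip mu f (cst 1)| <= M by apply: le_trans (CS lf l1) _; rewrite n1 mulr1.
have Ig : `|ip mu g (cst 1)| <= M by apply: le_trans (CS lg l1) _; rewrite n1 mulr1.
have H3 : `|ip mu f (cst 1) ^+ 2 - ip mu g (cst 1) ^+ 2| <= 2 * M * e.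
  rewrite subr_sqr normrM mulrC; apply: ler_pM => //.
  by apply: le_trans (ler_normD _ _) _; lra.
rewrite /vr; move: H1 H3; rewrite !ler_norml => /andP[? ?] /andP[? ?]; apply/andP; split; lra.
Qed.

End variance.

Section wpi.
Context {R : realType} {d : nat}.
Variables (V : 'rV[R]_d -> R) (k : R -> R.-pker 'rV[R]_d ~> 'rV[R]_d).
Variable pi : probability 'rV[R]_d R.
Hypothesis hV : C1 V.
Hypothesis hpi : gibbs V pi.
Hypothesis hk : langevin_transition V k.
Hypothesis hsemi : L2_contraction_semigroup k pi.
Hypothesis hcore : smooth_core V k pi.
Variable beta : R -> R.
Hypothesis hwpi : weak_poincare pi beta (fun f => (osc f ^+ 2)%E).
Local Notation T := 'rV[R]_d.
Local Notation S := (semigroup k).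
Local Notation L2 := (L2 pi).
Local Notation n2 := (n2 pi).
Local Notation ip := (ip pi).
Local Notation vr := (vr pi).

Lemma osc_sqr_le (f : T -> R) c : (forall x, 0 <= f x <= c) -> (osc f ^+ 2 <= (c ^+ 2)%:E)%E.
Proof.
move=> H.
have I0 : (0 <= ereal_inf (range (EFin \o f)))%E.
  by apply/ereal_infP => _ [x _ <-]; rewrite lee_fin; have /andP[] := H x.
have Sc : (ereal_sup (range (EFin \o f)) <= c%:E)%E.
  by apply/ereal_supP => _ [x _ <-]; rewrite lee_fin; have /andP[] := H x.
have I1 : (ereal_inf (range (EFin \o f)) <= (f 0)%:E)%E by apply: ereal_inf_lbound; exists 0.
have S1 : ((f 0)%:E <= ereal_sup (range (EFin \o f)))%E by apply: ereal_sup_ubound; exists 0.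
have Ifin : ereal_inf (range (EFin \o f)) \is a fin_num.
  by rewrite ge0_fin_numE//; apply: le_lt_trans I1 _; rewrite ltry.
have o0 : (0 <= osc f)%E.
  by rewrite /osc sube_ge0; [exact: le_trans I1 S1|rewrite Ifin].
have oc : (osc f <= c%:E)%E.
  rewrite /osc -[leRHS]sube0; exact: leeB.
by rewrite expe2 expr2 EFinM; apply: lee_pmul.
Qed.

Variables (e a q : R).
Hypotheses (e0 : 0 < e) (a0 : 0 < a) (q2 : 2 <= q).
Local Notation ps := (psi e a q).
Local Notation p := (pp e a q).

Lemma measurable_psi (f : T -> R) : measurable_fun setT f -> measurable_fun setT (fun x => ps (f x)).
Proof.
move=> mf; apply: measurableT_comp => //; apply: continuous_measurable_fun.
exact: is_derive_continuous (is_derive_psi q e0 a0).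
Qed.

Lemma measurable_pp (f : T -> R) : measurable_fun setT f -> measurable_fun setT (fun x => p (f x)).
Proof.
move=> mf; apply: measurableT_comp => //; apply: continuous_measurable_fun.
exact: continuous_pp.
Qed.

Lemma psi_norm x : `|ps x| <= a `^ (q / 2).
Proof. by have /andP[h0 h1] := psi_bnd e0 a0 q2 x; rewrite ger0_norm. Qed.

Lemma pp_norm x : `|p x| <= cq q * a `^ (q - 1).
Proof. by have /andP[h0 h1] := pp_bnd e0 a0 q2 x; rewrite ger0_norm. Qed.

Lemma L2_psi f : L2 f -> L2 (fun x => ps (f x)).
Proof. by move=> lf; apply: (@L2_bnd _ _ _ _ _ (a `^ (q / 2))); [exact: measurable_psi (L2_meas lf)|move=> x; exact: psi_norm]. Qed.

Lemma L2_pp f : L2 f -> L2 (fun x => p (f x)).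
Proof. by move=> lf; apply: (@L2_bnd _ _ _ _ _ (cq q * a `^ (q - 1))); [exact: measurable_pp (L2_meas lf)|move=> x; exact: pp_norm]. Qed.

(** Write |grad psi(h)|^2 = dpsi(h)^2 |grad h|^2 <= dpp(h) |grad h|^2 = grad pp(h) . grad h, whose
    integral is minus that of pp(h) L h by parts. Boundedness of [psi] makes the oscillation term at
    most s a^q. *)
Lemma wpi_smooth h s : smooth h -> L2 h -> L2 (langevin_op V h) -> 0 < s ->
  vr (fun x => ps (h x)) - s * (a `^ (q / 2)) ^+ 2 <=
  beta s * - ip (fun x => p (h x)) (langevin_op V h).
Proof.
move=> sh lh lLh s0.
have sps : smooth (fun x => ps (h x)) by exact: smooth_trunc_powR.
have ch := smooth_cont sh.
have cph i : continuous (partial i h) by exact/smooth_cont/smooth_partial.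
have lph i : L2 (partial i h) by exact: (grad_L2 hV hpi sh lh lLh).
pose dv i x := dpp e a q (h x) * partial i h x.
have cdv i : continuous (dv i).
  by apply: continuous_mul => //; apply: continuous_postcomp => //; exact: continuous_dpp.
have ldv i : L2 (dv i).
  apply: (@L2_le _ _ _ _ _ ((q ^+ 2 / 4 * a `^ (q - 2)) \*o partial i h)).
  - exact: continuous_rV_measurable.
  - exact: L2Z.
  - move=> x; rewrite /dv /= normrM [leRHS]normrM ler_wpM2r//.
    have /andP[h0 h1] := dpp_bnd e0 a0 q2 (h x).
    by rewrite (ger0_norm h0) (le_trans h1) ?ler_norm.
have cv : continuous (fun x => p (h x)) by apply: continuous_postcomp => //; exact: continuous_pp.
have dvP i x : is_derive x (delta_mx ord0 i) (fun x => p (h x)) (dv i x).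
  exact: (is_derive_comp_dir (f := p) (g := h) (is_derive_pp e0 a0 q2 (h x))
    (is_derive_partial i (sh [::] x))).
rewrite (ibp_L2 hV hpi sh lh lLh cv cdv dvP (L2_pp lh) ldv) opprK.
have := wpi_inequality hwpi sps (L2_psi lh) s0.
rewrite variance_vr; last exact: L2_psi.
have -> : \sum_i ip (dv i) (partial i h) = \int[pi]_x (\sum_i dv i x * partial i h x).
  by rewrite Rintegral_sum// => i; exact: (L2_int_mul (ldv i) (lph i)).
set I := \int[pi]_x _.
have iI : pi.-integrable setT (EFin \o (fun x => \sum_i dv i x * partial i h x)).
  rewrite (_ : _ \o _ = fun x => \sum_(i < d) (dv i x * partial i h x)%:E)%E; last first.
    by apply/funext => x; rewrite /= sumEFin.
  by apply: integrable_sum => // i _; exact: (L2_int_mul (ldv i) (lph i)).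
move=> H.
have HI : (\int[pi]_x (dotp (grad (fun x => ps (h x)) x) (grad (fun x => ps (h x)) x))%:E <= I%:E)%E.
  rewrite /I /Rintegral fineK; last exact: integrable_fin_num.
  apply: ge0_le_integral => //.
  - move=> x _; rewrite lee_fin; apply: sumr_ge0 => i _; rewrite -expr2; exact: sqr_ge0.
  - apply/measurable_EFinP; apply: continuous_rV_measurable.
    apply: continuous_bigsum => i; have c : continuous (fun x => grad (fun x => ps (h x)) x ord0 i).
      have -> : (fun y => grad (fun x => ps (h x)) y ord0 i) = partial i (fun x => ps (h x)) by apply/funext => y; rewrite /grad mxE.
      exact/smooth_cont/smooth_partial.
    exact: continuous_mul.
  - exact: (measurable_int pi iI).
  - move=> x _; rewrite lee_fin; apply: ler_sum => i _; rewrite gradE.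
    have -> : partial i (fun x => ps (h x)) x = dpsi e a q (h x) * partial i h x; last first.
      by rewrite /dv -[leRHS]mulrA -!expr2 exprMn ler_wpM2r ?sqr_ge0// dpsi_dpp.
      apply: partial_is_derive.
      apply: (is_derive_comp_dir (f := ps) (g := h)); first exact: is_derive_psi.
      by apply: is_derive_partial; exact: (sh [::]).
have b0 := wpi_weight_ge0 hwpi s0.
have H2 : ((vr (fun x => ps (h x)))%:E <= (beta s)%:E * I%:E + s%:E * ((a `^ (q / 2)) ^+ 2)%:E)%E.
  apply: le_trans H _; apply: leeD.
    by apply: lee_wpmul2l => //; rewrite lee_fin.
  apply: lee_wpmul2l; first by rewrite lee_fin ltW.
  by apply: osc_sqr_le => x; exact: psi_bnd.
by rewrite lerBlDr -lee_fin; exact: H2.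
Qed.

Let cA := a `^ (q / 2).
Let Mp := cq q * a `^ (q - 1).
Let Lp := q ^+ 2 / 4 * a `^ (q - 2).
Let Ls := q / 2 * a `^ (q / 2 - 1).
Let q0 : 0 <= q. Proof. by have := q2; lra. Qed.
Let cA0 : 0 <= cA. Proof. exact: powR_ge0. Qed.
Let Mp0 : 0 <= Mp. Proof. exact: le_trans (normr_ge0 _) (pp_norm 0). Qed.
Let Lp0 : 0 <= Lp. Proof. by rewrite mulr_ge0 ?powR_ge0// divr_ge0 ?sqr_ge0. Qed.
Let Ls0 : 0 <= Ls. Proof. by rewrite mulr_ge0 ?powR_ge0// divr_ge0. Qed.

Lemma n2_lip (G : R -> R) L f g : 0 <= L -> (forall x y, `|G x - G y| <= L * `|x - y|) ->
  L2 f -> L2 g -> L2 (fun x => G (f x)) -> L2 (fun x => G (g x)) ->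
  n2 ((fun x => G (f x)) \- (fun x => G (g x))) <= L * n2 (f \- g).
Proof.
move=> L0 HG lf lg lGf lGg; have lfg := L2B lf lg.
rewrite -[X in X * _](ger0_norm L0) -n2Z//; apply: n2_le; [exact: L2B|exact: L2Z|].
by move=> x /=; rewrite normrM (ger0_norm L0).
Qed.

Lemma psi_close f g r : L2 f -> L2 g -> n2 (f \- g) <= r ->
  `|vr (fun x => ps (f x)) - vr (fun x => ps (g x))| <= 4 * cA * (Ls * r).
Proof.
move=> lf lg fg.
apply: vr_close.
- exact: measurable_psi (L2_meas lf).
- exact: measurable_psi (L2_meas lg).
- by move=> x; exact: psi_norm.
- by move=> x; exact: psi_norm.
apply: le_trans (n2_lip Ls0 (psi_lip e0 a0 q2) lf lg (L2_psi lf) (L2_psi lg)) _.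
exact: ler_wpM2l.
Qed.

Lemma le_of_small_error (x y C : R) : 0 <= C -> (forall r, 0 < r -> r <= 1 -> x <= y + r * C) -> x <= y.
Proof.
move=> C0 H; apply/ler_addgt0Pr => r r0.
have C1 : 0 < 1 + C by lra.
have e1 : 0 < Num.min 1 (r / (1 + C)) by rewrite lt_min ltr01 divr_gt0.
apply: le_trans (H _ e1 _) _; first by rewrite ge_min lexx.
rewrite lerD2l; apply: le_trans (_ : _ <= r / (1 + C) * C) _.
  by apply: ler_wpM2r => //; rewrite ge_min lexx orbT.
by rewrite -mulrA ler_piMr ?(ltW r0)// mulrC ler_pdivrMr// mul1r; lra.
Qed.

(** [psi] and [pp] are bounded and Lipschitz, so both sides are continuous for the graph norm and
    the core suffices. *)
Lemma wpi_gen f g s : L2_generator k pi f g -> 0 < s ->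
  vr (fun x => ps (f x)) - s * cA ^+ 2 <= beta s * - ip (fun x => p (f x)) g.
Proof.
move=> G s0; have [lf lg _] := G; have b0 := wpi_weight_ge0 hwpi s0.
have C0 : 0 <= 4 * cA * Ls + beta s * (Lp * n2 g + Mp).
  by apply: addr_ge0; apply: mulr_ge0 => //; [apply: mulr_ge0|apply: addr_ge0 => //; apply: mulr_ge0 => //; exact: n2_ge0].
apply: (le_of_small_error C0) => r r0 r1.
have [h [sh Gh H1 H2]] := core_approx hcore G r0; have [lh lLh _] := Gh.
have := wpi_smooth sh lh lLh s0 => Hw.
have := psi_close lf lh H1; rewrite ler_norml => /andP[_ Hv].
have Hi : `|ip (fun x => p (f x)) g - ip (fun x => p (h x)) (langevin_op V h)| <= r * (Lp * n2 g + Mp).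
  apply: le_trans (ip_close (L2_pp lf) (L2_pp lh) lg lLh) _.
  rewrite mulrDr; apply: lerD.
    rewrite [X in _ <= X](_ : _ = Lp * r * n2 g); last by ring.
    apply: ler_wpM2r; first exact: n2_ge0.
    apply: le_trans (n2_lip Lp0 (pp_lip e0 a0 q2) lf lh (L2_pp lf) (L2_pp lh)) _.
    exact: ler_wpM2l.
  rewrite mulrC; apply: ler_pM => //; try exact: n2_ge0.
  by apply: n2_bnd; [exact: measurable_pp (L2_meas lh)|move=> x; exact: pp_norm].
have {}Hi := ler_wpM2l b0 (le_trans (ler_norm _) Hi).
rewrite -/cA in Hw; move: Hv Hi Hw.
generalize (vr (fun x => ps (f x))) (vr (fun x => ps (h x))) (ip (fun x => p (f x)) g)
  (ip (fun x => p (h x)) (langevin_op V h)) (s * cA ^+ 2) (beta s) (n2 g) cA Ls Lp Mp.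
move=> *; lra.
Qed.

Variable phi : R -> R.
Hypothesis mphi : measurable_fun setT phi.
Hypothesis phi_sub : forall x y, p y * (x - y) <= phi x - phi y.

(** The subgradients are bounded by Mp; hence [phi] grows at most linearly and maps L2 into L2. *)
Lemma phi_lip x y : `|phi x - phi y| <= Mp * `|x - y|.
Proof.
have B z w : p z * w <= Mp * `|w|.
  by apply: le_trans (ler_norm _) _; rewrite normrM ler_wpM2r// pp_norm.
have H z w : phi z - phi w <= Mp * `|z - w|.
  have H1 := phi_sub w z; have H2 := B z (z - w).
  by rewrite -opprB mulrN -[phi w - _]opprB lerN2 in H1; exact: le_trans H1 H2.
by apply/ler_normlP; split; [rewrite opprB distrC|]; exact: H.
Qed.

Lemma L2_phi f : L2 f -> L2 (fun x => phi (f x)).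
Proof.
move=> lf; apply: (@L2_le _ _ _ _ _ (cst `|phi 0| \+ (Mp \*o (Num.norm \o f)))).
- exact: measurableT_comp (L2_meas lf).
- by apply: L2D; [exact: L2_cst|apply: L2Z; exact: L2_norm].
- move=> x /=; have H0 : 0 <= `|phi 0| + Mp * `|f x| by apply: addr_ge0 => //; exact: mulr_ge0.
  rewrite (ger0_norm H0).
  have := phi_lip (f x) 0; rewrite subr0 => H.
  by rewrite -[phi (f x)](subrK (phi 0)) addrC; apply: le_trans (ler_normD _ _) _; rewrite lerD2l.
Qed.

Local Notation I f := (ip (fun x => phi (f x)) (cst 1)).

Lemma int_phi_close f g : L2 f -> L2 g -> `|I f - I g| <= Mp * n2 (f \- g).
Proof.
move=> lf lg; have l1 : L2 (cst 1) by exact: L2_cst.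
have lF := L2_phi lf; have lG := L2_phi lg.
rewrite -ipBl//; apply: le_trans (CS (L2B lF lG) l1) _.
by rewrite n2_cst normr1 mulr1; exact: n2_lip phi_lip _ _ _ _.
Qed.

Lemma int_phi_sub f g : L2 f -> L2 g -> ip (fun x => p (g x)) (f \- g) <= I f - I g.
Proof.
move=> lf lg; have l1 : L2 (cst 1) by exact: L2_cst.
have lF := L2_phi lf; have lG := L2_phi lg.
rewrite -ipBl//; apply: le_Rintegral => //.
- exact: (L2_int_mul (L2_pp lg) (L2B lf lg)).
- exact: (L2_int_mul (L2B lF lG) l1).
- by move=> x _ /=; rewrite mulr1.
Qed.

(* Convexity of phi replaces a time derivative of the integral of phi (S t f). *)
Lemma int_phi_step f g s r dl : L2_generator k pi f g -> 0 < s -> 0 <= r ->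
  (forall t u, 0 < t -> t < dl -> 0 <= u -> n2 (dq k t (S u f) \- S (u + t) g) < r) ->
  forall u t, 0 <= u -> 0 < t -> t < dl ->
  t * (vr (fun x => ps (S (u + t) f x)) - s * cA ^+ 2 - beta s * Mp * r) <=
  beta s * (I (S u f) - I (S (u + t) f)).
Proof.
move=> G s0 r0 Hr u t u0 t0 tdl; have b0 := wpi_weight_ge0 hwpi s0.
have ut0 : 0 <= u + t by rewrite addr_ge0// ltW.
have [lf lg _] := G.
have Gt := gen_S hk hsemi ut0 G; have [lF' lG' _] := Gt.
have lF := S_L2 hsemi u0 lf.
set F := S u f in lF *; set F' := S (u + t) f in Gt lF' *; set G' := S (u + t) g in Gt lG' *.
have Hw := wpi_gen Gt s0.
have H1 := int_phi_sub lF lF'.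
have lq := dq_L2 hsemi (ltW t0) lF.
have aeq : {ae pi, forall x, (F \- F') x = ((- t) \*o dq k t F) x}.
  apply: filterS (S_semi hk hsemi (ltW t0) u0 lf) => x E /=.
  by rewrite /dq -/F -E (addrC t u) -/F' mulNr mulrC divfK ?gt_eqF// opprB.
have lpF' := L2_pp lF'.
have E1 : ip (fun x => p (F' x)) (F \- F') = - t * ip (fun x => p (F' x)) (dq k t F).
  rewrite ipC (ip_aeL (L2B lF lF') (L2Z (- t) lq) lpF' aeq) (ipZl (- t) lq lpF').
  by rewrite [ip (dq k t F) _]ipC.
have E2 : `|ip (fun x => p (F' x)) (dq k t F) - ip (fun x => p (F' x)) G'| <= Mp * r.
  rewrite -(ipBr lq lG' lpF'); apply: le_trans (CS lpF' (L2B lq lG')) _.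
  apply: ler_pM; try exact: n2_ge0.
    by apply: n2_bnd; [exact: measurable_pp (L2_meas lF')|move=> x; exact: pp_norm].
  by apply: ltW; exact: Hr.
have E3 : ip (fun x => p (F' x)) (dq k t F) <= ip (fun x => p (F' x)) G' + Mp * r.
  by rewrite -lerBlDl; exact: le_trans (ler_norm _) E2.
apply: le_trans (ler_wpM2l b0 H1); rewrite E1.
rewrite (_ : beta s * (- t * _) = t * (beta s * - ip (fun x => p (F' x)) (dq k t F))); last by ring.
apply: ler_wpM2l; first exact: ltW.
apply: le_trans (lerB Hw (lexx _)) _; rewrite -[beta s * Mp * r]mulrA -mulrBr.
by apply: ler_wpM2l => //; rewrite -opprD lerN2.
Qed.

Lemma telescope (b i1 i2 i3 n t c : R) : n * t * c <= b * (i1 - i2) ->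
  t * c <= b * (i2 - i3) -> (n + 1) * t * c <= b * (i1 - i3).
Proof.
move=> H1 H2; have -> : (n + 1) * t * c = n * t * c + t * c by ring.
have -> : b * (i1 - i3) = b * (i1 - i2) + b * (i2 - i3) by ring.
exact: lerD.
Qed.

Lemma int_phi_iter f g s r dl K : L2_generator k pi f g -> 0 < s -> 0 <= r ->
  (forall t u, 0 < t -> t < dl -> 0 <= u -> n2 (dq k t (S u f) \- S (u + t) g) < r) ->
  forall u t n, 0 <= u -> 0 < t -> t < dl ->
  (forall v, u <= v -> v <= u + n%:R * t -> K <= vr (fun x => ps (S v f x))) ->
  n%:R * t * (K - s * cA ^+ 2 - beta s * Mp * r) <=
  beta s * (I (S u f) - I (S (u + n%:R * t) f)).
Proof.
move=> G s0 r0 Hr u t n u0 t0 tdl.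
elim: n => [|n IH] HK; first by rewrite !mul0r addr0 subrr mulr0.
have nt : 0 <= n%:R * t by rewrite mulr_ge0// ltW.
have E : u + n.+1%:R * t = (u + n%:R * t) + t by rewrite -natr1; ring.
have H1 := int_phi_step G s0 r0 Hr (addr_ge0 u0 nt) t0 tdl.
have H2 : K <= vr (fun x => ps (S (u + n%:R * t + t) f x)).
  by apply: HK; rewrite -E// lerDl mulr_ge0// ltW.
have {}IH := IH (fun v h1 h2 => HK v h1 (le_trans h2 _)).
have {}IH : n%:R * t * (K - s * cA ^+ 2 - beta s * Mp * r) <= beta s * (I (S u f) - I (S (u + n%:R * t) f)).
  by apply: IH; rewrite E lerDl ltW.
have H3 : t * (K - s * cA ^+ 2 - beta s * Mp * r) <= t * (vr (fun x => ps (S (u + n%:R * t + t) f x)) - s * cA ^+ 2 - beta s * Mp * r).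
  by apply: ler_wpM2l; [exact: ltW|rewrite !lerD2r].
have H4 := le_trans H3 H1.
by rewrite E -natr1; exact: telescope IH H4.
Qed.

(** A uniform mesh below dl: the accumulated error of the difference quotients is proportional to
    (t2 - t1) r, and r is arbitrary. *)
Lemma int_phi_gen f g s K t1 t2 : L2_generator k pi f g -> 0 < s -> 0 <= t1 -> t1 < t2 ->
  (forall v, t1 <= v -> v <= t2 -> K <= vr (fun x => ps (S v f x))) ->
  (t2 - t1) * (K - s * cA ^+ 2) <= beta s * (I (S t1 f) - I (S t2 f)).
Proof.
move=> G s0 t10 t12 HK; have b0 := wpi_weight_ge0 hwpi s0.
have D0 : 0 < t2 - t1 by rewrite subr_gt0.
have C0 : 0 <= (t2 - t1) * (beta s * Mp) by apply: mulr_ge0; [exact: ltW|exact: mulr_ge0].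
apply: (le_of_small_error C0) => r r0 r1.
have [dl dl0 Hr] := gen_unif hk hsemi G r0.
have [N HN] := ltr_add_invr (divr_gt0 dl0 D0).
pose t := (t2 - t1) / N.+1%:R.
have t0 : 0 < t by rewrite divr_gt0.
have tdl : t < dl.
  by move: HN; rewrite add0r ltr_pdivlMr// mulrC.
have Nt : N.+1%:R * t = t2 - t1 by rewrite /t mulrC divfK// pnatr_eq0.
have E : t1 + N.+1%:R * t = t2 by rewrite Nt; ring.
have := int_phi_iter (K := K) G s0 (ltW r0) Hr t10 t0 tdl (n := N.+1).
rewrite E Nt => /(_ HK).
by generalize (I (S t1 f)) (I (S t2 f)) (beta s) Mp cA => *; lra.
Qed.

(** The domain of the generator is left here: contraction keeps the orbits of f and h within r of
    each other at all times, and both the variance of psi and the integral of phi are Lipschitz for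
    the L2 norm. *)
Lemma int_phi_dissipation h s K t1 t2 : L2 h -> 0 < s -> 0 <= t1 -> t1 < t2 ->
  (forall v, t1 <= v -> v <= t2 -> K <= vr (fun x => ps (S v h x))) ->
  (t2 - t1) * (K - s * cA ^+ 2) <= beta s * (I (S t1 h) - I (S t2 h)).
Proof.
move=> lh s0 t10 t12 HK; have b0 := wpi_weight_ge0 hwpi s0.
have D0 : 0 < t2 - t1 by rewrite subr_gt0.
have C0 : 0 <= (t2 - t1) * (4 * cA * Ls) + beta s * (2 * Mp).
  by apply: addr_ge0; apply: mulr_ge0 => //; [exact: ltW|apply: mulr_ge0 => //; exact: mulr_ge0|exact: mulr_ge0].
apply: (le_of_small_error C0) => r r0 r1.
have [f [g [G fh]]] := gen_dense hk hsemi lh r0; have [lf lg _] := G.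
have lS v : 0 <= v -> L2 (S v f) /\ L2 (S v h) by move=> v0; split; exact: S_L2.
have cl v : 0 <= v -> n2 (S v f \- S v h) <= r.
  by move=> v0; apply: le_trans (n2S_B hsemi v0 lf lh) fh.
have HI v : 0 <= v -> - (Mp * r) <= I (S v f) - I (S v h) <= Mp * r.
  move=> v0; rewrite -ler_norml; have [l1 l2] := lS v v0; apply: le_trans (int_phi_close l1 l2) _.
  by apply: ler_wpM2l => //; exact: cl.
have HK' v : t1 <= v -> v <= t2 -> K - 4 * cA * (Ls * r) <= vr (fun x => ps (S v f x)).
  move=> v1 v2; have v0 := le_trans t10 v1; have [l1 l2] := lS v v0.
  have := psi_close l1 l2 (cl v v0); rewrite ler_norml => /andP[H _].
  have := HK v v1 v2; move: H; generalize (vr (fun x => ps (S v f x))) (vr (fun x => ps (S v h x))) cA Ls.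
  by move=> *; lra.
have H := int_phi_gen G s0 t10 t12 HK'.
have /andP[A3 A4] := HI t1 t10; have /andP[A1 A2] := HI t2 (le_trans t10 (ltW t12)).
move: A1 A2 A3 A4 H b0.
generalize (I (S t1 f)) (I (S t2 f)) (I (S t1 h)) (I (S t2 h)) (beta s) Mp cA Ls => i1 i2 i3 i4 b M c L A1 A2 A3 A4 H b0.
have : b * (i1 - i2) <= b * (i3 - i4 + 2 * M * r).
  by apply: ler_wpM2l => //; lra.
by lra.
Qed.

End wpi.

Lemma dissipation_arith (R : realFieldType) (D K C1 e X b I G C2 : R) :
  D * (K - C1 * e - X) <= b * I -> b * I <= b * (G + e * C2) ->
  D * (K - X) <= b * G + e * (D * C1 + b * C2).
Proof. by move=> H1 H2; lra. Qed.

Section powR_shift.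
Context {R : realType}.
Implicit Types x e q : R.

Lemma powR_add1 x q : 0 <= x -> 0 <= q -> (x + 1) `^ q <= 2 `^ q * (x `^ q + 1).
Proof.
move=> x0 q0; have [x1|/ltW x1] := leP x 1.
  apply: le_trans (_ : _ <= 2 `^ q) _; first by apply: powR_le => //; lra.
  by rewrite ler_peMr ?powR_ge0// lerDr powR_ge0.
apply: le_trans (_ : _ <= (2 * x) `^ q) _; first by apply: powR_le => //; lra.
by rewrite powRM// ler_wpM2l ?powR_ge0// lerDl.
Qed.

(** The error is linear in e with weight x^q + 1, so the shift in [Je] disappears in the limit once
    the q-th moment is finite. *)
Lemma powR_shift x e q : 0 <= x -> 0 <= e -> e <= 1 -> 1 <= q ->
  (x + e) `^ q <= x `^ q + e * (q * 2 `^ q * (x `^ q + 1)).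
Proof.
move=> x0 e0 e1 q1.
have H := @powR_lip _ q (x + e) (x + e) x q1.
have {}H : `|(x + e) `^ q - x `^ q| <= q * (x + e) `^ (q - 1) * `|x + e - x|.
  by apply: H; rewrite ?lexx ?addr_ge0 ?x0 ?lerDl.
have {}H := le_trans (ler_norm _) H.
have E : `|x + e - x| = e by rewrite (_ : x + e - x = e) ?ger0_norm//; ring.
rewrite E in H.
have q0 : 0 <= q by lra.
have H2 : (x + e) `^ (q - 1) <= 2 `^ q * (x `^ q + 1).
  apply: le_trans (powR_add1 x0 q0).
  apply: le_trans (_ : _ <= (x + 1) `^ (q - 1)) _; first by apply: powR_le; lra.
  by rewrite ler_powR//; lra.
have H3 : q * (x + e) `^ (q - 1) * e <= e * (q * 2 `^ q * (x `^ q + 1)).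
  by rewrite mulrC -[q * 2 `^ q * _]mulrA; apply: ler_wpM2l => //; apply: ler_wpM2l.
lra.
Qed.

End powR_shift.

Section real_integrable.
Context d (T : measurableType d) (R : realType) (mu : {measure set T -> \bar R}).
Implicit Types f g : T -> R.

Lemma measurable_powRf f (c : R) : measurable_fun setT f -> measurable_fun setT (fun x => f x `^ c).
Proof. by move=> mf; exact: (@measurableT_comp _ _ _ _ _ _ (fun u : R => u `^ c) _ f (measurable_powR c) mf). Qed.

Lemma integrable_mulc (c : R) f : mu.-integrable setT (EFin \o f) ->
  mu.-integrable setT (EFin \o (fun x => c * f x)).
Proof. exact: (integrableZl measurableT c). Qed.

Lemma Rintegral_le_ereal f g : mu.-integrable setT (EFin \o f) -> mu.-integrable setT (EFin \o g) ->
  (\int[mu]_x (f x)%:E <= \int[mu]_x (g x)%:E)%E -> \int[mu]_x f x <= \int[mu]_x g x.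
Proof.
move=> fi gi H; rewrite -lee_fin /Rintegral (fineK (integrable_fin_num measurableT fi)).
by rewrite (fineK (integrable_fin_num measurableT gi)).
Qed.

Lemma integrable_add f g : mu.-integrable setT (EFin \o f) -> mu.-integrable setT (EFin \o g) ->
  mu.-integrable setT (EFin \o (fun x => f x + g x)).
Proof. exact: (integrableD measurableT). Qed.

Lemma integrable_sub f g : mu.-integrable setT (EFin \o f) -> mu.-integrable setT (EFin \o g) ->
  mu.-integrable setT (EFin \o (fun x => f x - g x)).
Proof. exact: (integrableB measurableT). Qed.

End real_integrable.

Section dissipation.
Context {R : realType} {d : nat}.
Variables (V : 'rV[R]_d -> R) (k : R -> R.-pker 'rV[R]_d ~> 'rV[R]_d).
Variable pi : probability 'rV[R]_d R.
Hypothesis hV : C1 V.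
Hypothesis hpi : gibbs V pi.
Hypothesis hk : langevin_transition V k.
Hypothesis hsemi : L2_contraction_semigroup k pi.
Hypothesis hcore : smooth_core V k pi.
Variable beta : R -> R.
Hypothesis hwpi : weak_poincare pi beta (fun f => (osc f ^+ 2)%E).
Local Notation T := 'rV[R]_d.
Local Notation S := (semigroup k).
Local Notation L2 := (L2 pi).
Local Notation n2 := (n2 pi).
Local Notation ip := (ip pi).
Local Notation vr := (vr pi).

Variables (q : R) (h : T -> R).
Hypotheses (q2 : 2 <= q) (lh : L2 h) (h0 : forall x, 0 <= h x).
Hypothesis ih : forall t, 0 <= t -> pi.-integrable setT (EFin \o (fun x => S t h x `^ q)).

Definition Fq t : R := \int[pi]_x (S t h x `^ q).

Lemma integrable_Je e t : 0 < e -> e <= 1 -> 0 <= t ->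
  pi.-integrable setT (EFin \o (fun x => Je e q (S t h x))) /\
  cq q / q * Fq t <= \int[pi]_x Je e q (S t h x) <= cq q / q * (Fq t + e * (q * 2 `^ q * (Fq t + 1))).
Proof.
move=> e0 e1 t0; have q2' := q2.
have St0 x : 0 <= S t h x by exact: S_ge0.
have mS : measurable_fun setT (S t h) by exact: L2_meas (S_L2 hsemi t0 lh).
have cq0 : 0 <= cq q / q.
  rewrite /cq divr_ge0//; last by lra.
  by rewrite divr_ge0 ?sqr_ge0// mulr_ge0//; lra.
have q0 : 0 <= q by lra.
have q1 : 1 <= q by lra.
pose G x := cq q / q * (e * (q * 2 `^ q) + (1 + e * (q * 2 `^ q)) * S t h x `^ q).
have GE x : G x = cq q / q * (S t h x `^ q + e * (q * 2 `^ q * (S t h x `^ q + 1))).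
  by rewrite /G; ring.
have JG x : Je e q (S t h x) <= G x.
  by rewrite GE /Je; apply: ler_wpM2l => //; apply: powR_shift => //; exact: ltW.
have J0 x : 0 <= Je e q (S t h x) by rewrite /Je mulr_ge0 ?powR_ge0.
have i1 : pi.-integrable setT (EFin \o (fun=> e * (q * 2 `^ q))) by exact: (L2_int (L2_cst pi _)).
have i2 : pi.-integrable setT (EFin \o (fun x => (1 + e * (q * 2 `^ q)) * S t h x `^ q)).
  exact: (integrable_mulc _ (ih t0)).
have i3 : pi.-integrable setT (EFin \o (fun x => e * (q * 2 `^ q) + (1 + e * (q * 2 `^ q)) * S t h x `^ q)).
  exact: (integrable_add i1 i2).
have iG : pi.-integrable setT (EFin \o G).
  exact: (integrable_mulc _ i3).
have iC : pi.-integrable setT (EFin \o (fun x => cq q / q * S t h x `^ q)).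
  exact: (integrable_mulc _ (ih t0)).
have mJ : measurable_fun setT (fun x => Je e q (S t h x)).
  rewrite /Je; apply: measurable_funM; first exact: measurable_cst.
  apply: measurable_powRf.
  by apply: measurable_funD => //; exact: measurable_cst.
have iJ : pi.-integrable setT (EFin \o (fun x => Je e q (S t h x))).
  apply: (le_integrable measurableT _ _ iG); first exact/measurable_EFinP.
  by move=> x _; rewrite /= lee_fin !ger0_norm// (le_trans (J0 x)).
split=> //; apply/andP; split.
  rewrite /Fq -(RintegralZl _ measurableT (ih t0)).
  apply: le_Rintegral => // x _; rewrite /Je; apply: ler_wpM2l => //.
  by apply: powR_le => //; lra.
apply: le_trans (le_Rintegral measurableT iJ iG (fun x _ => JG x)) _.
have -> : \int[pi]_x G x = cq q / q * (e * (q * 2 `^ q) + (1 + e * (q * 2 `^ q)) * Fq t).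
  rewrite /G (RintegralZl (cq q / q) measurableT i3); congr (_ * _).
  apply: (etrans (RintegralD measurableT i1 i2)).
  rewrite (RintegralZl _ measurableT (ih t0)) Rintegral_cst//.
  rewrite (_ : fine _ = 1); first by rewrite mulr1.
  by transitivity (fine (1%E : \bar R)) => //; congr fine; exact: probability_setT.
by rewrite le_eqVlt; apply/orP; left; apply/eqP; ring.
Qed.

(** At a fixed level a, letting e tend to 0 turns [psi] into the power q/2 of the minimum with a,
    and [Je] into a multiple of the q-th power; the truncation survives only on the left-hand
    side. *)
Lemma dissipation a s K t1 t2 : 0 < a -> 0 < s -> 0 <= t1 -> t1 < t2 ->
  (forall v, t1 <= v -> v <= t2 -> K <= vr (fun x => (Num.min (S v h x) a) `^ (q / 2))) ->
  (t2 - t1) * (K - s * a `^ q) <= beta s * (cq q / q * (Fq t1 - Fq t2)).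
Proof.
move=> a0 s0 t10 t12 HK; have b0 := wpi_weight_ge0 hwpi s0; have q2' := q2.
have t20 : 0 <= t2 by lra.
have D0 : 0 < t2 - t1 by lra.
have aq : a `^ q = (a `^ (q / 2)) ^+ 2.
  rewrite expr2 -powRD; first by congr (_ `^ _); field.
  by rewrite (gt_eqF a0) implybT.
have F10 : 0 <= Fq t1 by apply: Rintegral_ge0 => x _; exact: powR_ge0.
have cq0 : 0 <= cq q / q.
  rewrite /cq divr_ge0//; last by lra.
  by rewrite divr_ge0 ?sqr_ge0// mulr_ge0//; lra.
pose C1 := 4 * a `^ (q / 2) * (q / 2 * a `^ (q / 2 - 1)).
pose C2 := cq q / q * (q * 2 `^ q * (Fq t1 + 1)).
have C10 : 0 <= C1 by rewrite !mulr_ge0 ?powR_ge0//; lra.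
have C20 : 0 <= C2 by rewrite mulr_ge0// mulr_ge0 ?addr_ge0// mulr_ge0 ?powR_ge0//; lra.
have C0 : 0 <= (t2 - t1) * C1 + beta s * C2.
  by apply: addr_ge0; apply: mulr_ge0 => //; exact: ltW.
apply: (le_of_small_error C0) => e e0 e1.
have [phi [mphi phi_sub JJ0 Jp]] := profile_convex e0 a0 q2.
have lS v : 0 <= v -> L2 (S v h) by move=> v0; exact: S_L2.
have HK' v : t1 <= v -> v <= t2 -> K - C1 * e <= vr (fun x => psi e a q (S v h x)).
  move=> v1 v2; have v0 := le_trans t10 v1.
  have mS := L2_meas (lS v v0).
  have S0 x : 0 <= S v h x by exact: S_ge0.
  have mpsi := measurable_psi q e0 a0 mS.
  have mmin : measurable_fun setT (fun x => Num.min (S v h x) a `^ (q / 2)).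
    apply: measurable_powRf.
    by apply: measurable_minr => //; exact: measurable_cst.
  have min0 x : 0 <= Num.min (S v h x) a by rewrite le_min S0 ltW.
  have bmin x : `|Num.min (S v h x) a `^ (q / 2)| <= a `^ (q / 2).
    rewrite ger0_norm ?powR_ge0//; apply: powR_le => //; first by lra.
    by rewrite ge_min lexx orbT.
  have bpsi x : `|psi e a q (S v h x)| <= a `^ (q / 2) by exact: psi_norm.
  have cl : n2 ((fun x => psi e a q (S v h x)) \- (fun x => Num.min (S v h x) a `^ (q / 2))) <=
      q / 2 * a `^ (q / 2 - 1) * e.
    apply: n2_bnd; first by apply: measurable_funB.
    by move=> x; exact: psi_min.
  have := vr_close mpsi mmin bpsi bmin cl; rewrite ler_norml => /andP[H _].
  apply: le_trans (_ : _ <= vr (fun x => Num.min (S v h x) a `^ (q / 2)) - C1 * e) _.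
    by rewrite lerD2r; exact: HK.
  by rewrite /C1 -mulrA; move: H; rewrite lerBrDr addrC.
have l1 := lS t1 t10; have l2 := lS t2 t20.
have HI := int_phi_dissipation hV hpi hk hsemi hcore hwpi e0 a0 q2 mphi phi_sub lh s0 t10 t12 HK'.
rewrite -aq in HI.
have [iJ1 /andP[_ J1]] := integrable_Je e0 e1 t10.
have [iJ2 /andP[J2 _]] := integrable_Je e0 e1 t20.
have lp1 := L2_phi e0 a0 q2 mphi phi_sub l1; have lp2 := L2_phi e0 a0 q2 mphi phi_sub l2.
set I1 := ip (fun x => phi (S t1 h x)) (cst 1) in HI.
set I2 := ip (fun x => phi (S t2 h x)) (cst 1) in HI.
have IE v : ip (fun x => phi (S v h x)) (cst 1) = \int[pi]_x phi (S v h x).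
  by rewrite /ip; apply: eq_Rintegral => x _; rewrite mulr1.
pose JJ y := Je e q y - phi y.
have S10 x : 0 <= S t1 h x by exact: S_ge0.
have mJe : measurable_fun setT (fun y : R => Je e q y).
  rewrite /Je; apply: measurable_funM; first exact: measurable_cst.
  apply: measurable_powRf.
  by apply: measurable_funD => //; exact: measurable_cst.
have mJJ : measurable_fun setT JJ by exact: measurable_funB.
(* The integral of Je - phi does not increase along the flow, so the decrement of the integral of
   phi is at most that of [Je]: the untruncated moment pays for the truncated dissipation. *)
have J := jensen hV hpi hk hsemi hcore (ltW D0) l1 S10 mJJ JJ0 Jp.
have iJJ1 : pi.-integrable setT (EFin \o (fun x => JJ (S t1 h x))).
  exact: (integrable_sub iJ1 (L2_int lp1)).
have iJJ2 : pi.-integrable setT (EFin \o (fun x => JJ (S t2 h x))).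
  exact: (integrable_sub iJ2 (L2_int lp2)).
have E2 : (\int[pi]_x (JJ (S (t2 - t1) (S t1 h) x))%:E = \int[pi]_x (JJ (S t2 h x))%:E)%E.
  apply: ae_eq_integral => //.
  - apply/measurable_EFinP/measurableT_comp => //; exact: (L2_meas (S_L2 hsemi (ltW D0) l1)).
  - exact: (measurable_int pi iJJ2).
  have := S_semi hk hsemi (ltW D0) t10 lh; rewrite subrK.
  by apply: filterS => x E _; rewrite E.
rewrite E2 in J.
have JR : \int[pi]_x JJ (S t2 h x) <= \int[pi]_x JJ (S t1 h x).
  exact: Rintegral_le_ereal iJJ2 iJJ1 J.
have EB v : pi.-integrable setT (EFin \o (fun x => Je e q (S v h x))) -> L2 (fun x => phi (S v h x)) ->
    \int[pi]_x JJ (S v h x) = \int[pi]_x Je e q (S v h x) - ip (fun x => phi (S v h x)) (cst 1).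
  by move=> iv lv; rewrite IE; apply: RintegralB => //; exact: L2_int.
rewrite (EB _ iJ1 lp1) (EB _ iJ2 lp2) -/I1 -/I2 in JR.
have H : I1 - I2 <= cq q / q * (Fq t1 - Fq t2) + e * C2.
  rewrite /C2; move: J1 J2 JR.
  generalize I1 I2 (\int[pi]_x Je e q (S t1 h x)) (\int[pi]_x Je e q (S t2 h x)) (cq q / q) (2 `^ q) (Fq t1) (Fq t2).
  by move=> *; lra.
have {}H := ler_wpM2l b0 H.
exact: dissipation_arith HI H.
Qed.

End dissipation.

(** * From discrete dissipation to decay *)

Section exp_bounds.
Context {R : realType}.

(** Rational bounds come from 1 + x <= exp x at x = 1/8, raised to a power; the bound on ln 5 below
    uses x = - 1/8 in the same way. *)
Lemma expR_half_ge : 8 / 5 <= expR (1 / 2 : R).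
Proof.
have -> : 1 / 2 = (1 / 8 : R) * 4%:R by field.
rewrite expRM_natr.
apply: le_trans (_ : _ <= (9 / 8) ^+ 4) _; first by rewrite !exprS expr0; lra.
rewrite lerXn2r// ?nnegrE ?expR_ge0//; try lra.
by apply: le_trans (expR_ge1Dx _); lra.
Qed.

Lemma expRN_half_le : expR (- (1 / 2) : R) <= 5 / 8.
Proof.
rewrite expRN; have H := expR_half_ge.
have -> : 5 / 8 = (8 / 5 : R)^-1 by field.
by rewrite lef_pV2// posrE ?expR_gt0//; lra.
Qed.

Lemma expRN1_le : expR (- 1 : R) <= 2 / 5.
Proof.
have -> : - 1 = - (1 / 2) + - (1 / 2) :> R by field.
rewrite expRD; have H := expRN_half_le; have H0 := expR_ge0 (- (1 / 2) : R).
apply: le_trans (_ : _ <= 5 / 8 * (5 / 8)) _; last by lra.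
by apply: ler_pM.
Qed.

Lemma ln5_ge : 3 / 2 <= ln 5 :> R.
Proof.
rewrite -[leLHS]expRK ler_ln ?posrE ?expR_gt0//.
have -> : 3 / 2 = (1 / 8 : R) * 12%:R by field.
rewrite expRM_natr.
have H : expR (1 / 8 : R) <= 8 / 7.
  have -> : 1 / 8 = - (- (1 / 8)) :> R by rewrite opprK.
  rewrite expRN; have -> : 8 / 7 = (7 / 8 : R)^-1 by field.
  rewrite lef_pV2 ?posrE ?expR_gt0 ?divr_gt0//.
  by apply: le_trans (expR_ge1Dx _); lra.
apply: le_trans (_ : _ <= (8 / 7) ^+ 12) _; last by rewrite !exprS expr0; lra.
by rewrite lerXn2r// ?nnegrE ?expR_ge0//; lra.
Qed.

(** From exp (- x) <= 1 / (1 + x) <= 1 - x / 2, the last step being x (1 - x) >= 0. The slope 1/2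
    produces the level 2 r delta in the regime of small divergence. *)
Lemma expRN_le (x : R) : 0 <= x -> x <= 1 -> x / 2 <= 1 - expR (- x).
Proof.
move=> x0 x1; rewrite expRN.
have H := expR_ge1Dx x.
have x10 : 0 < 1 + x by lra.
have : (expR x)^-1 <= (1 + x)^-1 by rewrite lef_pV2 ?posrE ?expR_gt0.
suff : (1 + x)^-1 <= 1 - x / 2 by lra.
rewrite -[leLHS]mul1r ler_pdivrMr//.
have : 0 <= x * (1 - x) by rewrite mulr_ge0//; lra.
by lra.
Qed.

(** This is ln (1 + y) >= y / (1 + y); with [expR_lim] it replaces the limit of (1 + x / m)^m. *)
Lemma expR_frac (y : R) : 0 <= y -> expR (y / (1 + y)) <= 1 + y.
Proof.
move=> y0; have y1 : 0 < 1 + y by lra.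
rewrite -[y / _]opprK expRN -[leRHS]invrK lef_pV2 ?posrE ?invr_gt0 ?expR_gt0//.
apply: le_trans (expR_ge1Dx _).
by rewrite le_eqVlt; apply/orP; left; apply/eqP; field; apply/eqP; lra.
Qed.

Lemma expR_lim (x z : R) : 0 <= x -> (forall N : nat, x / (1 + x / N.+1%:R) <= z) -> x <= z.
Proof.
move=> x0 H; apply/ler_addgt0Pr => e e0.
have z0 : 0 <= z by apply: le_trans (H 0%N); rewrite divr_ge0// addr_ge0// divr_ge0.
have zx0 : 0 < 1 + z * x by rewrite ltr_wpDr// mulr_ge0.
have [N HN] := ltr_add_invr (divr_gt0 e0 zx0); rewrite add0r in HN.
have := H N; set m : R := N.+1%:R in HN *.
have m0 : 0 < m by rewrite ltr0n.
have D0 : 0 < 1 + x / m by rewrite ltr_wpDr// divr_ge0// ltW.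
rewrite ler_pdivrMr// => Hx.
have : m^-1 * (1 + z * x) < e by rewrite -ltr_pdivlMr.
have : 0 < m^-1 by rewrite invr_gt0.
move: Hx; generalize (m^-1) => w.
by lra.
Qed.

(* Discretised Gronwall inequality: iterate the one-step bound on a uniform mesh. *)
Lemma growth (f : R -> R) c s t : 0 <= c -> s <= t ->
  (forall u, s <= u -> u <= t -> 0 < f u) ->
  (forall u v, s <= u -> u < v -> v <= t -> f v * (1 + c * (v - u)) <= f u) ->
  f t * expR (c * (t - s)) <= f s.
Proof.
move=> c0; rewrite le_eqVlt => /predU1P[<- _ _|st f0 H]; first by rewrite subrr mulr0 expR0 mulr1.
have ts0 : 0 <= t - s by rewrite subr_ge0 ltW.
have x0 : 0 <= c * (t - s) by rewrite mulr_ge0.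
have fs := f0 s (lexx _) (ltW st); have ft := f0 t (ltW st) (lexx _).
suff K : c * (t - s) <= ln (f s / f t).
  rewrite mulrC -ler_pdivlMr// -[leRHS]lnK ?posrE ?divr_gt0//.
  by rewrite ler_expR.
apply: expR_lim => // N; set x := c * (t - s); set m : R := N.+1%:R.
have m0 : 0 < m by rewrite ltr0n.
pose dt := (t - s) / m.
have dt0 : 0 < dt by rewrite divr_gt0// subr_gt0.
have y0 : 0 <= c * dt by rewrite mulr_ge0// ltW.
have K n : (n <= N.+1)%N -> f (s + n%:R * dt) * (1 + c * dt) ^+ n <= f s.
  elim: n => [|n IH] nN; first by rewrite mul0r addr0 expr0 mulr1.
  have := IH (ltnW nN); apply: le_trans.
  rewrite exprS mulrA; apply: ler_wpM2r; first by rewrite exprn_ge0// addr_ge0.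
  have nt : 0 <= n%:R * dt by rewrite mulr_ge0// ltW.
  have := H (s + n%:R * dt) (s + n.+1%:R * dt).
  rewrite (_ : s + n.+1%:R * dt - (s + n%:R * dt) = dt); last by rewrite -natr1; ring.
  apply; first by rewrite lerDl.
    by rewrite -natr1 ltrD2l mulrDl mul1r ltrDl.
  rewrite -lerBrDl /dt mulrA ler_pdivrMr// mulrC; apply: ler_wpM2l => //.
  by rewrite ler_nat.
have := K N.+1 (leqnn _).
rewrite (_ : s + N.+1%:R * dt = t); last by rewrite /dt -/m mulrC divfK ?gt_eqF//; ring.
move=> {}K.
have E : x / (1 + x / m) = ((c * dt) / (1 + c * dt)) * N.+1%:R.
  rewrite -/m /dt /x (_ : c * ((t - s) / m) = c * (t - s) / m); last by rewrite mulrA.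
  by rewrite [RHS]mulrAC divfK ?gt_eqF.
rewrite E -[leLHS]expRK ler_ln ?posrE ?expR_gt0 ?divr_gt0// expRM_natr ler_pdivlMr// mulrC.
apply: le_trans K; apply: ler_wpM2l; first exact: ltW.
by rewrite lerXn2r ?nnegrE ?expR_ge0 ?addr_ge0// expR_frac.
Qed.

End exp_bounds.

Section decay.
Context {R : realType}.
Variables (q delta : R) (F : R -> R) (B : R -> R).
Hypotheses (q2 : 2 <= q) (d1 : 1 <= delta).
Hypothesis F1 : forall t, 0 <= t -> 1 <= F t.
Hypothesis Fnd : forall s t, 0 <= s -> s <= t -> F t <= F s.
Hypothesis B0 : forall r, 0 < r -> 0 <= B r.
Hypothesis Bnd : forall r s, 0 < r -> r <= s -> B s <= B r.
Hypothesis HD : forall r s t, 0 < r -> 0 <= s -> s < t ->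
  (t - s) * (F t - F t `^ ((q - 2) / (q - 1)) - r * delta) <= B r * (cq q / q * (F s - F t)).
Hypothesis Flsc : forall c, (forall t, 0 < t -> F t <= c) -> F 0 <= c.

Definition Rn t := ln (F t) / (q - 1).

Let q10 : 0 < q - 1. Proof. by have := q2; lra. Qed.
Let qgt0 : 0 < q. Proof. by have := q2; lra. Qed.

Lemma Fgt0 t : 0 <= t -> 0 < F t. Proof. by move=> t0; apply: lt_le_trans (F1 t0). Qed.

Lemma Rn_ge0 t : 0 <= t -> 0 <= Rn t.
Proof. by move=> t0; rewrite divr_ge0 ?(ltW q10)// ln_ge0// F1. Qed.

Lemma Rn_nd s t : 0 <= s -> s <= t -> Rn t <= Rn s.
Proof.
move=> s0 st; have t0 := le_trans s0 st.
by rewrite ler_pM2r ?invr_gt0// ler_ln ?posrE ?Fgt0// Fnd.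
Qed.

Lemma F_expR t : 0 <= t -> F t = expR ((q - 1) * Rn t).
Proof. by move=> t0; rewrite /Rn mulrC divfK ?gt_eqF// lnK// posrE Fgt0. Qed.

(** As F = exp ((q - 1) R), the interpolation bound F - F^((q-2)/(q-1)) becomes F (1 - exp (-
    R)). *)
Lemma F_powR t : 0 <= t -> F t `^ ((q - 2) / (q - 1)) = F t * expR (- Rn t).
Proof.
move=> t0; have qn := gt_eqF q10; rewrite /powR gt_eqF ?Fgt0// {2}(F_expR t0) -expRD; congr expR.
by rewrite /Rn; field; rewrite qn.
Qed.

(** Inverse of B r cq / q, the factor of the decrement in [HD]. *)
Let kap r := 4 * (q - 1) / (q * B r).

Lemma F_step r s t : 0 < r -> 0 < B r -> 0 <= s -> s < t ->
  F t * (1 + kap r * (1 - expR (- Rn t) - r * delta) * (t - s)) <= F s.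
Proof.
move=> r0 Br s0 st; have t0 : 0 <= t by apply: le_trans s0 (ltW st).
have D0 : 0 < t - s by rewrite subr_gt0.
have rd0 : 0 <= r * delta by rewrite mulr_ge0 ?(ltW r0)//; apply: le_trans d1.
have H := HD r0 s0 st; rewrite (F_powR t0) in H.
(* F t >= 1 allows r delta to be replaced by F t r delta, so that F t factors out. *)
have H1 : F t * (1 - expR (- Rn t) - r * delta) <= F t - F t * expR (- Rn t) - r * delta.
  have : r * delta <= F t * (r * delta) by rewrite ler_peMl// F1.
  by lra.
have {}H := le_trans (ler_wpM2l (ltW D0) H1) H.
have E : B r * (cq q / q * (F s - F t)) = (F s - F t) / kap r.
  rewrite /kap /cq; have h1 := gt_eqF Br; have h2 := gt_eqF q10; have h3 := gt_eqF qgt0.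
  by field; rewrite h1 h2 h3.
have k0 : 0 < kap r.
  by apply: divr_gt0; apply: mulr_gt0.
rewrite E ler_pdivlMr// in H.
by lra.
Qed.

(** R is nonincreasing, so on [s, t] the quantity 1 - exp (- R) is at least its value at t, and
    [growth] applies with that constant rate. A negative rate reduces to monotonicity. *)
Lemma entropy_step r s t : 0 < r -> 0 < B r -> 0 <= s -> s <= t ->
  4 / (q * B r) * (1 - expR (- Rn t) - r * delta) * (t - s) <= Rn s - Rn t.
Proof.
move=> r0 Br s0 st; have t0 := le_trans s0 st.
have k0 : 0 < 4 / (q * B r) by apply: divr_gt0 => //; exact: mulr_gt0.
set c := 1 - expR (- Rn t) - r * delta.
have [c0|cn] := leP 0 c; last first.
  apply: le_trans (_ : _ <= 0) _; last by rewrite subr_ge0 Rn_nd.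
  by apply: mulr_le0_ge0; [apply: mulr_ge0_le0; exact: ltW|rewrite subr_ge0].
have kE : kap r = (q - 1) * (4 / (q * B r)) by rewrite /kap; ring.
have kc0 : 0 <= kap r * c by rewrite mulr_ge0// kE mulr_ge0 ?ltW.
have H : F t * expR (kap r * c * (t - s)) <= F s.
  apply: growth => // [u su ut|u v su uv vt]; first by rewrite Fgt0// (le_trans s0).
  have u0 := le_trans s0 su; have v0 := le_trans u0 (ltW uv).
  apply: le_trans (F_step r0 Br u0 uv).
  apply: ler_wpM2l; first exact/ltW/Fgt0.
  rewrite lerD2l; apply: ler_wpM2r; first by rewrite subr_ge0 ltW.
  apply: ler_wpM2l; first by rewrite kE mulr_ge0 ?ltW.
  by rewrite /c; apply: lerB => //; apply: lerB => //; rewrite ler_expR lerN2 Rn_nd.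
move: H; rewrite -ler_ln ?posrE ?mulr_gt0 ?expR_gt0 ?Fgt0//.
rewrite lnM ?posrE ?expR_gt0 ?Fgt0// expRK => H.
rewrite /Rn -mulrBl ler_pdivlMr//.
rewrite (_ : _ * (q - 1) = kap r * c * (t - s)); last by rewrite kE; ring.
by lra.
Qed.

(** With B r = 0 the quotients by it are 0 and the decay estimates carry no information; [HD] on
    [0, t] then gives the bound directly, though only for t > 0. *)
Lemma zero_rate r t : 0 < r -> B r = 0 -> 0 < t -> 1 - expR (- Rn t) <= r * delta.
Proof.
move=> r0 Br t0; have := HD r0 (lexx 0) t0; rewrite Br mul0r subr0 (F_powR (ltW t0)).
rewrite pmulr_rle0// => H.
have rd0 : 0 <= r * delta by rewrite mulr_ge0 ?(ltW r0)//; apply: le_trans d1.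
have : r * delta <= F t * (r * delta) by rewrite ler_peMl// F1// ltW.
have Ft := Fgt0 (ltW t0) => H2.
by rewrite -subr_le0 -(pmulr_rle0 _ Ft); lra.
Qed.

Lemma decay_large r t : 0 < r -> 0 <= t -> 1 <= Rn t ->
  Rn t <= Rn 0 - (2 - 4 * r * delta) / (B r * q) * t.
Proof.
move=> r0 t0 Rt1; have := B0 r0; rewrite le_eqVlt => /predU1P[<-|Br].
  by rewrite mul0r invr0 mulr0 mul0r subr0 Rn_nd.
have H := entropy_step r0 Br (lexx 0) t0; rewrite subr0 in H.
(* The value 1/2 leaves 4 (1/2 - r delta) = 2 - 4 r delta in [entropy_step]. *)
have e1 : expR (- Rn t) <= 1 / 2.
  apply: le_trans (_ : _ <= expR (- 1)) _; first by rewrite ler_expR lerN2.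
  by apply: le_trans expRN1_le _; lra.
have k0 : 0 <= 4 / (q * B r) * t by rewrite mulr_ge0// divr_ge0// mulr_ge0 ?ltW.
have H2 : (2 - 4 * r * delta) / (B r * q) * t <= 4 / (q * B r) * (1 - expR (- Rn t) - r * delta) * t.
  have -> : (2 - 4 * r * delta) / (B r * q) * t = 4 / (q * B r) * t * (1 / 2 - r * delta).
    have h1 := gt_eqF Br; have h3 := gt_eqF qgt0.
    by field; rewrite h1 h3.
  rewrite [leRHS]mulrAC; apply: ler_wpM2l => //; lra.
by lra.
Qed.

(** [growth] for R - 2 r delta, using 1 - exp (- R) >= R / 2. The starting time is general because
    the time bound applies it after a first phase. *)
Lemma decay_small r s t : 0 < r -> 0 <= s -> s <= t -> Rn s <= 1 ->
  Rn t <= expR (- (2 * (t - s) / (B r * q))) * (Rn s - 2 * r * delta) + 2 * r * delta.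
Proof.
move=> r0 s0 st Rs1; have t0 := le_trans s0 st; have := B0 r0; rewrite le_eqVlt => /predU1P[<-|Br].
  by rewrite mul0r invr0 mulr0 oppr0 expR0 mul1r subrK Rn_nd.
set z := 2 * (t - s) / (B r * q).
have z0 : 0 <= z by rewrite divr_ge0 ?mulr_ge0 ?subr_ge0// ltW.
have Rts : Rn t <= Rn s by exact: Rn_nd.
rewrite -lerBlDr.
(* If R t is already at most 2 r delta, [growth] lacks positivity; the sign of R s - 2 r delta or
   monotonicity then settles the claim. Otherwise positivity at t propagates backwards. *)
have [yt|yt] := leP (Rn t - 2 * r * delta) 0.
  have [ys|ys] := leP 0 (Rn s - 2 * r * delta).
    by apply: le_trans yt _; rewrite mulr_ge0// expR_ge0.
  apply: le_trans (_ : _ <= Rn s - 2 * r * delta) _; first by rewrite lerD2r.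
  by rewrite -subr_ge0 -[X in _ - X]mul1r -mulrBl; apply: mulr_le0; [rewrite subr_le0 -expR0 ler_expR oppr_le0|exact: ltW].
rewrite expRN [leRHS]mulrC ler_pdivlMr ?expR_gt0//.
have c0 : 0 <= 2 / (q * B r) by rewrite divr_ge0// mulr_ge0 ?ltW.
have -> : z = 2 / (q * B r) * (t - s).
  have h1 := gt_eqF Br; have h3 := gt_eqF qgt0.
  by rewrite /z; field; rewrite h1 h3.
apply: (growth (f := fun u => Rn u - 2 * r * delta) c0 st) => [u su ut|u v su uv vt].
  by apply: lt_le_trans yt _; rewrite lerD2r Rn_nd// (le_trans s0).
have u0 := le_trans s0 su; have v0 := le_trans u0 (ltW uv).
have H := entropy_step r0 Br u0 (ltW uv).
have Rv1 : Rn v <= 1 by apply: le_trans Rs1; rewrite Rn_nd// (le_trans su) ?(ltW uv).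
have He := expRN_le (Rn_ge0 v0) Rv1.
have H2 : 4 / (q * B r) * (Rn v / 2 - r * delta) * (v - u) <= 4 / (q * B r) * (1 - expR (- Rn v) - r * delta) * (v - u).
  apply: ler_wpM2r; first by rewrite subr_ge0 ltW.
  by apply: ler_wpM2l; [rewrite divr_ge0// mulr_ge0 ?ltW|rewrite lerD2r].
have E : 4 / (q * B r) * (Rn v / 2 - r * delta) * (v - u) = (Rn v - 2 * r * delta) * (2 / (q * B r) * (v - u)).
  by field; rewrite (gt_eqF Br) (gt_eqF qgt0).
rewrite E in H2; rewrite mulrDr mulr1.
by have := le_trans H2 H; lra.
Qed.

Let r1 : R := 1 / (4 * delta).

Let d0 : 0 < delta. Proof. exact: lt_le_trans d1. Qed.
Let r10 : 0 < r1. Proof. by rewrite divr_gt0// mulr_gt0. Qed.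
Let rd : r1 * delta = 1 / 4. Proof. by rewrite /r1; field; rewrite gt_eqF. Qed.

(** Serves the time bound at T = 0, which a vanishing rate can make admissible, whereas [zero_rate]
    speaks of positive times. *)
Lemma Rn_lsc c : (forall t, 0 < t -> Rn t <= c) -> Rn 0 <= c.
Proof.
move=> H; rewrite ler_pdivrMr// -ler_expR lnK ?posrE ?Fgt0//.
apply: Flsc => t t0; rewrite (F_expR (ltW t0)) ler_expR mulrC.
by rewrite ler_pM2r// H.
Qed.

(* While Rn >= 1 it decreases at rate at least (7/5) / (q B), and while Rn >= 1/2 at
   rate at least (1/2) / (q B); hence it is below 1/2 after time q B Rn 0. *)
Lemma half_entropy_pos t : 0 < t -> q * B r1 * Rn 0 <= t -> Rn t <= 1 / 2.
Proof.
move=> t0 Tt; rewrite leNgt; apply/negP => Rt.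
have eh u : 1 / 2 < Rn u -> expR (- Rn u) <= 5 / 8.
  by move=> Ru; apply: le_trans expRN_half_le; rewrite ler_expR lerN2 ltW.
have := B0 r10; rewrite le_eqVlt => /predU1P[/esym Br|Br].
  have := zero_rate r10 Br t0; have := eh _ Rt; rewrite rd; lra.
set b := q * B r1 in Tt *; have b0 : 0 < b by rewrite mulr_gt0.
have R00 := Rn_ge0 (lexx 0).
have T0 : 0 <= b * Rn 0 by rewrite mulr_ge0// ltW.
have RT : 1 / 2 < Rn (b * Rn 0) by apply: lt_le_trans Rt _; exact: Rn_nd.
have eT := eh _ RT.
have [Rle|Rgt] := leP (Rn 0) 1.
  have := entropy_step r10 Br (lexx 0) T0; rewrite rd -/b subr0.
  rewrite (_ : 4 / b * _ * _ = 4 * (1 - expR (- Rn (b * Rn 0)) - 1 / 4) * Rn 0); last first.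
    by field; rewrite gt_eqF.
  have : (1 / 8) * Rn 0 <= (1 - expR (- Rn (b * Rn 0)) - 1 / 4) * Rn 0.
    by apply: ler_wpM2r => //; lra.
  by lra.
set u := b * ((Rn 0 - 1) * (5 / 7)).
have u0 : 0 <= u by rewrite mulr_ge0 ?(ltW b0)//; lra.
have uT : u <= b * Rn 0 by rewrite ler_pM2l//; lra.
have Ru : Rn u <= 1.
  rewrite leNgt; apply/negP => Ru.
  have eu : expR (- Rn u) <= 2 / 5.
    by apply: le_trans expRN1_le; rewrite ler_expR lerN2 ltW.
  have := entropy_step r10 Br (lexx 0) u0; rewrite rd -/b subr0.
  rewrite (_ : 4 / b * _ * _ = 4 * (1 - expR (- Rn u) - 1 / 4) * ((Rn 0 - 1) * (5 / 7))); last first.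
    by rewrite /u; field; rewrite gt_eqF.
  have : (7 / 20) * ((Rn 0 - 1) * (5 / 7)) <= (1 - expR (- Rn u) - 1 / 4) * ((Rn 0 - 1) * (5 / 7)).
    by apply: ler_wpM2r; lra.
  by lra.
have := entropy_step r10 Br u0 uT; rewrite rd -/b.
(* Time left after u in units of b; it is at least 1, so rate 1/2 brings R from 1 down to 1/2. *)
set w := Rn 0 - (Rn 0 - 1) * (5 / 7).
have w1 : 1 <= w by rewrite /w; lra.
rewrite (_ : 4 / b * _ * _ = 4 * (1 - expR (- Rn (b * Rn 0)) - 1 / 4) * w); last first.
  by rewrite /u /w; field; rewrite gt_eqF.
have : (1 / 8) * 1 <= (1 - expR (- Rn (b * Rn 0)) - 1 / 4) * w by apply: ler_pM; lra.
by lra.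
Qed.

Lemma half_entropy t : 0 <= t -> q * B r1 * Rn 0 <= t -> Rn t <= 1 / 2.
Proof.
rewrite le_eqVlt => /predU1P[<- H|]; last exact: half_entropy_pos.
by apply: Rn_lsc => u u0; apply: half_entropy_pos => //; apply: le_trans H (ltW u0).
Qed.

Lemma decay_time_pos eps T : 0 < eps -> 0 < T ->
  q * B r1 * Rn 0 + q / 2 * B (eps / (4 * delta)) * ln (1 / eps) <= T -> Rn T <= eps.
Proof.
move=> e0 T0; set r2 := eps / (4 * delta).
have r20 : 0 < r2 by rewrite divr_gt0// mulr_gt0.
have rd2 : r2 * delta = eps / 4 by rewrite /r2; field; rewrite gt_eqF.
have b20 := B0 r20; have b10 := B0 r10; have R00 := Rn_ge0 (lexx 0).
have q0' := qgt0; have RT0 := Rn_ge0 (ltW T0).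
(* For eps >= 1 the logarithmic term is nonpositive and shortens the first phase; [decay_large], the
   monotonicity of B and ln eps <= eps - 1 compensate. *)
have [e1|e1] := leP 1 eps.
  rewrite div1r lnV ?posrE// => HT.
  have [Re|eR] := leP (Rn T) 1; first exact: le_trans e1.
  have lne0 : 0 <= ln eps by rewrite ln_ge0.
  have lne : ln eps <= eps - 1.
    by have := expR_ge1Dx (ln eps); rewrite lnK ?posrE//; lra.
  have r12 : r1 <= r2 by rewrite /r1 /r2 ler_pM2r// invr_gt0 mulr_gt0.
  have b12 := Bnd r10 r12.
  have H := decay_large r10 (ltW T0) (ltW eR).
  have [b1|b1] := eqVneq (B r1) 0.
    by apply: le_trans (half_entropy_pos T0 _) _; rewrite ?b1 ?mulr0 ?mul0r ?ltW//; lra.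
  have b1p : 0 < B r1 by rewrite lt_neqAle eq_sym b1.
  rewrite (_ : 2 - 4 * r1 * delta = 1) in H; last by rewrite -mulrA rd; field.
  have H2 : q * B r1 * (Rn 0 - 2^-1 * ln eps) <= T.
    apply: le_trans HT; have : q * (B r2 * ln eps) <= q * (B r1 * ln eps).
      by apply: ler_wpM2l; [exact: ltW|apply: ler_wpM2r].
    by lra.
  have H3 : Rn 0 - 2^-1 * ln eps <= 1 / (B r1 * q) * T.
    by rewrite div1r [leRHS]mulrC ler_pdivlMr ?mulr_gt0// mulrC [B r1 * q]mulrC.
  by lra.
(* A zero rate gives 1 - exp (- R T) <= eps / 4, whereas R T > eps would force at least eps / 2. *)
move=> HT; have [b2|b2] := eqVneq (B r2) 0.
  have := zero_rate r20 b2 T0; rewrite rd2 => H.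
  rewrite leNgt; apply/negP => RT.
  have : expR (- Rn T) <= expR (- eps) by rewrite ler_expR lerN2 ltW.
  by have := expRN_le (ltW e0) (ltW e1); lra.
have b2p : 0 < B r2 by rewrite lt_neqAle eq_sym b2.
have L0 : 0 <= ln (1 / eps) by rewrite ln_ge0// div1r invf_ge1// ltW.
(* T is split at u: the first phase gives R u <= 1/2, and the remaining time makes the exponential
   factor equal to eps, whence R T <= eps (1/2 - eps/2) + eps/2 <= eps. *)
set u := T - q / 2 * B r2 * ln (1 / eps).
have uge : q * B r1 * Rn 0 <= u by rewrite /u; lra.
have u0 : 0 <= u by apply: le_trans uge; rewrite mulr_ge0// mulr_ge0// ltW.
have uT : u <= T by rewrite /u gerBl mulr_ge0// mulr_ge0//; lra.
have Ru := half_entropy u0 uge.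
have Ru1 : Rn u <= 1 by lra.
have := decay_small r20 u0 uT Ru1.
have -> : 2 * (T - u) / (B r2 * q) = ln (1 / eps).
  by rewrite /u; field; rewrite (gt_eqF b2p) (gt_eqF qgt0).
rewrite div1r lnV ?posrE// opprK lnK ?posrE// -mulrA rd2 => H.
apply: le_trans H _.
have : eps * (Rn u - 2 * (eps / 4)) <= eps * (1 / 2).
  by apply: ler_wpM2l; [exact: ltW|lra].
by lra.
Qed.

Lemma decay_time eps T : 0 < eps -> 0 <= T ->
  q * B r1 * Rn 0 + q / 2 * B (eps / (4 * delta)) * ln (1 / eps) <= T -> Rn T <= eps.
Proof.
move=> e0; rewrite le_eqVlt => /predU1P[<- H|T0]; last exact: decay_time_pos.
apply: Rn_lsc => t t0; apply: decay_time_pos => //.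
exact: le_trans H (ltW t0).
Qed.

End decay.

(** * Moments and interpolation *)

Section amgm.
Context {R : realType}.
Implicit Types x y l n : R.

(** Tangent of exp at ln z, with z the geometric mean, evaluated at ln x and ln y; weighted by l and
    1 - l, the logarithms cancel. *)
Lemma weighted_amgm x y l : 0 < x -> 0 < y -> 0 <= l -> l <= 1 ->
  x `^ l * y `^ (1 - l) <= l * x + (1 - l) * y.
Proof.
move=> x0 y0 l0 l1; set z := x `^ l * y `^ (1 - l).
have z0 : 0 < z by rewrite mulr_gt0 ?powR_gt0.
have E : ln z = l * ln x + (1 - l) * ln y by rewrite lnM ?posrE ?powR_gt0// !ln_powR.
have T w : 0 < w -> z * (1 + ln w - ln z) <= w.
  move=> w0; have := expR_ge1Dx (ln w - ln z); rewrite expRB !lnK ?posrE// ler_pdivlMr//.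
  by rewrite mulrC addrA.
have Hx := ler_wpM2l l0 (T x x0).
have l10 : 0 <= 1 - l by lra.
have Hy := ler_wpM2l l10 (T y y0).
rewrite E in Hx Hy; lra.
Qed.

(** Weighted AM-GM for y^n and x^n with weights 1/n and 1 - 1/n; zero arguments are treated apart,
    since the logarithms need positivity. *)
Lemma powR_tangent x y n : 0 <= x -> 0 <= y -> 1 <= n ->
  x `^ n + n * x `^ (n - 1) * (y - x) <= y `^ n.
Proof.
rewrite le_eqVlt => /predU1P[<- y0 n1|x0].
  rewrite powR0; last by apply/eqP; lra.
  have [->|nn] := eqVneq n 1; first by rewrite subrr powRr0 powRr1//; lra.
  rewrite powR0; last by rewrite subr_eq0.
  by rewrite mulr0 mul0r addr0 powR_ge0.
rewrite le_eqVlt => /predU1P[<- n1|y0 n1].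
  rewrite powR0; last by apply/eqP; lra.
  rewrite sub0r mulrN -mulrA [_ * x]mulrC mulr_powRB1 ?(ltW x0)//; last by lra.
  have := powR_ge0 x n; have : 0 <= (n - 1) * x `^ n by rewrite mulr_ge0 ?powR_ge0//; lra.
  by lra.
have n0 : 0 < n by lra.
have l0 : 0 <= n^-1 by rewrite invr_ge0 ltW.
have l1 : n^-1 <= 1 by rewrite invf_le1.
have := weighted_amgm (powR_gt0 n y0) (powR_gt0 n x0) l0 l1.
rewrite -!powRrM mulfV ?gt_eqF// powRr1 ?(ltW y0)// mulrBr mulr1 mulfV ?gt_eqF// => H.
have E : n * x `^ (n - 1) * (y - x) = n * (y * x `^ (n - 1)) - n * x `^ n.
  by rewrite -(mulr_powRB1 (ltW x0) n0); ring.
have := ler_wpM2l (ltW n0) H.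
rewrite mulrDr !mulrA mulfV ?gt_eqF// mul1r [n * (1 - n^-1)]mulrBr mulr1 mulfV ?gt_eqF//.
rewrite E; lra.
Qed.

End amgm.

Section moments.
Context d (T : measurableType d) (R : realType) (mu : probability T R).
Variable h : T -> R.
Hypotheses (mh : measurable_fun setT h) (h0 : forall x, 0 <= h x).

Definition mom (n : R) : R := \int[mu]_x (h x `^ n).
Definition fmom (n : R) := mu.-integrable setT (EFin \o (fun x => h x `^ n)).

Lemma mom_ge0 n : 0 <= mom n.
Proof. by apply: Rintegral_ge0 => x _; exact: powR_ge0. Qed.

Lemma fmom_int1 n : 1 <= n -> fmom n -> mu.-integrable setT (EFin \o h).
Proof.
move=> n1 fn; have i1 : mu.-integrable setT (EFin \o (fun=> 1)) by exact: (L2_int (L2_cst mu 1)).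
apply: (le_integrable measurableT _ _ (integrable_add i1 fn)).
  exact/measurable_EFinP.
move=> x _; rewrite /= lee_fin !ger0_norm ?addr_ge0 ?powR_ge0//.
have [hx|hx] := leP (h x) 1; first by rewrite (le_trans hx)// lerDl powR_ge0.
by apply: le_trans (le1r_powR (ltW hx) n1) _; rewrite lerDr.
Qed.

Hypothesis h1 : \int[mu]_x h x = 1.

Lemma Rintegral_cst1 (c : R) : \int[mu]_x c = c.
Proof.
rewrite Rintegral_cst// (_ : fine _ = 1); first by rewrite mulr1.
by transitivity (fine (1%E : \bar R)) => //; congr fine; exact: probability_setT.
Qed.

Lemma mom_ge1 n : 1 <= n -> fmom n -> 1 <= mom n.
Proof.
move=> n1 fn; have i1 : mu.-integrable setT (EFin \o (fun=> 1 - n)) by exact: (L2_int (L2_cst mu _)).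
have ih := fmom_int1 n1 fn; have inh := integrable_mulc n ih.
have : \int[mu]_x ((1 - n) + n * h x) <= mom n.
  apply: le_Rintegral => //; first exact: (integrable_add i1 inh).
  move=> x _; have := powR_tangent ler01 (h0 x) n1; rewrite powR1.
  by rewrite mulr1; lra.
rewrite (RintegralD measurableT i1 inh) (RintegralZl _ measurableT ih) h1 Rintegral_cst1.
by rewrite mulr1 subrK.
Qed.

(* h^m = (h)^l (h^n)^(1-l) with m = l + (1-l) n, normalised so that the weighted AM-GM inequality applies. *)
Lemma mom_interp m n l : 1 <= n -> fmom n -> 0 < m -> 0 <= l -> l <= 1 -> m = l + (1 - l) * n ->
  fmom m /\ mom m <= mom n `^ (1 - l).
Proof.
move=> n1 fn m0 l0 l1 mE; have G1 := mom_ge1 n1 fn.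
have G0 : 0 < mom n by apply: lt_le_trans G1.
have ih := fmom_int1 n1 fn.
pose g x := (mom n `^ (1 - l)) * (l * h x + (1 - l) * (mom n)^-1 * h x `^ n).
have ig1 := integrable_mulc l ih; have ig2 := integrable_mulc ((1 - l) * (mom n)^-1) fn.
have ig := integrable_mulc (mom n `^ (1 - l)) (integrable_add ig1 ig2).
have H x : h x `^ m <= g x.
  have := h0 x; rewrite le_eqVlt => /predU1P[<-|hx].
    rewrite powR0 ?gt_eqF// /g mulr_ge0 ?powR_ge0// addr_ge0 ?mulr_ge0 ?powR_ge0// ?subr_ge0//.
    by rewrite invr_ge0 ltW.
  have := weighted_amgm hx (divr_gt0 (powR_gt0 n hx) G0) l0 l1.
  rewrite powRM ?powR_ge0 ?invr_ge0 ?(ltW G0)// -powRrM -powR_inv1 ?(ltW G0)// -powRrM mulN1r powRN.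
  rewrite mulrA -powRD; last by rewrite (gt_eqF hx) implybT.
  rewrite (_ : l + n * (1 - l) = m); last by rewrite mE [n * _]mulrC.
  rewrite ler_pdivrMr ?powR_gt0// powR_inv1 ?(ltW G0)// => K.
  by apply: le_trans K _; rewrite /g le_eqVlt; apply/orP; left; apply/eqP; ring.
have im : fmom m.
  apply: (le_integrable measurableT _ _ ig); first exact/measurable_EFinP/measurable_powRf.
  by move=> x _; rewrite /= lee_fin ger0_norm ?powR_ge0// (le_trans (H x))// ler_norm.
split=> //; apply: le_trans (le_Rintegral measurableT im ig (fun x _ => H x)) _.
rewrite /g (RintegralZl _ measurableT (integrable_add ig1 ig2)) (RintegralD measurableT ig1 ig2).
rewrite (RintegralZl _ measurableT ih) (RintegralZl _ measurableT fn) h1 -/(mom n).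
rewrite -mulrA mulVf ?gt_eqF// !mulr1 (_ : l + (1 - l) = 1) ?mulr1//; ring.
Qed.

Variable q : R.
Hypotheses (q2 : 2 <= q) (fq : fmom q).

Let fpow x := h x `^ (q / 2).

Lemma half_sqr x : fpow x * fpow x = h x `^ q.
Proof.
have [hx|hx] := eqVneq (h x) 0.
  by rewrite /fpow hx !powR0 ?mul0r//; apply/eqP; have := q2; lra.
by rewrite /fpow -powRD ?hx ?implybT//; congr (_ `^ _); field.
Qed.

Lemma L2_fpow : L2 mu fpow.
Proof.
apply/L2P; split; first exact: measurable_powRf.
by move: fq; rewrite /fmom; congr (_.-integrable _ (_ \o _)); apply/funext => x; rewrite expr2 half_sqr.
Qed.

(** Interpolating the moment of order q/2 between the orders 1 and q has weight l = (q/2) / (q - 1),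
    and the squared mean gets the exponent 2 (1 - l) = (q - 2) / (q - 1). *)
Lemma vr_fpow : mom q - mom q `^ ((q - 2) / (q - 1)) <= vr mu fpow.
Proof.
have q2' := q2; have q1 : 0 < q - 1 by lra.
have qn := gt_eqF q1.
rewrite /vr (_ : ip mu fpow fpow = mom q); last first.
  by rewrite /ip; apply: eq_Rintegral => x _; rewrite half_sqr.
rewrite lerD2l lerN2 (_ : ip mu fpow (cst 1) = mom (q / 2)); last first.
  by rewrite /ip; apply: eq_Rintegral => x _; rewrite /= mulr1.
pose l := q / 2 / (q - 1).
have l0 : 0 <= l by rewrite !divr_ge0//; lra.
have l1 : l <= 1 by rewrite ler_pdivrMr//; lra.
have q20 : 0 < q / 2 by lra.
have q1' : 1 <= q by lra.
have [|_ H] := mom_interp q1' fq q20 l0 l1; first by rewrite /l; field; rewrite qn.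
have G0 : 0 < mom q by apply: lt_le_trans (mom_ge1 _ fq) => //; lra.
have -> : mom q `^ ((q - 2) / (q - 1)) = (mom q `^ (1 - l)) ^+ 2.
  rewrite expr2 -powRD; last by rewrite (gt_eqF G0) implybT.
  by congr (_ `^ _); rewrite /l; field; rewrite qn.
by rewrite lerXn2r ?nnegrE ?powR_ge0 ?mom_ge0.
Qed.

Lemma n2_center f c : L2 mu f ->
  n2 mu (f \- cst c) ^+ 2 = ip mu f f - 2 * c * ip mu f (cst 1) + c ^+ 2.
Proof.
move=> lf; have l1 : L2 mu (cst 1) by exact: L2_cst.
have lc := L2Z c l1.
have -> : f \- cst c = f \- (c \*o cst 1) by apply/funext => x; rewrite /= mulr1.
rewrite n2_sqr (ipBl lf lc (L2B lf lc)) (ipBr lf lc lf) (ipBr lf lc lc).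
rewrite (ipZl c l1 lf) (ipZr c lf l1) (ipZl c l1 lc) (ipZr c l1 l1) [ip mu (cst 1) f]ipC.
have -> : ip mu (cst 1) (cst 1) = 1 by rewrite -n2_sqr n2_cst normr1 expr1n.
ring.
Qed.

(** Expansion of |u - 2 v|^2 >= 0. The constant on u has to be small: its inverse 2/3 is regained
    from the logarithm in the rate. *)
Lemma ip_young u v : L2 mu u -> L2 mu v ->
  n2 mu (u \+ v) ^+ 2 <= 3 / 2 * n2 mu u ^+ 2 + 3 * n2 mu v ^+ 2.
Proof.
move=> lu lv; have lv2 := L2Z 2 lv.
rewrite !n2_sqr (ipDl lu lv (L2D lu lv)) (ipDr lu lv lu) (ipDr lu lv lv) [ip mu v u]ipC.
have := ip_ge0 mu (u \- (2 \*o v)).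
rewrite (ipBl lu lv2 (L2B lu lv2)) (ipBr lu lv2 lu) (ipBr lu lv2 lv2).
rewrite (ipZr 2 lu lv) (ipZl 2 lv lv2) (ipZl 2 lv lu) (ipZr 2 lv lv) [ip mu v u]ipC; lra.
Qed.

(** The mean minimises the L2 distance to constants, so the mean of g may be subtracted from f as
    well. *)
Lemma vr_split f g : L2 mu f -> L2 mu g ->
  vr mu f <= 3 / 2 * vr mu g + 3 * n2 mu (f \- g) ^+ 2.
Proof.
move=> lf lg; set c := ip mu g (cst 1).
have l1 : L2 mu (cst 1) by exact: L2_cst.
have lc : L2 mu (cst c) by exact: L2_cst.
apply: le_trans (_ : _ <= n2 mu (f \- cst c) ^+ 2) _.
  rewrite n2_center// /vr; have := sqr_ge0 (ip mu f (cst 1) - c); lra.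
have -> : vr mu g = n2 mu (g \- cst c) ^+ 2 by rewrite n2_center// /vr -/c; ring.
set u := g \- cst c; set v := f \- g.
have lu : L2 mu u by exact: L2B.
have lv : L2 mu v by exact: L2B.
have -> : f \- cst c = u \+ v by apply/funext => x; rewrite /u /v /=; ring.
exact: ip_young.
Qed.

End moments.

Section powR_facts.
Context {R : realType}.
Implicit Types x y al : R.

(** Makes the variance bound uniform on a time interval: F is nonincreasing, so the bound is
    smallest at the end. *)
Lemma sub_powR_nd x y al : 0 <= al -> al <= 1 -> 1 <= x -> x <= y -> x - x `^ al <= y - y `^ al.
Proof.
move=> al0 al1 x1 xy; have x0 : 0 < x by apply: lt_le_trans x1.
have yE : y = x * (y / x) by rewrite mulrC divfK ?gt_eqF.
have yx1 : 1 <= y / x by rewrite ler_pdivlMr// mul1r.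
have E : y `^ al = x `^ al * (y / x) `^ al by rewrite {1}yE powRM ?(ltW x0)// (le_trans _ yx1).
have H1 := ler1_powR yx1 al1; have H2 := ler1_powR x1 al1.
have H3 : x `^ al * (y / x) `^ al <= x `^ al * (y / x) by rewrite ler_wpM2l ?powR_ge0.
have H4 : x `^ al * (y / x - 1) <= x * (y / x - 1) by rewrite ler_wpM2r// subr_ge0.
rewrite -E in H3; rewrite [in X in _ <= X]mulrBr mulr1 -yE in H4.
lra.
Qed.

Lemma powR_inv x al : 0 <= x -> x^-1 `^ al = x `^ (- al).
Proof. by move=> x0; rewrite -(powR_inv1 x0) -powRrM mulN1r. Qed.

Lemma sqr_sub_le x y : 0 <= y -> y <= x -> (x - y) * (x - y) <= x * x.
Proof. by move=> y0 yx; apply: ler_pM; rewrite ?subr_ge0// lerBlDr lerDl. Qed.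

Lemma le_sqrt x y : 0 <= x -> 0 <= y -> x ^+ 2 <= y -> x <= Num.sqrt y.
Proof. by move=> x0 y0 H; rewrite -[x]ger0_norm// -sqrtr_sqr ler_wsqrtr. Qed.

Lemma ln_rate_ge r (aa : R) : 0 < r -> r < 1 -> 1 <= aa -> 3 / 2 <= ln (Num.max ((5 / r) `^ aa) 1).
Proof.
move=> r0 r1 a1; have mx0 : 0 < Num.max ((5 / r) `^ aa) 1 by rewrite lt_max ltr01 orbT.
apply: le_trans ln5_ge _; rewrite ler_ln ?posrE//.
rewrite le_max; apply/orP; left.
have r5 : 5 <= 5 / r by rewrite ler_pdivlMr//; lra.
apply: le_trans r5 _; rewrite -[leLHS]powRr1; last by rewrite divr_ge0// ltW.
by apply: ler_powR => //; rewrite ler_pdivlMr//; lra.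
Qed.

Lemma vr_arith (f g n W E : R) : f <= 3 / 2 * g + 3 * n -> n <= W -> E <= f ->
  2 / 3 * (E - 3 * W) <= g.
Proof. by move=> *; lra. Qed.

Lemma rate_arith (D E W b L X : R) : 0 <= D -> 0 <= W -> 3 / 2 <= L -> 0 <= b * X ->
  D * (2 / 3 * (E - 3 * W) - W) <= b * X -> D * (E - 5 * W) <= b * L * X.
Proof.
move=> D0 W0 L0 bX H; have := mulr_ge0 D0 W0.
have : 0 <= (L - 3 / 2) * (b * X) by rewrite mulr_ge0// subr_ge0.
by lra.
Qed.

End powR_facts.

(** * Dissipation of the q-th moment along the flow *)

Section entropy_dissipation.
Context {R : realType} {d : nat}.
Variables (V : 'rV[R]_d -> R) (k : R -> R.-pker 'rV[R]_d ~> 'rV[R]_d).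
Variable pi : probability 'rV[R]_d R.
Hypothesis hV : C1 V.
Hypothesis hpi : gibbs V pi.
Hypothesis hk : langevin_transition V k.
Hypothesis hsemi : L2_contraction_semigroup k pi.
Hypothesis hcore : smooth_core V k pi.
Variable beta : R -> R.
Hypothesis hwpi : weak_poincare pi beta (fun f => (osc f ^+ 2)%E).
Local Notation T := 'rV[R]_d.
Local Notation S := (semigroup k).
Local Notation L2 := (L2 pi).
Local Notation n2 := (n2 pi).
Local Notation ip := (ip pi).
Local Notation vr := (vr pi).
Local Notation mom := (mom pi).
Local Notation fmom := (fmom pi).

Lemma mom_S n t f : 1 <= n -> 0 <= t -> L2 f -> (forall x, 0 <= f x) -> fmom f n ->
  fmom (S t f) n /\ mom (S t f) n <= mom f n.
Proof.
move=> n1 t0 lf f0 ff; have S0 x : 0 <= S t f x by exact: S_ge0.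
have mS := L2_meas (S_L2 hsemi t0 lf).
have J := jensen hV hpi hk hsemi hcore t0 lf f0 (J := fun x => x `^ n)
  (p := fun x => n * x `^ (n - 1)) (measurable_powR n) (fun y _ => powR_ge0 y n)
  (fun x y x0 y0 => powR_tangent x0 y0 n1).
have fin : (\int[pi]_x (f x `^ n)%:E)%E \is a fin_num by exact: (integrable_fin_num measurableT ff).
have fS : fmom (S t f) n.
  apply/integrableP; split; first exact/measurable_EFinP/measurable_powRf.
  under eq_integral do rewrite /= ger0_norm ?powR_ge0//.
  by apply: le_lt_trans J _; rewrite ltey_eq fin.
by split; [exact: fS|exact: Rintegral_le_ereal fS ff J].
Qed.

Lemma mom_ae n f g : measurable_fun setT f -> measurable_fun setT g ->
  {ae pi, forall x, f x = g x} -> mom f n = mom g n.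
Proof.
move=> mf mg fg; rewrite /mom /Rintegral; congr fine; apply: ae_eq_integral => //.
- exact/measurable_EFinP/measurable_powRf.
- exact/measurable_EFinP/measurable_powRf.
- by apply: filterS fg => x E _; rewrite E.
Qed.

Variables (q : R) (h : T -> R).
Hypotheses (q2 : 2 <= q) (lh : L2 h) (h0 : forall x, 0 <= h x).
Hypothesis h1 : \int[pi]_x h x = 1.
Hypothesis fq : fmom h q.
Let F t := mom (S t h) q.
Let q1 : 1 <= q. Proof. by have := q2; lra. Qed.
Let mS t : 0 <= t -> measurable_fun setT (S t h).
Proof. by move=> t0; exact: L2_meas (S_L2 hsemi t0 lh). Qed.
Let Sh0 t x : 0 <= S t h x. Proof. exact: S_ge0. Qed.

Lemma mass_S t : 0 <= t -> \int[pi]_x S t h x = 1.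
Proof.
move=> t0; have := S_sym hV hpi hk hsemi hcore t0 lh (L2_cst pi 1).
rewrite S_cst /ip; under eq_Rintegral do rewrite mulr1.
by under [in RHS]eq_Rintegral do rewrite mulr1; rewrite h1.
Qed.

Lemma F_fin t : 0 <= t -> fmom (S t h) q.
Proof. by move=> t0; have [] := mom_S q1 t0 lh h0 fq. Qed.

Lemma F_ge1 t : 0 <= t -> 1 <= F t.
Proof. by move=> t0; exact: (mom_ge1 (mS t0) (Sh0 t) (mass_S t0) q1 (F_fin t0)). Qed.

Lemma F_nd s t : 0 <= s -> s <= t -> F t <= F s.
Proof.
move=> s0 st; have ts0 : 0 <= t - s by rewrite subr_ge0.
have ls := S_L2 hsemi s0 lh.
have [_ H] := mom_S q1 ts0 ls (Sh0 s) (F_fin s0).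
apply: le_trans H; rewrite le_eqVlt; apply/orP; left; apply/eqP.
apply: mom_ae; [exact: mS (le_trans s0 st)|exact: L2_meas (S_L2 hsemi ts0 ls)|].
by have := S_semi hk hsemi ts0 s0 lh; rewrite subrK.
Qed.

Lemma F0E : F 0 = mom h q.
Proof. by rewrite /F (S0 hk)//; exact: L2_meas lh. Qed.

Let al := (q - 2) / (q - 1).
Let al01 : 0 <= al <= 1.
Proof.
have q2' := q2; rewrite /al divr_ge0//=; [|lra|lra].
by rewrite ler_pdivrMr; lra.
Qed.

Lemma F_diss s t a r K : 0 < a -> 0 < r -> 0 <= s -> s < t ->
  (forall v, s <= v -> v <= t -> K <= vr (fun x => (Num.min (S v h x) a) `^ (q / 2))) ->
  (t - s) * (K - r * a `^ q) <= beta r * (cq q / q * (F s - F t)).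
Proof. exact: (dissipation hV hpi hk hsemi hcore hwpi q2 lh h0 F_fin). Qed.

Lemma vr_S_ge v t : 0 <= v -> v <= t -> F t - F t `^ al <= vr (fun x => S v h x `^ (q / 2)).
Proof.
move=> v0 vt; have t0 := le_trans v0 vt; have /andP[a0 a1] := al01.
apply: le_trans (vr_fpow (mS v0) (Sh0 v) (mass_S v0) q2 (F_fin v0)).
exact: (sub_powR_nd a0 a1 (F_ge1 t0) (F_nd v0 vt)).
Qed.

(** Averaging against the kernels preserves the bound M, so truncation at level M is inactive. *)
Lemma diss_bounded M r s t : 0 < M -> (forall x, h x <= M) -> 0 < r -> 0 <= s -> s < t ->
  (t - s) * (F t - F t `^ al - r * M `^ q) <= beta r * (cq q / q * (F s - F t)).
Proof.
move=> M0 hM r0 s0 st; apply: F_diss => // v sv vt; have v0 := le_trans s0 sv.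
have SM x : S v h x <= M.
  rewrite -[leRHS](_ : S v (cst M) x = M); last by rewrite S_cst.
  have fk : (k v x setT < +oo)%E by rewrite prob_kernel ltry.
  apply: le_Rintegral => //.
  - apply: measurable_bounded_integrable => //; first exact: L2_meas lh.
    exists M; split; first exact: num_real.
    by move=> N MN y _; rewrite /= ger0_norm// (le_trans (hM y)) ?ltW.
  - apply: measurable_bounded_integrable => //.
    by exists `|M|; split; [exact: num_real|move=> N MN y _; exact: ltW].
rewrite (_ : (fun x => _) = fun x => S v h x `^ (q / 2)); first exact: vr_S_ge.
by apply/funext => x; rewrite min_l.
Qed.

(* Lower semicontinuity: bound F t from below by the tangent of x^q at the truncation
   of h, which pairs S t h with a bounded function. *)
Lemma F_lsc c : (forall t, 0 < t -> F t <= c) -> F 0 <= c.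
Proof.
move=> H; rewrite F0E; have q2' := q2.
have c0 : 0 <= c by apply: le_trans (H 1 _); rewrite ?mom_ge0.
have mh := L2_meas lh.
pose tr (m : nat) x := Num.min (h x) m%:R.
have tr0 m x : 0 <= tr m x by rewrite le_min h0 ler0n.
have mtr m : measurable_fun setT (tr m) by apply: measurable_minr => //; exact: measurable_cst.
have trm (m : nat) n x : 0 <= n -> `|tr m x `^ n| <= m%:R `^ n.
  move=> n0; rewrite ger0_norm ?powR_ge0//; apply: powR_le => //.
  by rewrite ge_min lexx orbT.
have ltr m n : 0 <= n -> L2 (fun x => tr m x `^ n).
  by move=> n0; apply: (@L2_bnd _ _ _ _ _ (m%:R `^ n)); [exact: measurable_powRf|move=> x; exact: trm].
have q10 : 0 <= q - 1 by lra.
have K m : mom (tr m) q <= c.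
  have lq := ltr m _ q10; have lt1 : L2 (tr m).
    by apply: (@L2_bnd _ _ _ _ _ m%:R) => // x; rewrite ger0_norm// ge_min lexx orbT.
  have lqq : L2 (fun x => tr m x `^ q) by apply: ltr; lra.
  have n0 := n2_ge0 pi (fun x => tr m x `^ (q - 1)).
  have C0 : 0 <= q * n2 (fun x => tr m x `^ (q - 1)) by rewrite mulr_ge0//; lra.
  apply: (le_of_small_error C0) => e e0 e1.
  have [dl dl0 Hd] := S_cont0 hk hsemi lh e0.
  have t0 : 0 < dl / 2 by rewrite divr_gt0.
  have tdl : dl / 2 < dl by lra.
  have Hn := Hd _ (ltW t0) tdl; have HF := H _ t0.
  have lS := S_L2 hsemi (ltW t0) lh.
  set t := dl / 2 in t0 tdl Hn HF lS *.
  have iS := F_fin (ltW t0).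
  have E : mom (tr m) q + q * ip (fun x => tr m x `^ (q - 1)) (S t h \- tr m) <= F t.
    have i1 : pi.-integrable setT (EFin \o (fun x => tr m x `^ q)) by exact: L2_int.
    have i2 := L2_int_mul lq (L2B lS lt1); have i3 := integrable_mulc q i2.
    rewrite /ip -(RintegralZl q measurableT i2) -(RintegralD measurableT i1 i3).
    apply: (le_Rintegral measurableT (integrable_add i1 i3) iS) => x _ /=.
    by rewrite mulrA; apply: powR_tangent.
  have E2 : 0 <= ip (fun x => tr m x `^ (q - 1)) (h \- tr m).
    by apply: Rintegral_ge0 => x _; rewrite mulr_ge0 ?powR_ge0//= subr_ge0 ge_min lexx.
  have E3 : `|ip (fun x => tr m x `^ (q - 1)) (S t h \- h)| <= n2 (fun x => tr m x `^ (q - 1)) * e.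
    apply: le_trans (CS lq (L2B lS lh)) _; exact: ler_wpM2l.
  have E4 : ip (fun x => tr m x `^ (q - 1)) (S t h \- tr m) =
      ip (fun x => tr m x `^ (q - 1)) (S t h \- h) + ip (fun x => tr m x `^ (q - 1)) (h \- tr m).
    rewrite -(ipDr (L2B lS lh) (L2B lh lt1) lq); congr (ip _ _).
    by apply/funext => x /=; rewrite addrA subrK.
  rewrite E4 in E; move: E3; rewrite ler_norml => /andP[E3 _].
  have q0 : 0 <= q by lra.
  have := ler_wpM2l q0 E3; have := mulr_ge0 q0 E2; move: E HF.
  generalize (ip (fun x => tr m x `^ (q - 1)) (S t h \- h)) (ip (fun x => tr m x `^ (q - 1)) (h \- tr m))
    (n2 (fun x => tr m x `^ (q - 1))) (mom (tr m) q) (F t).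
  by move=> *; lra.
have q20 : 0 <= q / 2 by lra.
have [|||_] := @fatou_L2 _ _ _ pi (fun m x => tr m x `^ (q / 2)) (fun x => h x `^ (q / 2)) (Num.sqrt c) (fun m => ltr m _ q20).
- move=> m; apply: le_sqrt => //; first exact: n2_ge0.
  rewrite n2_sqr; apply: le_trans (K m); rewrite le_eqVlt; apply/orP; left; apply/eqP.
  by rewrite /ip /mom; apply: eq_Rintegral => x _; exact: half_sqr.
- exact: measurable_powRf.
- apply: nearW => x; apply: (@cvg_near_cst _ _ (h x `^ (q / 2))).
  have [N _ HN] := nbhs_infty_ger (h x).
  by exists N => // n Nn; rewrite /tr min_l//; exact: HN.
move=> Hn; have -> : mom h q = n2 (fun x => h x `^ (q / 2)) ^+ 2.
  by rewrite n2_sqr /ip /mom; apply: eq_Rintegral => x _; rewrite half_sqr.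
rewrite -[leRHS](sqr_sqrtr c0) lerXn2r// nnegrE ?sqrtr_ge0 ?n2_ge0//.
Qed.

Variable q' : R.
Hypotheses (qq' : q < q') (fq' : fmom h q').
Let G := mom h q'.
(** Equals exp (q R) for R = ln G / (q' - 1), the divergence of order q'. *)
Let delta := G `^ (q / (q' - 1)).
Let q'1 : 1 <= q'. Proof. by have := qq'; have := q1; lra. Qed.
Let mh : measurable_fun setT h. Proof. exact: L2_meas lh. Qed.
Let G1 : 1 <= G. Proof. exact: (mom_ge1 mh h0 h1 q'1 fq'). Qed.
Let G0 : 0 < G. Proof. exact: lt_le_trans G1. Qed.
Let cc := q / (q' - q).
Let aa := q' / (q' - q).

Lemma delta_ge1 : 1 <= delta.
Proof.
have q2' := q2; have qq := qq'.
by rewrite -(powRr0 G) /delta; apply: ler_powR => //; rewrite divr_ge0//; lra.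
Qed.

Lemma F0_le_delta : mom h q <= G `^ ((q - 1) / (q' - 1)).
Proof.
have q2' := q2; have qq := qq'; have q'0 : 0 < q' - 1 by lra.
have q'n := gt_eqF q'0.
pose l := (q' - q) / (q' - 1).
have l0 : 0 <= l by rewrite divr_ge0//; lra.
have l1 : l <= 1 by rewrite ler_pdivrMr//; lra.
have qp : 0 < q by lra.
have [|_] := mom_interp mh h0 h1 q'1 fq' qp l0 l1; first by rewrite /l; field; rewrite q'n.
by rewrite (_ : 1 - l = (q - 1) / (q' - 1))// /l; field; rewrite q'n.
Qed.

Lemma G_le_delta : G `^ ((q - 1) / (q' - 1)) <= delta.
Proof.
have q2' := q2; have qq := qq'.
by apply: ler_powR => //; rewrite ler_pM2r ?invr_gt0; lra.
Qed.

(* Truncation level for which the tail of the q'-th moment above the level and the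
   oscillation term at r' = (r / 5)^aa are both at most r delta / 5. *)
Let lev r := (delta * (5 / r) `^ cc) `^ q^-1.

Let lev_pow r : lev r `^ q = delta * (5 / r) `^ cc.
Proof.
have q2' := q2; rewrite /lev -powRrM mulVf ?powRr1//; last by apply/eqP; lra.
by rewrite mulr_ge0 ?powR_ge0.
Qed.

Let lev_gt0 r : 0 < r -> 0 < lev r.
Proof. by move=> r0; apply/powR_gt0/mulr_gt0; apply: powR_gt0 => //; apply: divr_gt0. Qed.

Let lev_s r : 0 < r -> (r / 5) `^ aa * lev r `^ q = r * delta / 5.
Proof.
move=> r0; have qq := qq'; have qn : q' - q == 0 = false by apply/eqP; lra.
have r50 : 0 < r / 5 by rewrite divr_gt0.
rewrite lev_pow (_ : 5 / r = (r / 5)^-1); last by rewrite invf_div.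
rewrite (powR_inv _ (ltW r50)) mulrCA -powRD; last by rewrite (gt_eqF r50) implybT.
rewrite (_ : aa + - cc = 1) ?powRr1 ?(ltW r50)//; first by rewrite mulrA [r * delta]mulrC.
by rewrite /aa /cc; field; rewrite qn.
Qed.

Let lev_tail r : 0 < r -> lev r `^ (q - q') * G <= r * delta / 5.
Proof.
move=> r0; have q2' := q2; have qq := qq'; have qn : q' - q == 0 = false by apply/eqP; lra.
have qp : q == 0 = false by apply/eqP; lra.
have q'n : q' - 1 == 0 = false by apply/eqP; lra.
have r50 : 0 < r / 5 by rewrite divr_gt0.
have H : lev r `^ (q - q') = G `^ ((q - q') / (q' - 1)) * (r / 5).
  rewrite /lev -powRrM powRM ?powR_ge0// /delta -powRrM; congr (_ * _).
    by congr (_ `^ _); field; rewrite qp q'n.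
  rewrite (_ : 5 / r = (r / 5)^-1); last by rewrite invf_div.
  rewrite (powR_inv _ (ltW r50)) -!powRrM -[RHS]powRr1 ?(ltW r50)//; congr (_ `^ _).
  by rewrite /cc; field; rewrite qp qn.
rewrite H mulrAC -{2}(powRr1 (ltW G0)) -powRD; last by rewrite (gt_eqF G0) implybT.
rewrite (_ : _ + 1 = (q - 1) / (q' - 1)); last by field; rewrite q'n.
have := ler_wpM2r (ltW r50) G_le_delta; lra.
Qed.

Lemma diss_moment r s t : 0 < r -> 0 <= s -> s < t ->
  (t - s) * (F t - F t `^ al - r * delta) <=
  renyi_rate beta q q'%:E r * (cq q / q * (F s - F t)).
Proof.
move=> r0 s0 st; have q2' := q2; have qq := qq'; have t0 : 0 <= t by lra.
have q20 : 0 <= q / 2 by lra.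
have qq0 : 0 <= q' - q by lra.
have X0 : 0 <= cq q / q * (F s - F t).
  rewrite mulr_ge0//; last by rewrite subr_ge0 F_nd// ltW.
  rewrite /cq divr_ge0//; last by lra.
  by rewrite divr_ge0 ?sqr_ge0// mulr_ge0//; lra.
have rr0 : 0 < (r / 5) `^ aa by rewrite powR_gt0// divr_gt0.
have b0 := wpi_weight_ge0 hwpi rr0.
have d1 := delta_ge1.
rewrite /renyi_rate -/aa.
have ln0 : 0 <= ln (Num.max ((5 / r) `^ aa) 1) by rewrite ln_ge0// le_max lexx orbT.
(* For r >= 1 the left-hand side is nonpositive, as F t <= F 0 <= delta <= r delta; this covers r >=
   5, where the rate vanishes. *)
have [r1|r1] := leP 1 r.
  apply: le_trans (_ : _ <= 0) _; last by rewrite mulr_ge0// mulr_ge0.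
  apply: mulr_ge0_le0; first by rewrite subr_ge0 ltW.
  have H1 := F_nd (lexx 0) t0; rewrite F0E in H1.
  have H2 : delta <= r * delta by rewrite ler_peMl// (le_trans ler01).
  have H3 := le_trans H1 (le_trans (le_trans F0_le_delta G_le_delta) H2).
  by rewrite -addrA -opprD subr_le0 (le_trans H3)// lerDr powR_ge0.
have aa1 : 1 <= aa by rewrite /aa ler_pdivlMr ?mul1r ?subr_gt0// gerBl; exact: le_trans q2'.
have lnge := ln_rate_ge r0 r1 aa1.
pose W := r * delta / 5; pose E := F t - F t `^ al.
have HK v : s <= v -> v <= t ->
    2 / 3 * (E - 3 * W) <= vr (fun x => Num.min (S v h x) (lev r) `^ (q / 2)).
  move=> sv vt; have v0 := le_trans s0 sv.
  have lev0 := ltW (lev_gt0 r0).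
  have mv := mS v0.
  have lf : L2 (fun x => S v h x `^ (q / 2)) by exact: (L2_fpow mv q2 (F_fin v0)).
  have lg : L2 (fun x => Num.min (S v h x) (lev r) `^ (q / 2)).
    apply: (@L2_bnd _ _ _ _ _ (lev r `^ (q / 2))).
      by apply: measurable_powRf; apply: measurable_minr => //; exact: measurable_cst.
    move=> x; rewrite ger0_norm ?powR_ge0//; apply: powR_le => //.
      by rewrite le_min Sh0.
    by rewrite ge_min lexx orbT.
  have H := vr_split lf lg.
  (* The difference lives where S v h exceeds the level; there (S v h)^q is at most lev^(q-q') (S v
     h)^q', and the q'-th moment does not increase in time. *)
  have Hn : n2 ((fun x => S v h x `^ (q / 2)) \- (fun x => Num.min (S v h x) (lev r) `^ (q / 2))) ^+ 2 <= W.
    have [fv Gv] := mom_S q'1 v0 lh h0 fq'.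
    apply: le_trans (lev_tail r0).
    apply: le_trans (ler_wpM2l (powR_ge0 (lev r) (q - q')) Gv).
    rewrite n2_sqr /mom -(RintegralZl _ measurableT fv).
    apply: (le_Rintegral measurableT (L2_int_mul (L2B lf lg) (L2B lf lg)) (integrable_mulc _ fv)) => x _ /=.
    have [hx|hx] := leP (S v h x) (lev r).
      by rewrite subrr mul0r mulr_ge0 ?powR_ge0.
    have A : lev r `^ (q / 2) <= S v h x `^ (q / 2) by apply: powR_le => //; exact: ltW.
    apply: le_trans (_ : _ <= S v h x `^ (q / 2) * S v h x `^ (q / 2)) _.
      exact: sqr_sub_le (powR_ge0 _ _) A.
    rewrite (half_sqr (S v h) q2).
    have hx0 : 0 < S v h x by apply: le_lt_trans hx.
    rewrite (_ : S v h x `^ q = S v h x `^ ((q - q') + q')); last by rewrite subrK.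
    rewrite powRD; last by rewrite (gt_eqF hx0) implybT.
    apply: ler_wpM2r; first exact: powR_ge0.
    rewrite -(opprB q' q).
    rewrite !powRN lef_pV2; [|exact: (powR_gt0 _ hx0)|exact: (powR_gt0 _ (lev_gt0 r0))].
    by apply: powR_le => //; exact: ltW.
  have He := vr_S_ge v0 vt.
  exact: vr_arith H Hn He.
have H := F_diss (lev_gt0 r0) rr0 s0 st HK.
rewrite lev_s// -/W in H.
have W0 : 0 <= W by rewrite /W divr_ge0// mulr_ge0 ?powR_ge0// ltW.
have -> : r * delta = 5 * W by rewrite /W [RHS]mulrC divfK.
by apply: rate_arith H => //; [rewrite subr_ge0 ltW|exact: mulr_ge0].
Qed.

End entropy_dissipation.

(** * Densities and the Renyi divergence *)


Section density.
Local Open Scope charge_scope.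
Context d (T : measurableType d) (R : realType).
Implicit Types (rho pi : probability T R) (h : T -> R).

(** A real-valued representative, nonnegative everywhere, so that moments are real integrals and the
    kernels can integrate it pointwise. *)
Definition density rho pi h := [/\ measurable_fun setT h, forall x, 0 <= h x &
  forall A, measurable A -> rho A = (\int[pi]_(x in A) (h x)%:E)%E].

Lemma density_int rho pi h : density rho pi h -> pi.-integrable setT (EFin \o h).
Proof.
case=> mh h0 H; apply/integrableP; split; first exact/measurable_EFinP.
under eq_integral do rewrite /= ger0_norm//.
by rewrite -H// probability_setT ltry.
Qed.

Lemma density_mass rho pi h : density rho pi h -> \int[pi]_x h x = 1.
Proof.
move=> [mh h0 H]; rewrite /Rintegral -H//.
by transitivity (fine (1%E : \bar R)) => //; congr fine; exact: probability_setT.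
Qed.

Lemma density_dom rho pi h : density rho pi h -> rho `<< pi.
Proof.
move=> [mh h0 H]; apply/null_content_dominatesP => A mA A0.
by rewrite H// null_set_integral//; exact/measurable_funTS/measurable_EFinP.
Qed.

Lemma density_ex rho pi : rho `<< pi -> exists h, density rho pi h.
Proof.
move=> dom; pose f := Radon_Nikodym_SigmaFinite.f rho pi.
have ff x : f x \is a fin_num by exact: Radon_Nikodym_SigmaFinite.f_fin_num.
have f0 x : (0 <= f x)%E by exact: Radon_Nikodym_SigmaFinite.f_ge0.
have mf : measurable_fun setT f.
  exact: (measurable_int pi (Radon_Nikodym_SigmaFinite.f_integrable dom)).
exists (fun x => fine (f x)); split.
- by apply/measurable_EFinP; rewrite (_ : _ \o _ = f)//; apply/funext => x; rewrite /= fineK.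
- by move=> x; exact: fine_ge0.
- move=> A mA; rewrite (Radon_Nikodym_SigmaFinite.f_integral dom)//.
  by apply: eq_integral => x _; rewrite fineK.
Qed.

Lemma density_RN rho pi h : density rho pi h ->
  {ae pi, forall x, 'd (charge_of_finite_measure rho) '/d pi x = (h x)%:E}.
Proof.
move=> D; have dom := density_dom D; have iD := density_int D; have [mh h0 H] := D.
have : ae_eq pi setT (EFin \o h) ('d (charge_of_finite_measure rho) '/d pi).
  apply: integral_ae_eq => //.
  move=> A AE mA; rewrite -Radon_Nikodym_integral//.
  by rewrite /charge_of_finite_measure /= H.
by apply: filterS => x /(_ I) E; exact/esym.
Qed.

Lemma density_ae rho pi h h' : density rho pi h -> measurable_fun setT h' -> (forall x, 0 <= h' x) ->
  {ae pi, forall x, h x = h' x} -> density rho pi h'.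
Proof.
move=> [mh h0 H] mh' h'0 E; split=> // A mA; rewrite H//.
apply: ae_eq_integral => //; [exact/measurable_funTS/measurable_EFinP..|].
by apply: filterS E => x -> _.
Qed.

Lemma renyi_lne q rho pi h : 1 < q -> density rho pi h ->
  (renyi q%:E rho pi = ((q - 1)^-1)%:E * lne (\int[pi]_x (h x `^ q)%:E))%E.
Proof.
move=> q1 D; have dom := density_dom D; have [mh h0 _] := D.
have mRN : measurable_fun setT ('d (charge_of_finite_measure rho) '/d pi).
  by apply: measurable_int; exact: Radon_Nikodym_integrable.
rewrite /renyi asboolT//; congr (_ * lne _)%E.
rewrite powR_Lnorm; last by apply/eqP; lra.
apply: ae_eq_integral => //.
- by apply: (@measurableT_comp _ _ _ _ _ _ (fun x => poweR x q)); [exact: measurable_poweR|exact: measurableT_comp].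
- exact/measurable_EFinP/measurable_powRf.
by apply: filterS (density_RN D) => x -> _; rewrite /= ger0_norm// poweR_EFin.
Qed.

Lemma renyi_mom q rho pi h : 1 < q -> density rho pi h -> fmom pi h q ->
  renyi q%:E rho pi = (ln (mom pi h q) / (q - 1))%:E.
Proof.
move=> q1 D fq; have [mh h0 _] := D.
have G0 : 0 < mom pi h q.
  by apply: lt_le_trans (mom_ge1 mh h0 (density_mass D) (ltW q1) fq).
rewrite (renyi_lne q1 D) -(fineK (integrable_fin_num measurableT fq)) lne_EFin//.
by rewrite -EFinM mulrC.
Qed.

Lemma renyi_fmom q rho pi h : 1 < q -> density rho pi h ->
  (renyi q%:E rho pi < +oo)%E -> fmom pi h q.
Proof.
move=> q1 D; have [mh h0 _] := D; rewrite (renyi_lne q1 D) => H.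
apply/integrableP; split; first exact/measurable_EFinP/measurable_powRf.
under eq_integral do rewrite /= ger0_norm ?powR_ge0//.
rewrite ltNge leye_eq; apply/negP => /eqP E; move: H.
by rewrite E /= gt0_muley ?ltxx// lte_fin invr_gt0; lra.
Qed.

(** The essential supremum is at least the mean 1 of the density, so its logarithm is that of a real
    M >= 1. *)
Lemma renyi_oo rho pi h : density rho pi h -> (renyi +oo rho pi < +oo)%E ->
  exists M, [/\ 1 <= M, renyi +oo rho pi = (ln M)%:E & {ae pi, forall x, h x <= M}].
Proof.
move=> D; have dom := density_dom D; have [mh h0 _] := D.
have pT : (0 < pi setT)%E by rewrite probability_setT.
have E : renyi +oo rho pi = lne (ess_sup pi (EFin \o h)).
  rewrite /renyi asboolT// unlock pT; congr lne; apply: eq_ess_sup.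
  by apply: filterS (density_RN D) => x Hx /=; rewrite Hx /= ger0_norm.
rewrite E; set M := ess_sup _ _.
have HM : {ae pi, forall x, ((h x)%:E <= M)%E} by exact: ess_sup_ge.
have M1 : (1 <= M)%E.
  have H : (\int[pi]_x (h x)%:E = 1)%E.
    by rewrite -[LHS]fineK; [congr (_%:E); exact: density_mass D|exact: (integrable_fin_num measurableT (density_int D))].
  have : (\int[pi]_x (h x)%:E <= \int[pi]_x M)%E.
    have M0 : (0 <= M)%E by apply: ess_sup_gee => //; apply: nearW => x; rewrite lee_fin.
    apply: ae_ge0_le_integral => //.
    - by move=> x _; rewrite lee_fin.
    - exact/measurable_EFinP.
    - by apply: filterS HM => x hx _.
  by rewrite H integral_cst_prob.
case: M HM M1 => [M||] HM M1 //; move=> _.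
exists M; split; first by rewrite lee_fin in M1.
  by rewrite lne_EFin//; apply: lt_le_trans ltr01 _; rewrite lee_fin in M1.
by apply: filterS HM => x; rewrite lee_fin.
Qed.

End density.

Section law.
Context {R : realType} {d : nat}.
Variables (V : 'rV[R]_d -> R) (k : R -> R.-pker 'rV[R]_d ~> 'rV[R]_d).
Variable pi : probability 'rV[R]_d R.
Hypothesis hV : C1 V.
Hypothesis hpi : gibbs V pi.
Hypothesis hk : langevin_transition V k.
Hypothesis hsemi : L2_contraction_semigroup k pi.
Hypothesis hcore : smooth_core V k pi.
Local Notation T := 'rV[R]_d.
Local Notation S := (semigroup k).

(** The Markov property from time 0 gives the probability of A as the pairing of S t 1_A with h, and
    symmetry moves S t onto h. *)
Lemma law_density (dW : measure_display) (W : measurableType dW) (P : probability W R)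
  (F : R -> set (set W)) (B X : R -> {RV P >-> 'rV[R]_d}) (h : T -> R) t :
  langevin_diffusion V k F B X -> 0 <= t -> density (distribution P (X 0)) pi h -> L2 pi h ->
  density (distribution P (X t)) pi (S t h).
Proof.
move=> [sde mk] t0 [mh h0 H] lh; have lS := S_L2 hsemi t0 lh.
split; [exact: L2_meas lS|exact: S_ge0|] => A mA.
have FT : F 0 setT.
  have [sf _ _] := sde_filtration sde; have sF := sf 0 (lexx _).
  rewrite -(setD0 setT); have [s0 sC _] := sF; exact: sC s0.
have E : P (X t @^-1` A) = (\int[P]_w k t (X 0%R w) A)%E.
  have := mk 0 t setT A (lexx _) t0 FT mA; rewrite setTI subr0; exact.
have mkA : measurable_fun setT (fun x => k t x A) by exact: measurable_kernel.
have lA := L2_indic pi mA.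
apply: (etrans E).
transitivity (\int[distribution P (X 0%R)]_x k t x A)%E.
  by rewrite ge0_integral_distribution.
rewrite (integral_density mh h0 H)//.
transitivity ((ip pi (S t (\1_A)) h)%:E).
  rewrite /ip /Rintegral fineK.
    by apply: eq_integral => x _; rewrite EFinM S_indic.
  exact: (integrable_fin_num measurableT (L2_int_mul (S_L2 hsemi t0 lA) lh)).
rewrite (S_sym hV hpi hk hsemi hcore t0 lA lh) /ip /Rintegral fineK; last first.
  exact: (integrable_fin_num measurableT (L2_int_mul lA lS)).
rewrite [RHS]integral_mkcond; apply: eq_integral => x _.
by rewrite patchE indicE; case: ifP => /= _; rewrite ?mul1r ?mul0r.
Qed.

End law.

Lemma renyi_rate_ge0 (R : realType) (beta : R -> R) (q : R) (q' : \bar R) r :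
  (forall r, 0 < r -> 0 <= beta r) -> (q%:E < q')%E -> 0 < r -> 0 <= renyi_rate beta q q' r.
Proof.
move=> b0; case: q' => [q'||] //= qq' r0; last exact: b0.
rewrite mulr_ge0 ?b0 ?powR_gt0 ?divr_gt0//.
by rewrite ln_ge0// le_max lexx orbT.
Qed.

Lemma renyi_rate_noninc (R : realType) (beta : R -> R) (q : R) (q' : \bar R) r s :
  (forall r, 0 < r -> 0 <= beta r) -> (forall r s, 0 < r -> r <= s -> beta s <= beta r) ->
  0 <= q -> (q%:E < q')%E -> 0 < r -> r <= s -> renyi_rate beta q q' s <= renyi_rate beta q q' r.
Proof.
move=> b0 bn q0; case: q' => [q'||] //= qq' r0 rs; last exact: bn.
have s0 : 0 < s by exact: lt_le_trans rs.
rewrite lte_fin in qq'.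
have a0 : 0 <= q' / (q' - q) by rewrite divr_ge0//; lra.
have r5 : 0 < r / 5 by rewrite divr_gt0.
have s5 : 0 < s / 5 by rewrite divr_gt0.
apply: ler_pM.
- by rewrite b0// powR_gt0.
- by rewrite ln_ge0// le_max lexx orbT.
- by apply: bn; [exact: powR_gt0|apply: powR_le => //; [exact: ltW|rewrite ler_pM2r]].
have mx x : 0 < Num.max ((5 / x) `^ (q' / (q' - q))) 1 by rewrite lt_max ltr01 orbT.
rewrite ler_ln ?posrE// ge_max le_max [X in _ && X]le_max lexx orbT andbT; apply/orP; left.
apply: powR_le => //; first by rewrite divr_ge0// ltW.
by rewrite ler_pM2l// lef_pV2.
Qed.

(** * Finite and infinite q' combined *)

Section assembly.
Context {R : realType} {d : nat}.
Variables (V : 'rV[R]_d -> R) (k : R -> R.-pker 'rV[R]_d ~> 'rV[R]_d).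
Variable pi : probability 'rV[R]_d R.
Hypothesis hV : C1 V.
Hypothesis hpi : gibbs V pi.
Hypothesis hk : langevin_transition V k.
Hypothesis hsemi : L2_contraction_semigroup k pi.
Hypothesis hcore : smooth_core V k pi.
Variable beta : R -> R.
Hypothesis hwpi : weak_poincare pi beta (fun f => (osc f ^+ 2)%E).
Local Notation T := 'rV[R]_d.
Local Notation S := (semigroup k).

(** The semigroup is controlled on L2 only; interpolating between the orders 1 and n supplies the
    second moment. *)
Lemma fmom_L2 (h : T -> R) n : measurable_fun setT h -> (forall x, 0 <= h x) -> 2 <= n ->
  \int[pi]_x h x = 1 -> fmom pi h n -> L2 pi h.
Proof.
move=> mh h0 n2' h1 fn; apply/L2P; split=> //.
have n0 : 1 <= n by lra.
pose l := (n - 2) / (n - 1); have n10 : 0 < n - 1 by lra.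
have l0 : 0 <= l by rewrite divr_ge0//; lra.
have l1 : l <= 1 by rewrite ler_pdivrMr//; lra.
have [|f2 _] := mom_interp mh h0 h1 n0 fn (ltr0Sn R 1) l0 l1.
  by rewrite /l; field; rewrite gt_eqF.
by move: f2; rewrite /fmom; congr (_.-integrable _ (_ \o _)); apply/funext => x; rewrite powR_mulrn.
Qed.

(** Common interface for finite and infinite q': the dissipation inequality takes the same form in
    both, so the decay argument is carried out once. *)
Lemma initial_density (rho : probability T R) (q : R) (q' : \bar R) :
  2 <= q -> (q%:E < q')%E -> (renyi q' rho pi < +oo)%E ->
  let delta := expR (q * fine (renyi q' rho pi)) in
  exists h, [/\ density rho pi h, L2 pi h, fmom pi h q, 1 <= delta &
    forall r s t, 0 < r -> 0 <= s -> s < t ->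
      (t - s) * (mom pi (S t h) q - mom pi (S t h) q `^ ((q - 2) / (q - 1)) - r * delta) <=
      renyi_rate beta q q' r * (cq q / q * (mom pi (S s h) q - mom pi (S t h) q))].
Proof.
move=> q2; case: q' => [q'||] // qq' fin delta.
  rewrite lte_fin in qq'.
  have q'1 : 1 < q' by lra.
  have dom : rho `<< pi.
    by move: fin; rewrite /renyi; case: asboolP => // _; rewrite ltxx.
  have [h D] := density_ex dom; have [mh h0 _] := D.
  have h1 := density_mass D.
  have fq' := renyi_fmom q'1 D fin.
  have q'2 : 2 <= q' by lra.
  have lh := fmom_L2 mh h0 q'2 h1 fq'.
  have fq : fmom pi h q.
    pose l := (q' - q) / (q' - 1); have q'0 : 0 < q' - 1 by lra.
    have l0 : 0 <= l by rewrite divr_ge0//; lra.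
    have l1 : l <= 1 by rewrite ler_pdivrMr//; lra.
    have qp : 0 < q by lra.
    have [|//] := mom_interp mh h0 h1 (ltW q'1) fq' qp l0 l1.
    by rewrite /l; field; rewrite gt_eqF.
  have G1 := mom_ge1 mh h0 h1 (ltW q'1) fq'.
  have G0 : 0 < mom pi h q' by apply: lt_le_trans G1.
  have dE : delta = mom pi h q' `^ (q / (q' - 1)).
    rewrite /delta (renyi_mom q'1 D fq') /= /powR gt_eqF//; congr expR.
    by rewrite mulrA mulrAC.
  exists h; split=> //.
    by rewrite dE; exact: (delta_ge1 q2 lh h0 h1 qq' fq').
  move=> r s t r0 s0 st; rewrite dE.
  exact: (diss_moment hV hpi hk hsemi hcore hwpi q2 lh h0 h1 fq qq' fq' r0 s0 st).
have dom : rho `<< pi.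
  by move: fin; rewrite /renyi; case: asboolP => // _; rewrite ltxx.
have [g Dg] := density_ex dom; have [M [M1 RM gM]] := renyi_oo Dg fin.
have [mg g0 _] := Dg.
(* The density is only essentially bounded; cutting it at M changes it on a null set and makes the
   bound hold everywhere, as the kernels see pointwise values. *)
pose h x := Num.min (g x) M.
have M0 : 0 < M by apply: lt_le_trans M1.
have mh : measurable_fun setT h by apply: measurable_minr => //; exact: measurable_cst.
have h0 x : 0 <= h x by rewrite le_min g0 ltW.
have hM x : h x <= M by rewrite ge_min lexx orbT.
have D : density rho pi h.
  by apply: density_ae Dg mh h0 _; apply: filterS gM => x gx; rewrite /h min_l.
have h1 := density_mass D.
have lh : L2 pi h by apply: (@L2_bnd _ _ _ _ _ M) => // x; rewrite ger0_norm.
have q0 : 0 <= q by lra.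
have fq : fmom pi h q.
  apply: L2_int; apply: (@L2_bnd _ _ _ _ _ (M `^ q)); first exact: measurable_powRf.
  by move=> x; rewrite ger0_norm ?powR_ge0//; exact: powR_le.
have dE : delta = M `^ q by rewrite /delta RM /= /powR gt_eqF.
exists h; split=> //.
  by rewrite dE -(powRr0 M); exact: ler_powR.
move=> r s t r0 s0 st; rewrite dE.
exact: (diss_bounded hV hpi hk hsemi hcore hwpi q2 lh h0 h1 fq M0 hM r0 s0 st).
Qed.

End assembly.

Theorem theorem2 (R : realType) (d : nat) (hd : (0 < d)%N)
  (V : 'rV[R]_d -> R) (hV : C1 V)
  (pi : probability 'rV[R]_d R) (hpi : gibbs V pi)
  (beta_WPI : R -> R)
  (hwpi : weak_poincare pi beta_WPI (fun f => (osc f ^+ 2)%E))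
  (* the Langevin diffusion, its transition function and its generator *)
  (k : R -> R.-pker 'rV[R]_d ~> 'rV[R]_d) (hk : langevin_transition V k)
  (hsemi : L2_contraction_semigroup k pi) (hcore : smooth_core V k pi)
  (dW : measure_display) (W : measurableType dW) (P : probability W R)
  (F : R -> set (set W)) (B X : R -> {RV P >-> 'rV[R]_d})
  (hX : langevin_diffusion V k F B X)
  (q : R) (q' : \bar R) (hq : 2 <= q) (hqq' : (q%:E < q')%E)
  (hfin : (renyi q' (distribution P (X 0%R)) pi < +oo)%E) :
  let Rq (t : R) : \bar R := renyi q%:E (distribution P (X t)) pi in
  let delta0 : R := expR (q * fine (renyi q' (distribution P (X 0%R)) pi)) in
  let beta : R -> R := renyi_rate beta_WPI q q' in
  (forall r t : R, 0 < r -> 0 <= t ->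
    ((1 <= Rq 0%R -> 1 <= Rq t ->
      Rq t <= Rq 0%R - ((2 - 4 * r * delta0) / (beta r * q) * t)%:E)%E
    /\
    (Rq 0%R < 1 ->
      Rq t <= (expR (- (2 * t / (beta r * q))))%:E
                * (Rq 0%R - (2 * r * delta0)%:E) + (2 * r * delta0)%:E)%E))
  /\
  (forall eps T : R, 0 < eps -> 0 <= T ->
    ((q * beta (1 / (4 * delta0)))%:E * Rq 0%R
      + (q / 2 * beta (eps / (4 * delta0)) * ln (1 / eps))%:E <= T%:E)%E ->
    (Rq T <= eps%:E)%E).
Proof.
move=> Rq delta0 beta.
have [h [D lh fq d1 HD]] := initial_density hV hpi hk hsemi hcore hwpi hq hqq' hfin.
rewrite -/delta0 in d1 HD.
have [mh h0 _] := D; have h1 := density_mass D.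
pose G t := mom pi (semigroup k t h) q.
have G1 t : 0 <= t -> 1 <= G t by exact: (F_ge1 hV hpi hk hsemi hcore hq lh h0 h1 fq).
have Gnd s t : 0 <= s -> s <= t -> G t <= G s by exact: (F_nd hV hpi hk hsemi hcore hq lh h0 fq).
have Glsc c : (forall t, 0 < t -> G t <= c) -> G 0 <= c.
  exact: (F_lsc hV hpi hk hsemi hcore hq lh h0 fq).
have b0 r : 0 < r -> 0 <= beta r.
  by apply: renyi_rate_ge0 => // r' r'0; exact: (wpi_weight_ge0 hwpi r'0).
have bn r s : 0 < r -> r <= s -> beta s <= beta r.
  apply: renyi_rate_noninc => //; last by lra.
    by move=> r' r'0; exact: (wpi_weight_ge0 hwpi r'0).
  by move=> r' s' r'0 rs; exact: (wpi_weight_noninc hwpi r'0 rs).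
have q1 : 1 < q by lra.
(* The divergences are finite at all times, so the extended-real claims reduce to real ones. *)
have RE t : 0 <= t -> Rq t = (Rn q G t)%:E.
  move=> t0; have Dt := law_density hV hpi hk hsemi hcore hX t0 D lh.
  exact: (renyi_mom q1 Dt (F_fin hV hpi hk hsemi hcore hq lh h0 fq t0)).
split=> [r t r0 t0|eps T e0 T0].
  rewrite (RE 0 (lexx 0)) (RE t t0); split=> [_ Rt|R0].
    rewrite lee_fin in Rt; rewrite -EFinB lee_fin.
    exact: (decay_large hq d1 G1 Gnd b0 HD r0 t0 Rt).
  rewrite lte_fin in R0; rewrite -EFinB -EFinM -EFinD lee_fin.
  have := decay_small hq d1 G1 Gnd b0 HD r0 (lexx 0) t0 (ltW R0).
  by rewrite subr0.
rewrite (RE 0 (lexx 0)) (RE T T0) -EFinM -EFinD !lee_fin => H.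
exact: (decay_time hq d1 G1 Gnd b0 bn HD Glsc e0 T0 H).
Qed.
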